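(* The parameterized cograph edge-edition problem has a cubic vertex kernel. That is, there is a polynomial time algorithm which, given a finite simple undirected graph $G$ and an integer $k\geqslant 0$, outputs a graph $G'$ and an integer $k'\geqslant 0$ such that $(G,k)$ is a positive instance of the parameterized cograph edge-edition problem if and only if $(G',k')$ is, where $G'$ has $O(k^3)$ vertices and $k'$ is bounded by a computable function of $k$.
   Context: Graphs are finite, undirected, without loops or multiple edges. A cograph is a graph containing no induced path on four vertices ($P_4$); equivalently, a graph that can be constructed from single-vertex graphs by a sequence of disjoint unions and complete joins. Parameterized cograph edge-edition problem. Input: a graph $G=(V,E)$. Parameter: an integer $k\geqslant 0$. Question: is there a set $F$ of pairs of distinct vertices of $V$ with $|F|\leqslant k$ such that $H=(V,E\vartriangle F)$ is a cograph? Here $\vartriangle$ denotes symmetric difference. A kernelization of a parameterized problem $Q$ is a polynomial time algorithm that transforms an instance $(x,k)$ into an instance $(x',k')$ such that $(x,k)\in Q\Leftrightarrow (x',k')\in Q$ and $|x'|,k'\leqslant h(k)$ for some computable function $h$. The output is called a kernel. A cubic vertex kernel for a graph problem is a kernel whose graph has $O(k^3)$ vertices. *)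

(* Defs.v *)
From mathcomp Require Import all_boot.

Set Implicit Arguments.
Unset Strict Implicit.
Unset Printing Implicit Defensive.

(* A simple graph on T is given by its edge set, a set of 2-element sets. *)

Section EdgeSets.

Variable T : finType.
Implicit Types (E F : {set {set T}}) (x y a b c d : T).

Definition edge_set E : bool := [forall e in E, #|e| == 2].

Definition adj E x y : bool := [set x; y] \in E.

Definition induced_P4 E a b c d : bool :=
  [&& uniq [:: a; b; c; d],
      adj E a b, adj E b c, adj E c d,
      ~~ adj E a c, ~~ adj E b d & ~~ adj E a d].

Definition cograph E : Prop := forall a b c d, ~~ induced_P4 E a b c d.

Definition symdiff E F : {set {set T}} := (E :\: F) :|: (F :\: E).

End EdgeSets.

Record graph := Graph {
  nvertices : nat;
  edges : {set {set 'I_nvertices}};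
  edgesP : edge_set edges
}.

Definition cograph_edge_edition (G : graph) (k : nat) : Prop :=
  exists F : {set {set 'I_(nvertices G)}},
    [/\ edge_set F, #|F| <= k & cograph (symdiff (edges G) F)].

(* The machine model is N. Jones's WHILE language ("Computability and
   Complexity from a Programming Perspective"), whose values are binary trees.
   Instead of one time unit, an assignment is charged the size of the assigned
   tree plus that of the expression. Hence no sharing of subtrees is exploited:
   the assigned variables never hold more nodes in all than the input size plus
   the elapsed time, and time is polynomially related to Turing machine time. *)

Inductive data := Nil | Cons of data & data.

Fixpoint dsize (v : data) : nat :=
  if v is Cons a b then (dsize a + dsize b).+1 else 1.

Definition dhd (v : data) : data := if v is Cons a _ then a else Nil.
Definition dtl (v : data) : data := if v is Cons _ b then b else Nil.

Inductive expr :=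
  | EVar of nat
  | ENil
  | ECons of expr & expr
  | EHd of expr
  | ETl of expr.

Inductive cmd :=
  | Skip
  | Assign of nat & expr
  | Seq of cmd & cmd
  | If of expr & cmd & cmd
  | While of expr & cmd.

Definition store := nat -> data.

Definition update (s : store) (x : nat) (v : data) : store :=
  fun y => if y == x then v else s y.

Fixpoint eval (s : store) (e : expr) : data :=
  match e with
  | EVar x => s x
  | ENil => Nil
  | ECons e1 e2 => Cons (eval s e1) (eval s e2)
  | EHd e1 => dhd (eval s e1)
  | ETl e1 => dtl (eval s e1)
  end.

Fixpoint esize (e : expr) : nat :=
  match e with
  | EVar _ | ENil => 1
  | ECons e1 e2 => (esize e1 + esize e2).+1
  | EHd e1 | ETl e1 => (esize e1).+1
  end.

(* [exec c s s' t]: started in s, c halts in s' after time t. Tests hold when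
   the value is not Nil. *)
Inductive exec : cmd -> store -> store -> nat -> Prop :=
  | exec_skip s : exec Skip s s 1
  | exec_assign s x e :
      exec (Assign x e) s (update s x (eval s e)) (esize e + dsize (eval s e))
  | exec_seq c1 c2 s1 s2 s3 t1 t2 :
      exec c1 s1 s2 t1 -> exec c2 s2 s3 t2 -> exec (Seq c1 c2) s1 s3 (t1 + t2)
  | exec_if_true e c1 c2 s s' t :
      eval s e <> Nil -> exec c1 s s' t -> exec (If e c1 c2) s s' (esize e + t)
  | exec_if_false e c1 c2 s s' t :
      eval s e = Nil -> exec c2 s s' t -> exec (If e c1 c2) s s' (esize e + t)
  | exec_while_true e c s1 s2 s3 t1 t2 :
      eval s1 e <> Nil -> exec c s1 s2 t1 -> exec (While e c) s2 s3 t2 ->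
      exec (While e c) s1 s3 (esize e + t1 + t2)
  | exec_while_false e c s :
      eval s e = Nil -> exec (While e c) s s (esize e).

(* Input and output are passed in variable 0. *)
Definition init (v : data) : store := update (fun=> Nil) 0 v.

Definition runs (p : cmd) (input output : data) (t : nat) : Prop :=
  exists2 s, exec p (init input) s t & s 0 = output.

Definition computable (X Y : Type) (encX : X -> data) (encY : Y -> data)
    (f : X -> Y) : Prop :=
  exists p : cmd, forall x, exists t, runs p (encX x) (encY (f x)) t.

Definition polytime (X Y : Type) (encX : X -> data) (encY : Y -> data)
    (f : X -> Y) : Prop :=
  exists (p : cmd) (a d : nat), forall x, exists2 t,
    runs p (encX x) (encY (f x)) t & t <= a * dsize (encX x) ^ d + a.

Definition enc_bool (b : bool) : data := if b then Cons Nil Nil else Nil.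

Definition enc_seq (X : Type) (enc : X -> data) (s : seq X) : data :=
  foldr (fun x v => Cons (enc x) v) Nil s.

Definition enc_pair (X Y : Type) (encX : X -> data) (encY : Y -> data)
    (z : X * Y) : data :=
  Cons (encX z.1) (encY z.2).

(* Binary notation, least significant bit first; [up_log 2 k.+1] is the number
   of binary digits of k (none for 0). *)
Definition binary (k : nat) : seq bool :=
  mkseq (fun i => odd (k %/ 2 ^ i)) (up_log 2 k.+1).

Definition enc_nat (k : nat) : data := enc_seq enc_bool (binary k).

(* Adjacency matrix, row by row. *)
Definition enc_graph (G : graph) : data :=
  enc_seq (enc_seq enc_bool)
    [seq [seq adj (edges G) i j | j <- enum 'I_(nvertices G)]
       | i <- enum 'I_(nvertices G)].

(* A parameterized problem on X is given by the predicate Q selecting its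
   positive instances. *)
Definition kernelization (X : Type) (enc : X -> data) (Q : X -> nat -> Prop)
    (K : X * nat -> X * nat) : Prop :=
  [/\ polytime (enc_pair enc enc_nat) (enc_pair enc enc_nat) K,
      forall x k, Q x k <-> Q (K (x, k)).1 (K (x, k)).2
    & exists2 h : nat -> nat, computable enc_nat enc_nat h &
        forall x k, dsize (enc (K (x, k)).1) <= h k /\ (K (x, k)).2 <= h k].

(* Main.v *)
(** A pair of vertices that, together with many pairwise disjoint pairs, spans
    P4s has to be edited; such pairs are edited first, lowering k, until no
    large "sunflower" of P4s is left. If M is a module, a P4 meets M in at most
    one vertex or lies inside M, and a solution can be made uniform on M by
    copying its cheapest vertex; hence editing G costs exactly as much as
    editing G[M] plus editing G without the edges inside M. So G is split along
    minimal modules containing an edge until none of them separates edges from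
    edges. Finally, of more than 2k+1 vertices with the same neighbourhood only
    2k+1 are kept.

    For the size of the result, decompose an optimal solution H as a cotree. The
    vertices that hang off a path of the cotree without being touched by an edit
    form modules of G, so they are independent and twins if they hang off
    consecutive nodes of the same kind. An edit between a vertex below the path
    and one outside its upper end forms a P4 with two vertices hanging off a
    union and a join node in the right order, and these P4s are disjoint apart
    from the edited pair, so the path carries O(k) classes of twins;
    there are O(k) paths in total and each class has O(k) vertices. *)

Require Import Defs.
From mathcomp Require Import all_boot.
From mathcomp Require Import zify.
From Stdlib Require Import Classical.

Set Implicit Arguments.
Unset Strict Implicit.
Unset Printing Implicit Defensive.

(** * Modules and substitution *)

(** Splitting along modules turns G into several graphs on the same vertex set whose costs add up.
    They are put side by side as a disjoint union, where costs add up as well, so one graph with one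
    budget comes out and k need not be distributed in advance. Pieces without a P4 cost nothing and
    are dropped; each remaining piece needs an edit, and this edit absorbs the additive constants of
    its size bound. The size bound uses two properties of a piece. Sunflowers in it are small,
    because splitting creates no new P4 and a greedy sunflower is within a factor of two of a
    largest one. And each module with an edge contains all edges; together with the optimality of H
    this forces every module of H that touches edits, yet misses an edge, to be left by an edit.
    That edit is the centre of the sunflower which bounds the length of a path of the cotree. The
    cotree is never built. Induction over its nodes carries a potential, in which each edited vertex
    pays for a bounded number of classes. *)

Definition p4 (T : Type) (e : rel T) a b c d :=
  [&& e a b, e b c, e c d, ~~ e a c, ~~ e b d & ~~ e a d].

Section Graphs.

Variable T : finType.
Implicit Types (e h g : rel T) (M W : {set T}).

Definition sgraph e := symmetric e /\ irreflexive e.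

Definition p4free e := forall a b c d, ~~ p4 e a b c d.

(* Ordered pairs are counted, so that k edits amount to distance 2k. *)
Definition dist e h := \sum_x \sum_y (e x y != h x y : nat).

Definition editable e m := exists h, [/\ sgraph h, p4free h & dist e h <= m].

Definition module e M := forall x y z,
  x \in M -> y \in M -> z \notin M -> e x z = e y z.

Definition inside e M : rel T := fun x y => [&& x \in M, y \in M & e x y].

Definition outside e M : rel T := fun x y => ~~ ((x \in M) && (y \in M)) && e x y.

(** Substitution in the sense of modular decomposition: M becomes a module that has the outer
    neighbours of [u] and [g] as its inner graph. *)
Definition subst h g M u : rel T := fun x y =>
  if x \in M then if y \in M then g x y else h u y
  else if y \in M then h x u else h x y.

Lemma eq_p4free e h : e =2 h -> p4free e -> p4free h.
Proof. by move=> eh He a b c d; have := He a b c d; rewrite /p4 !eh. Qed.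

Lemma eq_sgraph e h : e =2 h -> sgraph e -> sgraph h.
Proof.
by move=> eh [es ei]; split=> [x y|x]; rewrite -!eh ?ei // es.
Qed.

Lemma eq_dist e e' h : e =2 e' -> dist e h = dist e' h.
Proof. by move=> ee; apply: eq_bigr => x _; apply: eq_bigr => y _; rewrite ee. Qed.

Lemma eq_editable e e' m : e =2 e' -> editable e m -> editable e' m.
Proof. by move=> ee [h [? ? d]]; exists h; split=> //; rewrite -(eq_dist _ ee). Qed.

Lemma leq_editable e m n : m <= n -> editable e m -> editable e n.
Proof. by move=> mn [h [? ? d]]; exists h; split=> //; apply: leq_trans mn. Qed.

Lemma sgraph_inside e M : sgraph e -> sgraph (inside e M).
Proof.
case=> es ei; split=> [x y|x]; rewrite /inside ?ei ?andbF //.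
by rewrite es andbCA.
Qed.

Lemma sgraph_outside e M : sgraph e -> sgraph (outside e M).
Proof.
case=> es ei; split=> [x y|x]; rewrite /outside ?ei ?andbF //.
by rewrite es (andbC (x \in M)).
Qed.

Lemma p4free_inside e M : p4free e -> p4free (inside e M).
Proof.
move=> He a b c d; apply/negP; rewrite /p4 /inside.
case/and5P=> /and3P[aM bM ab] /and3P[_ cM bc] /and3P[_ dM cd].
rewrite aM bM cM dM /= => ac /andP[bd ad].
by have := He a b c d; rewrite /p4 ab bc cd ac bd ad.
Qed.

Lemma sgraph_subst h g M u : sgraph h -> sgraph g -> sgraph (subst h g M u).
Proof.
move=> [hs hi] [gs gi]; split=> [x y|x]; rewrite /subst.
  by case: (x \in M); case: (y \in M).
by case: (x \in M).
Qed.

(* A P4 has no nontrivial module, so it meets M in at most one vertex or lies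
   inside M. *)
Lemma p4free_subst h g M u : sgraph h -> p4free h -> p4free g ->
  p4free (subst h g M u).
Proof.
move=> [hs hi] Hh Hg a b c d; rewrite /p4 /subst.
have := Hg a b c d; rewrite /p4.
have := (Hh a b c d, Hh u b c d, Hh a u c d, Hh a b u d, Hh a b c u).
rewrite /p4 !(hs _ u).
case: (a \in M); case: (b \in M); case: (c \in M); case: (d \in M);
  case: (h u a); case: (h u b); case: (h u c); case: (h u d) => //=;
  rewrite ?(andbF, andbT) //=; by case=> [[[[]]]].
Qed.

Lemma leq_min_avg (M : {set T}) u0 (f : T -> nat) : u0 \in M ->
  exists2 u, u \in M & #|M| * f u <= \sum_(x in M) f x.
Proof.
move=> u0M; case: (arg_minnP f u0M) => u uM umin; exists u => //.
by rewrite -sum_nat_const; apply: leq_sum => x; apply: umin.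
Qed.

Definition dist_on e h (P Q : pred T) :=
  \sum_(x | P x) \sum_(y | Q y) (e x y != h x y : nat).

Lemma dist_onID e h P Q : dist_on e h P predT =
  dist_on e h P Q + dist_on e h P (predC Q).
Proof.
by rewrite /dist_on -big_split /=; apply: eq_bigr => x _; rewrite (bigID Q).
Qed.

Lemma dist_onIDl e h P Q : dist_on e h predT Q =
  dist_on e h P Q + dist_on e h (predC P) Q.
Proof. by rewrite /dist_on (bigID P). Qed.

Lemma dist_onC e h P Q : sgraph e -> sgraph h ->
  dist_on e h P Q = dist_on e h Q P.
Proof.
move=> [es _] [hs _]; rewrite /dist_on exchange_big /=.
by apply: eq_bigr => x _; apply: eq_bigr => y _; rewrite es hs.
Qed.

Lemma dist_split e h M : sgraph e -> sgraph h ->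
  dist e h = dist_on e h (mem M) (mem M)
             + (dist_on e h (mem M) (predC (mem M))).*2
             + dist_on e h (predC (mem M)) (predC (mem M)).
Proof.
move=> sge sgh; rewrite -[dist e h]/(dist_on e h predT predT).
rewrite (dist_onID _ _ _ (mem M)) !(dist_onIDl _ _ (mem M)) -addnn.
by rewrite (@dist_onC _ _ (predC (mem M)) (mem M)) // !addnA.
Qed.

Lemma eq_dist_on e h e' h' (P Q : pred T) :
  (forall x y, P x -> Q y -> (e x y != h x y) = (e' x y != h' x y)) ->
  dist_on e h P Q = dist_on e' h' P Q.
Proof.
by move=> E; apply: eq_bigr => x Px; apply: eq_bigr => y Qy; rewrite E.
Qed.

Lemma dist_on0 e h (P Q : pred T) :
  (forall x y, P x -> Q y -> e x y = h x y) -> dist_on e h P Q = 0.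
Proof.
by move=> E; rewrite /dist_on big1 // => x Px; rewrite big1 // => y Qy;
  rewrite E ?eqxx.
Qed.

(* Copying a vertex u of M with the fewest edits towards the complement of M
   does not increase the number of edits between M and its complement. *)
Lemma dist_subst e h g M u0 : sgraph e -> sgraph h -> sgraph g ->
  module e M -> u0 \in M ->
  exists2 u, u \in M & dist e (subst h g M u) <=
    dist_on e g (mem M) (mem M) + (dist e h - dist_on e h (mem M) (mem M)).
Proof.
move=> sge sgh sgg Mm u0M.
pose f x := \sum_(y in predC (mem M)) (e x y != h x y : nat).
have [u uM ule] := leq_min_avg f u0M; exists u => //.
rewrite (dist_split M sge (sgraph_subst M u sgh sgg)) (dist_split M sge sgh).
have -> : dist_on e (subst h g M u) (mem M) (mem M) = dist_on e g (mem M) (mem M).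
  by apply: eq_dist_on => x y /= xM yM; rewrite /subst xM yM.
have -> : dist_on e (subst h g M u) (predC (mem M)) (predC (mem M))
          = dist_on e h (predC (mem M)) (predC (mem M)).
  by apply: eq_dist_on => x y /= xM yM; rewrite /subst (negPf xM) (negPf yM).
have le : dist_on e (subst h g M u) (mem M) (predC (mem M))
          <= dist_on e h (mem M) (predC (mem M)).
  apply: leq_trans ule; rewrite -sum_nat_const; apply: leq_sum => x /= xM.
  apply: leq_sum => y /= yM; rewrite /subst xM (negPf yM).
  by rewrite (Mm x u y).
lia.
Qed.

Lemma dist_inside e h M : dist (inside e M) (inside h M) =
  dist_on e h (mem M) (mem M).
Proof.
rewrite /dist /dist_on [RHS]big_mkcond; apply: eq_bigr => x _ /=.
rewrite /inside; case: (x \in M) => /=; last by rewrite big1.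
rewrite [RHS]big_mkcond; apply: eq_bigr => y _ /=.
by case: (y \in M).
Qed.

Lemma dist_on_le e h P Q : dist_on e h P Q <= dist e h.
Proof.
rewrite /dist /dist_on [leqRHS](bigID P) /=; apply: leq_trans (leq_addr _ _).
by apply: leq_sum => x _; rewrite [leqRHS](bigID Q) /= leq_addr.
Qed.

Lemma sgraph0 : sgraph (fun _ _ => false).
Proof. by []. Qed.

Lemma p4free0 : p4free (fun _ _ => false).
Proof. by []. Qed.

Lemma module_outside e M : module e M -> module (outside e M) M.
Proof.
by move=> Mm x y z xM yM zM; rewrite /outside (negPf zM) !andbF /= (Mm x y z).
Qed.

(** Restricting a solution to M gives the inner half. For the outer half the solution is emptied
    inside M, and the whole of M copies its cheapest vertex. Conversely, the inner solution is
    substituted into the outer one at the vertex of M that is cheapest there. *)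
Lemma editable_split e M m u0 : sgraph e -> module e M -> u0 \in M ->
  editable e m <->
  exists m1 m2, [/\ m1 + m2 <= m, editable (inside e M) m1
                  & editable (outside e M) m2].
Proof.
move=> sge Mm u0M; split=> [[h [sgh p4h hm]]|].
  have [sgo Mo] := (sgraph_outside M sge, module_outside Mm).
  have [u uM] := dist_subst sge sgh sgraph0 Mm u0M.
  set h2 := subst _ _ _ _ => le2.
  (* [h2] has no edge inside M, so passing from [e] to [outside e M] saves exactly the edges of [e]
     inside M. *)
  have E2 : dist (outside e M) h2 = dist e h2 - dist_on e (fun _ _ => false) (mem M) (mem M).
    have sg2 : sgraph h2 by exact: sgraph_subst.
    rewrite (dist_split M sgo sg2) (dist_split M sge sg2).
    rewrite dist_on0 => [|x y /= xM yM]; last by rewrite /outside /h2 /subst xM yM.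
    rewrite [dist_on e h2 (mem M) (mem M)](_ : _ =
      dist_on e (fun _ _ => false) (mem M) (mem M)); last first.
      by apply: eq_dist_on => x y /= xM yM; rewrite /h2 /subst xM yM.
    rewrite (@eq_dist_on (outside e M) h2 e h2) => [|x y /= xM yM]; last first.
      by rewrite /outside (negPf yM) andbF.
    rewrite (@eq_dist_on (outside e M) h2 e h2 (predC _)) => [|x y /= xM yM]; last first.
      by rewrite /outside (negPf yM) andbF.
    lia.
  have le1 := dist_on_le e h (mem M) (mem M).
  exists (dist_on e h (mem M) (mem M)), (dist (outside e M) h2); split.
  - rewrite E2; lia.
  - exists (inside h M); rewrite dist_inside; split=> //.
      exact: sgraph_inside.
    exact: p4free_inside.
  - exists h2; split=> //; first exact: sgraph_subst.
    exact: p4free_subst.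
case=> m1 [m2 [le12 [h1 [sg1 p41 d1]] [h2 [sg2 p42 d2]]]].
have [sgo Mo] := (sgraph_outside M sge, module_outside Mm).
have [u uM le] := dist_subst sgo sg2 sg1 Mo u0M.
have sgs := sgraph_subst M u sg2 sg1.
exists (subst h2 h1 M u); split=> //; first exact: p4free_subst.
apply: leq_trans le12; apply: leq_trans (leq_add d1 d2).
move: le; rewrite (dist_split M sgo sgs) (dist_split M sge sgs).
rewrite [dist_on (outside e M) _ (mem M) (predC _)](@eq_dist_on _ _ e (subst h2 h1 M u))
   => [|x y /= xM yM]; last first.
  by rewrite /outside (negPf yM) andbF.
rewrite [dist_on (outside e M) _ (predC _) (predC _)](@eq_dist_on _ _ e (subst h2 h1 M u))
   => [|x y /= xM yM]; last first.
  by rewrite /outside (negPf yM) andbF.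
rewrite [dist_on _ (subst h2 h1 M u) (mem M) (mem M)](@eq_dist_on _ _ (outside e M) h1)
  => [|x y /= xM yM]; last by rewrite /subst xM yM.
have -> : dist_on e (subst h2 h1 M u) (mem M) (mem M)
   = dist_on (inside e M) h1 (mem M) (mem M).
  by apply: eq_dist_on => x y /= xM yM; rewrite /subst /inside xM yM.
have := dist_on_le (inside e M) h1 (mem M) (mem M).
have := dist_on_le (outside e M) h2 (mem M) (mem M).
lia.
Qed.

End Graphs.

(** * Reduction rules *)

(** The two positions of x, y in a P4 that [altern_petal] produces: at distance two if the edit
    inserts xy, an end edge with end y if it deletes xy. *)
Definition petal (T : Type) (e : rel T) x y (p : T * T) := p4 e x p.1 y p.2 || p4 e y x p.1 p.2.

Definition apart (T : eqType) (p q : T * T) :=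
  [&& p.1 != q.1, p.1 != q.2, p.2 != q.1 & p.2 != q.2].

Section Reductions.

Variable T : finType.
Implicit Types (e h g : rel T) (M W : {set T}).

Lemma dist_card e h : dist e h = #|[set p | e p.1 p.2 != h p.1 p.2]|.
Proof.
rewrite /dist pair_bigA /= -sum1dep_card [RHS]big_mkcond /=.
by apply: eq_bigr => p _; case: (_ != _).
Qed.

Lemma editable_inside e M m : editable e m -> editable (inside e M) m.
Proof.
case=> h [sgh p4h hm]; exists (inside h M); split.
- exact: sgraph_inside.
- exact: p4free_inside.
- by rewrite dist_inside; apply: leq_trans hm; apply: dist_on_le.
Qed.

Definition pair_flip (x y : T) : rel T := fun u v =>
  (u == x) && (v == y) || (u == y) && (v == x).

Definition flip e x y : rel T := fun u v => e u v (+) pair_flip x y u v.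

Lemma sgraph_flip e x y : x != y -> sgraph e -> sgraph (flip e x y).
Proof.
move=> xy [es ei]; split=> [u v|u]; rewrite /flip /pair_flip.
  by rewrite es orbC (andbC (u == y)) (andbC (u == x)).
rewrite ei andbC orbb; case: eqP => //= ->; apply/negbTE.
by rewrite eq_sym.
Qed.

Lemma dist_trans e g h : dist e h <= dist e g + dist g h.
Proof.
rewrite /dist -big_split; apply: leq_sum => x _; rewrite -big_split.
by apply: leq_sum => y _; case: (e x y); case: (g x y); case: (h x y).
Qed.

Lemma distC e h : dist e h = dist h e.
Proof. by apply: eq_bigr => x _; apply: eq_bigr => y _; rewrite eq_sym. Qed.

Lemma dist_flip e x y : x != y -> dist e (flip e x y) = 2.
Proof.
move=> xy; rewrite dist_card; set D := [set p | _].
have -> : D = [set (x, y); (y, x)].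
  apply/setP=> -[u v]; rewrite !inE /= !xpair_eqE /flip /pair_flip.
  by case: (e u v); case: (_ || _).
by rewrite cards2 xpair_eqE negb_and xy.
Qed.

Lemma dist_flip_edited e h x y : sgraph e -> sgraph h -> x != y ->
  e x y != h x y -> dist e h = (dist (flip e x y) h).+2.
Proof.
move=> [es _] [hs _] xy exy; rewrite !dist_card.
set D := [set p | _]; rewrite (cardsD1 (x, y) D) (cardsD1 (y, x) (D :\ _)).
rewrite !inE /= exy es hs exy xpair_eqE eq_sym (negPf xy) /=.
rewrite !add1n; congr _.+2; apply: eq_card => -[u v].
rewrite !inE /= !xpair_eqE /flip /pair_flip.
have [/andP[/eqP-> /eqP->]|nyx] := boolP ((u == y) && (v == x)).
  by rewrite orbT /=; move: exy; rewrite (es x) (hs x); case: (e y x); case: (h y x).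
have [/andP[/eqP-> /eqP->]|nxy] := boolP ((u == x) && (v == y)).
  by rewrite /=; move: exy; case: (e x y); case: (h x y).
by rewrite /= addbF.
Qed.

Definition sunflower e x y l := pairwise (@apart T) l && all (petal e x y) l.

Lemma p4_uniq e a b c d : sgraph e -> p4 e a b c d -> uniq [:: a; b; c; d].
Proof.
move=> [es ei] /and5P[ab bc cd ac /andP[bd ad]]; rewrite /= !inE !negb_or.
have ne x y : e x y -> x != y by apply: contraTneq => ->; rewrite ei.
have ac' : a != c by apply: contraNneq ad => ->.
have ad' : a != d by apply: contraNneq ac => ->; rewrite es.
have bd' : b != d by apply: contraNneq ad => <-.
by rewrite ac' ad' bd' (ne _ _ ab) (ne _ _ bc) (ne _ _ cd).
Qed.

Lemma apart_sym : symmetric (@apart T).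
Proof.
move=> [a b] [c d]; rewrite /apart /= (eq_sym a c) (eq_sym a d) (eq_sym b c).
by rewrite (eq_sym b d); do !case: (_ != _).
Qed.

Lemma pairwise_in (A : eqType) (r : rel A) s : symmetric r -> pairwise r s ->
  forall p q, p \in s -> q \in s -> p != q -> r p q.
Proof.
move=> rs; elim: s => [//|a s IH] /= /andP[/allP ra /IH{}IH] p q.
rewrite !inE => /orP[/eqP->|ps] /orP[/eqP->|qs]; first by rewrite eqxx.
- by move=> _; apply: ra.
- by move=> _; rewrite rs; apply: ra.
- exact: IH.
Qed.

(** If xy were left alone, every petal would need another edited pair, with an end among its own two
    vertices. Petals are disjoint, so these pairs differ, and each of them counts in both orders. *)
Lemma sunflower_edited e h x y l m : sgraph e -> sgraph h -> p4free h ->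
  x != y -> sunflower e x y l -> dist e h <= m -> m < (size l).*2 ->
  e x y != h x y.
Proof.
move=> [es ei] [hs hi] p4h xy /andP[pw /allP pt] hm ml; apply/negP => /eqP exy.
(* The second entry is required to lie in the petal proper; it is this entry that tells witnesses of
   different petals apart. *)
pose good (p sq : T * T) := [&& sq.1 \in [:: x; y; p.1; p.2],
  sq.2 \in [:: p.1; p.2] & e sq.1 sq.2 != h sq.1 sq.2].
have goodP p : p \in l -> exists sq, good p sq.
  move=> pl; apply/existsP; rewrite -[X in is_true X]negbK; apply/negP => /existsPn N.
  have E s q : s \in [:: x; y; p.1; p.2] -> q \in [:: p.1; p.2] -> h s q = e s q.
    by move=> si qi; have := N (s, q); rewrite /good si qi /= negbK => /eqP.
  have [p1 p2] : (p.1 \in [:: p.1; p.2]) * (p.2 \in [:: p.1; p.2]).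
    by rewrite !inE !eqxx orbT.
  have xi : x \in [:: x; y; p.1; p.2] by rewrite !inE eqxx.
  have yi : y \in [:: x; y; p.1; p.2] by rewrite !inE eqxx orbT.
  have [q1 q2] : (p.1 \in [:: x; y; p.1; p.2]) * (p.2 \in [:: x; y; p.1; p.2]).
    by rewrite !inE !eqxx !orbT.
  case/orP: (pt _ pl) => P.
    have := p4h x p.1 y p.2; move: P; rewrite /p4 -exy (hs p.1 y) (es p.1 y).
    by rewrite !E // => ->.
  have := p4h y x p.1 p.2; move: P; rewrite /p4 (hs y x) -exy (es y x).
  by rewrite !E // => ->.
pose f p := odflt (x, y) [pick sq | good p sq].
have fP p : p \in l -> good p (f p).
  by move=> /goodP[sq Hsq]; rewrite /f; case: pickP => [//|/(_ sq)]; rewrite Hsq.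
have apartP := pairwise_in apart_sym pw.
have petal_out p : p \in l -> (x \notin [:: p.1; p.2]) && (y \notin [:: p.1; p.2]).
  move=> /pt /orP[] /(p4_uniq (conj es ei)) /and4P[]; rewrite !inE !negb_or.
    by move=> /and3P[-> _ ->] /andP[p1y _] -> _; rewrite eq_sym p1y.
  by move=> /and3P[_ -> ->] /andP[-> ->] _ _.
have sep p q : p \in l -> q \in l -> p != q -> forall z,
    z \in [:: p.1; p.2] -> z \in [:: x; y; q.1; q.2] -> False.
  move=> pl ql pq z zp zq; have /and4P[a b c d] := apartP _ _ pl ql pq.
  have := petal_out p pl; move: zp zq; rewrite !inE.
  by case/orP => /eqP->; rewrite ?(negPf a) ?(negPf b) ?(negPf c) ?(negPf d) !orbF;
    case/orP=> /eqP<-; rewrite eqxx ?orbT ?andbF.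
have sub z q : z \in [:: q.1; q.2] -> z \in [:: x; y; q.1; q.2].
  by rewrite !inE => ->; rewrite !orbT.
pose swap (p : T * T) := (p.2, p.1).
have ul : uniq l.
  apply: pairwise_uniq pw => -[a b].
  by rewrite /apart /= eqxx.
have inj : {in l &, injective f}.
  move=> p q pl ql E; have [//|pq] := eqVneq p q; exfalso.
  have /and3P[_ P2 _] := fP _ pl; have /and3P[_ Q2 _] := fP _ ql.
  by apply: (sep p q pl ql pq (f p).2 P2); rewrite E; apply: sub Q2.
have uf : uniq (map f l) by rewrite map_inj_in_uniq.
(* No witness is the reverse of another: its second entry lies in its own petal and so cannot be the
   first entry of a witness for another petal; nor is a vertex ever paired with itself. *)
have u2 : uniq (map f l ++ map swap (map f l)).
  rewrite cat_uniq uf map_inj_uniq ?uf ?andbT; last by move=> [a b] [c d] [-> ->].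
  apply/hasPn => _ /mapP[_ /mapP[p pl ->] ->]; apply/mapP => -[q ql Eq].
  have E2 : (f p).2 = (f q).1 by rewrite -Eq.
  have E1 : (f p).1 = (f q).2 by rewrite -Eq.
  have /and3P[P1 P2 P3] := fP _ pl; have /and3P[Q1 Q2 _] := fP _ ql.
  have [E|pq] := eqVneq p q.
    by move: P3; rewrite E1 -E ei hi.
  by apply: (sep p q pl ql pq (f p).2 P2); rewrite E2.
have: size (map f l ++ map swap (map f l)) <= dist e h.
  rewrite dist_card cardE; apply: uniq_leq_size => // sq.
  rewrite mem_enum inE mem_cat => /orP[/mapP[p /fP/and3P[_ _ ?] ->] //|].
  by move=> /mapP[_ /mapP[p /fP/and3P[_ _ P] ->] ->] /=; rewrite es hs.
rewrite size_cat !size_map addnn => le; move: (leq_trans le hm).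
by rewrite leqNgt ml.
Qed.

Lemma editable_flip e x y l k : sgraph e -> x != y -> sunflower e x y l ->
  k < size l ->
  editable e k.*2 <-> 0 < k /\ editable (flip e x y) k.-1.*2.
Proof.
move=> sge xy sf kl; split=> [[h [sgh p4h hm]]|[k0 [h [sgh p4h hm]]]].
  have kl2 : k.*2 < (size l).*2 by rewrite ltn_double.
  have exy := sunflower_edited sge sgh p4h xy sf hm kl2.
  move: hm; rewrite (dist_flip_edited sge sgh xy exy) => hm.
  split; first by lia.
  by exists h; split=> //; lia.
exists h; split=> //; have := dist_trans e (flip e x y) h.
by rewrite dist_flip //; lia.
Qed.

Definition twin e u v := [forall z, e u z == e v z].

Lemma twinP e u v : reflect (e u =1 e v) (twin e u v).
Proof. by apply: (iffP forallP) => H z; apply/eqP; rewrite ?H. Qed.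

(** Deleting v is modelled by isolating it. Every vertex of S touched by the solution accounts for
    an ordered edited pair, so with more than m vertices some [u] in S is untouched, and v can be
    put back as a non-adjacent copy of [u] at no cost. *)
Lemma editable_del_twin e v (S : {set T}) m : sgraph e -> v \notin S ->
  {in S, forall u, twin e u v} -> m < #|S| ->
  editable (inside e [set~ v]) m -> editable e m.
Proof.
move=> [es ei] vS St mS [h [sgh p4h hm]].
pose E := inside e [set~ v].
have [u uS uh] : exists2 u, u \in S & E u =1 h u.
  have [/existsP[u /andP[uS /forallP H]]|/existsPn N] :=
    boolP [exists u, (u \in S) && [forall z, E u z == h u z]].
    by exists u => // z; apply/eqP.
  exfalso; have : #|S| <= m; last by lia.
  apply: leq_trans hm; rewrite -sum1_card big_mkcond; apply: leq_sum => x _.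
  case: ifP => // xS; have := N x; rewrite xS /= => /forallPn[z Hz].
  by rewrite (bigD1 z) //= -/E Hz leq_addr.
have uv : u != v by apply: contraNneq vS => <-.
have /twinP tw := St u uS.
have uM : u \in [set u; v] by rewrite !inE eqxx.
exists (subst h (fun _ _ => false) [set u; v] u); split.
- exact: sgraph_subst.
- exact: p4free_subst.
apply: leq_trans hm; apply: leq_sum => x _; apply: leq_sum => y _.
have Euz z : z != v -> e u z = h u z.
  by move=> zv; rewrite -uh /E /inside !inE uv zv.
have euv : e u v = false by rewrite tw ei.
rewrite /subst !inE.
have [->|xu] := eqVneq x u; have [->|yu] := eqVneq y u => /=.
- by rewrite ei.
- have [->|yv] := eqVneq y v; first by rewrite euv.
  by rewrite Euz ?eqxx.
- have [->|xv] := eqVneq x v; first by rewrite es euv.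
  by rewrite es Euz // (proj1 sgh) eqxx.
- have [->|xv] := eqVneq x v; have [->|yv] := eqVneq y v => /=.
  + by rewrite ei.
  + by rewrite -tw Euz ?eqxx.
  + by rewrite es -tw Euz // (proj1 sgh) eqxx.
  + by rewrite /inside !inE xv yv.
Qed.

(** The vertices outside X are put back one at a time; the twins that justify each step lie in X and
    hence are present at every stage. *)
Lemma editable_keep e (X : {set T}) m : sgraph e ->
  (forall v, v \notin X -> m < #|[set u in X | twin e u v]|) ->
  editable e m <-> editable (inside e X) m.
Proof.
move=> sge keep; split; first exact: editable_inside.
move=> edX; suff H n (Y : {set T}) : X \subset Y -> #|Y :\: X| <= n -> editable (inside e Y) m.
  apply: eq_editable (H #|T| setT (subsetT _) (max_card _)) => x y.
  by rewrite /inside !inE.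
elim: n Y => [|n IH] Y XY.
  rewrite leqn0 cards_eq0 setD_eq0 => YX.
  by have /eqP<- : X == Y by rewrite eqEsubset XY.
have [/eqP|] := boolP (Y :\: X == set0).
  by move=> D0 _; apply: IH => //; rewrite D0 cards0.
case/set0Pn=> v; rewrite inE => /andP[vX vY] Hn.
have XYv : X \subset Y :\ v.
  by apply/subsetP => x xX; rewrite !inE (subsetP XY) // andbT; apply: contraNneq vX => <-.
apply: (@editable_del_twin _ v [set u in X | twin e u v]).
- exact: sgraph_inside.
- by rewrite inE (negPf vX).
- move=> u; rewrite inE => /andP[uX /twinP tw]; apply/twinP=> z.
  by rewrite /inside (subsetP XY) // vY tw.
- exact: keep.
- apply: (@eq_editable _ (inside e (Y :\ v))).
    move=> x y; rewrite /inside !inE; case: (x != v) => //=; case: (y != v) => //=.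
    by rewrite !andbF.
  apply: IH => //; have := cardsD1 v (Y :\: X); rewrite !inE vX vY /=.
  have -> : (Y :\: X) :\ v = (Y :\ v) :\: X.
    by apply/setP=> z; rewrite !inE; case: (z != v); rewrite ?andbF.
  by lia.
Qed.

End Reductions.

(** * Transport of solutions along injections *)

Section Embedding.

Variables (T1 T2 : finType) (f : T1 -> T2).
Hypothesis f_inj : injective f.

Lemma editable_preim (e : rel T2) m : editable e m -> editable (relpre f e) m.
Proof.
case=> h [[hs hi] p4h hm]; exists (relpre f h); split.
- by split=> [x y|x]; rewrite /= ?hi // hs.
- by move=> a b c d; apply: p4h.
apply: leq_trans hm; rewrite !dist_card.
have finj2 : injective (fun p : T1 * T1 => (f p.1, f p.2)).
  by move=> [a b] [c d] [/f_inj-> /f_inj->].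
rewrite -(card_imset _ finj2); apply: subset_leq_card.
by apply/subsetP => z /imsetP[p + ->]; rewrite !inE.
Qed.

(** Outside the image of [f] all vertices are isolated. A solution extends by leaving them isolated,
    which adds no edit, and no P4 because a P4 has no isolated vertex. *)
Lemma editable_embed (e1 : rel T1) (e2 : rel T2) m :
  e1 =2 relpre f e2 ->
  (forall x y, e2 x y -> (x \in codom f) && (y \in codom f)) ->
  editable e1 m <-> editable e2 m.
Proof.
move=> E sup; split; last first.
  by move/editable_preim; apply: eq_editable => x y; rewrite E.
case=> h [[hs hi] p4h hm].
pose inv x := [pick a | f a == x].
have invf a : inv (f a) = Some a.
  by rewrite /inv; case: pickP => [b /eqP/f_inj->//|/(_ a)]; rewrite eqxx.
have inv_codom x a : inv x = Some a -> x = f a.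
  by rewrite /inv; case: pickP => // b /eqP<- [->].
pose h2 x y := if inv x is Some a then if inv y is Some b then h a b else false else false.
have h2f a b : h2 (f a) (f b) = h a b by rewrite /h2 !invf.
have h2P x y : h2 x y -> exists a b, [/\ x = f a, y = f b & h a b].
  rewrite /h2; case Ex : (inv x) => [a|//]; case Ey : (inv y) => [b|//].
  by exists a, b; split=> //; apply: inv_codom.
exists h2; split.
- split=> [x y|x]; rewrite /h2; case: (inv x) => [a|] //; case: (inv y) => [b|] //.
- move=> a b c d; apply/negP => P.
  have /and5P[/h2P[a' [b' [Ea Eb _]]] _ /h2P[c' [d' [Ec Ed _]]] _ _] := P.
  by have := p4h a' b' c' d'; move: P; rewrite Ea Eb Ec Ed /p4 !h2f => ->.
apply: leq_trans hm; rewrite !dist_card.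
pose D1 := [set p : T1 * T1 | e1 p.1 p.2 != h p.1 p.2].
apply: leq_trans (leq_imset_card (fun p => (f p.1, f p.2)) D1).
apply: subset_leq_card; apply/subsetP => -[x y]; rewrite inE /= => Hxy.
have /andP[/codomP[a Ea] /codomP[b Eb]] : (x \in codom f) && (y \in codom f).
  case Exy : (e2 x y) Hxy => [|]; first by move=> _; apply: sup.
  case Hh : (h2 x y) => // _; have [a [b [-> -> _]]] := h2P _ _ Hh.
  by rewrite !codom_f.
apply/imsetP; exists (a, b); rewrite ?Ea ?Eb // inE /= E /=.
by rewrite -Ea -Eb; move: Hxy; rewrite Ea Eb h2f.
Qed.

End Embedding.

(** * Costs of disjoint unions *)

Section DisjointUnion.

Variables (I T : finType) (es : I -> rel T).

Definition dunion : rel (I * T) := fun p q => (p.1 == q.1) && es p.1 p.2 q.2.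

Lemma sgraph_dunion : (forall i, sgraph (es i)) -> sgraph dunion.
Proof.
move=> sg; split=> [[i x] [j y]|[i x]]; rewrite /dunion /=.
  by rewrite eq_sym; case: eqP => // ->; rewrite (proj1 (sg i)).
by rewrite (proj2 (sg i)) andbF.
Qed.

Lemma leq_sum_diag (F : I -> I -> nat) : \sum_i F i i <= \sum_i \sum_j F i j.
Proof. by apply: leq_sum => i _; rewrite (bigD1 i) //= leq_addr. Qed.

Lemma sum_pair (F : I * T -> nat) : \sum_p F p = \sum_i \sum_x F (i, x).
Proof. by rewrite pair_bigA; apply: eq_bigr => -[]. Qed.

Lemma dist_pair (e h : rel (I * T)) : dist e h =
  \sum_i \sum_j \sum_x \sum_y (e (i, x) (j, y) != h (i, x) (j, y) : nat).
Proof.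
rewrite /dist sum_pair; apply: eq_bigr => i _; rewrite [RHS]exchange_big /=.
by apply: eq_bigr => x _; rewrite sum_pair.
Qed.

(** Restricting a solution to the components only forgets edits between them, and the union of
    connected or disconnected P4-free components is P4-free because a P4 is connected. *)
Lemma editable_dunion m : editable dunion m <->
  exists2 c : I -> nat, \sum_i c i <= m & forall i, editable (es i) (c i).
Proof.
split=> [[h [[hs hi] p4h hm]]|[c cm /fin_all_exists[h Hh]]].
  exists (fun i => dist (es i) (fun x y => h (i, x) (i, y))).
    apply: leq_trans hm; rewrite dist_pair.
    apply: leq_trans (leq_sum_diag _); apply: leq_sum => i _.
    by apply: leq_sum => x _; apply: leq_sum => y _; rewrite /dunion /= eqxx.
  move=> i; exists (fun x y => h (i, x) (i, y)); split=> //.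
  - by split=> [x y|x]; rewrite ?hi // hs.
  - by move=> a b c d; apply: p4h.
exists (fun p q => (p.1 == q.1) && h p.1 p.2 q.2); split.
- split=> [[i x] [j y]|[i x]] /=; have [[hs hi] _ _] := Hh i.
    by rewrite eq_sym; case: eqP => // ->; rewrite hs.
  by rewrite hi andbF.
- move=> [i a] [j b] [k x] [l d]; apply/negP; rewrite /p4 /=.
  case/and3P=> /andP[/eqP<- ab] /andP[/eqP<- bc] /andP[/andP[/eqP<- cd]].
  rewrite eqxx /= => H; have [_ p4h _] := Hh i.
  by have := p4h a b x d; rewrite /p4 ab bc cd H.
apply: leq_trans cm; rewrite dist_pair; apply: leq_sum => i _.
have [_ _ di] := Hh i; apply: leq_trans di.
rewrite (bigD1 i) //= [X in _ + X]big1 ?addn0 => [|j ij]; last first.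
  rewrite big1 // => x _; rewrite big1 // => y _.
  by rewrite /dunion /= (eq_sym i) (negPf ij).
by apply: leq_sum => x _; apply: leq_sum => y _; rewrite /dunion /= eqxx.
Qed.

End DisjointUnion.

(** * Lists of graphs sharing one budget *)

Section EditableSeq.

Variable T : finType.
Implicit Types (e : rel T) (rs : seq (rel T)).

Fixpoint editable_seq rs m : Prop :=
  if rs is e :: rs' then
    exists m1 m2, [/\ m1 + m2 <= m, editable e m1 & editable_seq rs' m2]
  else True.

Lemma leq_editable_seq rs m n : m <= n -> editable_seq rs m -> editable_seq rs n.
Proof.
case: rs => //= e rs mn [m1 [m2 [le ? ?]]]; exists m1, m2; split=> //.
exact: leq_trans mn.
Qed.

Lemma editable_seq1 e m : editable_seq [:: e] m <-> editable e m.
Proof.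
split=> [[m1 [m2 [le H _]]]|H].
  by apply: leq_editable H; lia.
by exists m, 0; split; rewrite ?addn0.
Qed.

Lemma editable_seq_cat r1 r2 m : editable_seq (r1 ++ r2) m <->
  exists m1 m2, [/\ m1 + m2 <= m, editable_seq r1 m1 & editable_seq r2 m2].
Proof.
elim: r1 m => [|e r1 IH] m /=.
  split=> [H|[m1 [m2 [le _ H]]]]; first by exists 0, m; split.
  by apply: leq_editable_seq H; lia.
split=> [[a [b [le He /IH[c [d [le2 H1 H2]]]]]]|].
  exists (a + c), d; split=> //; first by lia.
  by exists a, c; split.
case=> a [b [le [c [d [le2 He H1]]] H2]]; exists c, (d + b); split=> //.
  by lia.
by apply/IH; exists d, b; split.
Qed.

Lemma editable_seq_flatten (S : Type) (f g : S -> seq (rel T)) (s : seq S) m :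
  (forall x m, List.In x s -> editable_seq (f x) m <-> editable_seq (g x) m) ->
  editable_seq (flatten (map f s)) m <-> editable_seq (flatten (map g s)) m.
Proof.
elim: s m => [//|x s IH] m H /=.
have IH' n := IH n (fun y k ys => H y k (or_intror ys)).
have Hx n := H x n (or_introl erefl).
by split=> /editable_seq_cat[a [b [le Ha Hb]]]; apply/editable_seq_cat;
  exists a, b; split=> //; (apply/IH' || apply/Hx).
Qed.

Lemma editable_seq_nth rs m : editable_seq rs m <->
  exists2 c : nat -> nat, \sum_(i < size rs) c i <= m &
    forall i, i < size rs -> editable (nth (fun _ _ => false) rs i) (c i).
Proof.
elim: rs m => [|e rs IH] m /=.
  by split=> // _; exists (fun=> 0); rewrite ?big_ord0.
split=> [[m1 [m2 [le H1 /IH[c cm Hc]]]]|[c cm Hc]].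
  exists (fun i => if i is j.+1 then c j else m1).
    by rewrite big_ord_recl /=; apply: leq_trans le; rewrite leq_add2l.
  by case=> [|i] //= /Hc.
exists (c 0), (\sum_(i < size rs) c i.+1); split.
- by move: cm; rewrite big_ord_recl.
- exact: Hc 0 isT.
- by apply/IH; exists (fun i => c i.+1) => // i; apply: Hc i.+1.
Qed.

End EditableSeq.

(** * Size of a reduced graph *)

Section Cotree.

Variables (T : finType) (h : rel T).
Hypotheses (sgh : sgraph h) (p4h : p4free h).
Implicit Types (A B W : {set T}).

Definition cross A B b := forall x y, x \in A -> y \in B -> h x y = b.

Lemma crossC A B b : cross A B b -> cross B A b.
Proof. by move=> H x y xB yA; rewrite (proj1 sgh) H. Qed.

Definition cut W b A B :=
  [/\ A != set0, B != set0, A :&: B = set0, A :|: B = W & cross A B b].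

Lemma cutC W b A B : cut W b A B -> cut W b B A.
Proof. by case=> A0 B0 AB U c; split; rewrite // 1?setIC 1?setUC //; apply: crossC. Qed.

(** A vertex v is added to a cut of the others. The label [b] stays arbitrary, so unions and joins
    are treated at once, complementation exchanging them. If a side agrees with [b] throughout
    towards v, then v goes to the other side; if no vertex agrees, v is split off with the opposite
    label; otherwise some side is mixed, which is the case of [key]. *)
Lemma p4free_cut W : 1 < #|W| -> exists b A B, cut W b A B.
Proof.
have [hs hi] := sgh.
elim: {W}_.+1 {-2}W (ltnSn #|W|) => // n IH W Wn W1.
have [v vW] : exists v, v \in W by apply/set0Pn; rewrite -card_gt0 ltnW.
have cW := cardsD1 v W; rewrite vW /= in cW.
have [W2|W2] := leqP 2 #|W :\ v|; last first.
  have /eqP/cards1P[u Wu] : #|W :\ v| = 1 by lia.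
  exists (h v u), [set v], [set u]; split.
  - by apply/set0Pn; exists v; rewrite inE.
  - by apply/set0Pn; exists u; rewrite inE.
  - by apply/setP=> z; rewrite -Wu !inE; case: (z == v).
  - by rewrite -Wu setD1K.
  - by move=> x y; rewrite !inE => /eqP-> /eqP->.
have [b [A [B cAB]]] : exists b A B, cut (W :\ v) b A B by apply: IH => //; lia.
pose N := [set z | h z v != b].
(* Otherwise a neighbour r of v in B', v, a neighbour z of v in A' and a
   non-neighbour q of v in A' adjacent to z form a P4 (or its complement). *)
have key A' B' : cut (W :\ v) b A' B' -> B' :&: N != set0 -> A' :&: N != set0 ->
    A' :\: N != set0 -> exists b A B, cut W b A B.
  case=> A0 B0 AB U c BN AN ADN.
  have vA : v \notin A' by apply/negP => vA; have := setD11 v W; rewrite -U inE vA.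
  have vB : v \notin B' by apply/negP => vB; have := setD11 v W; rewrite -U inE vB orbT.
  have UW z : (z \in W) = (z == v) || (z \in A') || (z \in B').
    have : (z \in A' :|: B') = (z \in W :\ v) by rewrite U.
    by rewrite !inE; case: eqP => [->|_] /=; rewrite ?vW // => <-.
  exists b, (A' :\: N), (W :\: (A' :\: N)); split=> //.
  - by apply/set0Pn; exists v; rewrite !inE (negPf vA) andbF vW.
  - by apply/setP=> z; rewrite !inE; case: (z \in A'); rewrite ?andbF //; case: (h z v != b).
  - apply/setP=> z; rewrite !inE UW; case: (z \in A'); rewrite ?andbF //= ?orbT.
    by case: (h z v != b).
  move=> q z; rewrite !inE negbK => /andP[/eqP qv qA]; rewrite negb_and negbK UW.
  case/andP=> /orP[zN|zA]; last first.
    rewrite (negPf zA) orbF => /orP[/eqP->//|]; exact: c.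
  have [->//|zv /=] := eqVneq z v; case/orP=> [zA|]; last exact: c.
  apply/eqP/negP => /negP qz.
  case/set0Pn: BN => r; rewrite !inE => /andP[rB rv].
  have zr := c z r zA rB; have qr := c q r qA rB.
  have := p4h r v z q; have := p4h v q r z; rewrite /p4.
  rewrite (hs v r) (hs v z) (hs v q) (hs r z) (hs r q) (hs z q) zr qr qv.
  by move: rv zN qz; case: (b); case: (h r v); case: (h z v); case: (h q z).
have [A0 B0 AB U c] := cAB.
have vA : v \notin A by apply/negP => vA; have := setD11 v W; rewrite -U inE vA.
have vB : v \notin B by apply/negP => vB; have := setD11 v W; rewrite -U inE vB orbT.
have alone A' B' : cut (W :\ v) b A' B' -> v \notin A' -> A' :&: N = set0 ->
    exists b A B, cut W b A B.
  case=> A0' B0' AB' U' c' vA' AN; exists b, A', (v |: B'); split=> //.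
  - by apply/set0Pn; exists v; rewrite !inE eqxx.
  - apply/setP=> z; move/setP/(_ z): AB'; rewrite !inE.
    by case: eqP => [->|//]; rewrite (negPf vA').
  - by rewrite setUCA U' setD1K.
  - move=> x y xA; rewrite !inE => /orP[/eqP->|]; last exact: c'.
    by move/setP/(_ x): AN; rewrite !inE xA /= => /negbFE/eqP.
have [AN|AN] := eqVneq (A :&: N) set0; first exact: alone cAB vA AN.
have [BN|BN] := eqVneq (B :&: N) set0; first exact: alone (cutC cAB) vB BN.
have [AD|AD] := eqVneq (A :\: N) set0; last exact: key cAB BN AN AD.
have [BD|BD] := eqVneq (B :\: N) set0; last exact: key (cutC cAB) AN BN BD.
exists (~~ b), (W :\ v), [set v]; split.
- by rewrite -card_gt0; lia.
- by apply/set0Pn; exists v; rewrite inE.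
- by apply/setP=> z; rewrite !inE; case: (z == v); rewrite ?andbF.
- by rewrite setUC setD1K.
move=> x y; rewrite -U => /setUP xAB /set1P->.
move/setP/(_ x): AD; move/setP/(_ x): BD; rewrite !inE !negbK.
by case: xAB => ->; rewrite !andbT; case: (h x v); case: (b).
Qed.

(** Stands in for the cotree: a leaf is a singleton, an inner node a cut together with its label. *)
Lemma cotree_ind (P : {set T} -> Prop) :
  (forall x, P [set x]) ->
  (forall W b A B, cut W b A B -> P A -> P B -> P W) ->
  forall W, W != set0 -> P W.
Proof.
move=> P1 PU W; elim: {W}_.+1 {-2}W (ltnSn #|W|) => // n IH W Wn W0.
have [W1|W1] := leqP #|W| 1.
  have /cards1P[x ->] : #|W| == 1 by rewrite eqn_leq W1 card_gt0.
  exact: P1.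
have [b [A [B cAB]]] := p4free_cut W1.
have [A0 B0 AB U _] := cAB.
have cU : #|W| = #|A| + #|B| by rewrite -U cardsU AB cards0 subn0.
have := A0; have := B0; rewrite -!card_gt0 => B1 A1.
by apply: PU cAB _ _; apply: IH => //; lia.
Qed.

Lemma module_cut W b A B : cut W b A B -> module h W -> module h A.
Proof.
case=> _ _ AB U c Wm x y z xA yA zA.
have [zB|zB] := boolP (z \in B); first by rewrite !c.
by apply: Wm; rewrite -U inE ?xA ?yA // negb_or zA zB.
Qed.

End Cotree.

(** * Neighbourhoods in an irreducible graph with an optimal solution *)

Section SizeBound.

Variables (T : finType) (e h : rel T) (s0 : nat).
Hypotheses (sge : sgraph e) (sgh : sgraph h) (p4h : p4free h).
Hypothesis p4e : ~ p4free e.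
Hypothesis edge_module : forall M u v, module e M -> u \in M -> v \in M ->
  e u v -> forall x y, e x y -> x \in M.
Hypothesis hmin : forall g, sgraph g -> p4free g -> dist e h <= dist e g.
Hypothesis sunflower_small :
  forall x y l, x != y -> sunflower e x y l -> size l <= s0.

Implicit Types (A B M W : {set T}).

Definition edited := [set x | [exists y, e x y != h x y]].
Definition nbh x := [set y | e x y].
Definition nbhs W := nbh @: (W :\: edited).
Definition covers W := forall x y, e x y -> x \in W.

Lemma uneditedE x y : x \notin edited -> e x y = h x y.
Proof. by rewrite inE => /existsPn/(_ y); rewrite negbK => /eqP. Qed.

(** Without edits, M is a module of [e] too. An edge inside would make M contain all edges, hence
    every P4 of [e]; but there [e] agrees with the P4-free [h]. *)
Lemma unedited_indep M : module h M -> M :&: edited = set0 ->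
  {in M &, forall x y, e x y = false}.
Proof.
move=> Mm M0 x y xM yM; apply/negP => exy.
have un z : z \in M -> z \notin edited.
  by move=> zM; move/setP/(_ z): M0; rewrite inE zM in_set0 => /= ->.
have em : module e M by move=> a b z aM bM zM; rewrite !uneditedE ?un // (Mm a b).
have cov := edge_module em xM yM exy.
apply: p4e => a b c d; apply/negP => P; have /and5P[ab bc cd _ _] := P.
have dM : d \in M by apply: (cov d c); rewrite (proj1 sge).
have [[aM bM] cM] := (cov _ _ ab, cov _ _ bc, cov _ _ cd).
by have := p4h a b c d; move: P; rewrite /p4 !uneditedE ?un // => ->.
Qed.

Lemma unedited_nbh M : module h M -> M :&: edited = set0 ->
  {in M &, forall x y, nbh x = nbh y}.
Proof.
move=> Mm M0 x y xM yM; apply/setP=> z; rewrite !inE.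
have un z' : z' \in M -> z' \notin edited.
  by move=> zM; move/setP/(_ z'): M0; rewrite inE zM in_set0 => /= ->.
have [zM|zM] := boolP (z \in M); first by rewrite !(unedited_indep Mm M0).
by rewrite !uneditedE ?un // (Mm x y).
Qed.

(** If no edit left W, then W would be a module of [e], and an independent one since it misses an
    edge. All edits inside W would then be wasteful, against the optimality of [h]. *)
Lemma edited_across W : module h W -> W :&: edited != set0 -> ~ covers W ->
  exists x y, [/\ x \in W, y \notin W & e x y != h x y].
Proof.
move=> Wm WA ncov.
have [/existsP[x /existsP[y /and3P[xW yW xy]]]|N] :=
  boolP [exists x, exists y, [&& x \in W, y \notin W & e x y != h x y]].
  by exists x, y.
have E x y : x \in W -> y \notin W -> e x y = h x y.
  move=> xW yW; apply/eqP; move: N; rewrite negb_exists => /forallP/(_ x).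
  by rewrite negb_exists => /forallP/(_ y); rewrite xW yW /= negbK.
have em : module e W by move=> a b z aW bW zW; rewrite !E // (Wm a b).
have ind x y : x \in W -> y \in W -> e x y = false.
  move=> xW yW; apply/negP => exy; apply: ncov; exact: (edge_module em xW yW exy).
case/set0Pn: WA => w /setIP[wW]; rewrite inE => /existsP[z wz].
have zW : z \in W by apply: contraNT wz => zW; rewrite E.
(* Substituting the empty graph for W saves the edits inside W, of which the pair w, z is one, and
   loses nothing outside. *)
have [u uW] := dist_subst sge sgh (@sgraph0 T) em wW.
have := hmin (sgraph_subst W u sgh (@sgraph0 T))
             (p4free_subst W u sgh p4h (@p4free0 T)).
rewrite dist_on0 => [|x y /= xW yW]; last by rewrite ind.
have : 0 < dist_on e h (mem W) (mem W).
  by rewrite /dist_on (bigD1 w) //= (bigD1 z) //= wz.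
have := dist_on_le e h (mem W) (mem W).
lia.
Qed.

(* s lists, from top to bottom, unedited vertices hanging off a path of the
   cotree that leads to the edited vertices of W; b is the label of the first
   node (true for a join) and the labels alternate. *)
Fixpoint altern W b s :=
  if s is v :: s' then
    [/\ v \in W :\: edited, (forall x, x \in W :&: edited -> h v x = b),
        (forall w, w \in s' -> h v w = b) & altern W (~~ b) s']
  else True.

Lemma altern_mem W b s : altern W b s -> forall v, v \in s -> v \in W :\: edited.
Proof.
elim: s b => [//|v s IH] b /= [vW _ _ /IH H] w; rewrite inE => /orP[/eqP->//|].
exact: H.
Qed.

Lemma altern_uniq W b s : W :&: edited != set0 -> altern W b s -> uniq s.
Proof.
case/set0Pn=> x xW; elim: s b => [//|v s IH] b /= [_ vx vs al].
rewrite (IH _ al) andbT; apply/negP => vins.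
case: s vs al vins {IH} => [//|w s] vs /= [_ wx ws _]; rewrite inE.
have hvw := vs w (mem_head _ _).
case/orP=> [/eqP E|vin]; first by move: (wx x xW) (vx x xW); rewrite E => ->; case: (b).
by move: (ws v vin); rewrite (proj1 sgh) hvw; case: (b).
Qed.

(** Consecutive chain vertices become petals of the pair x, y; [beta] is the value of that pair in
    [h] and selects which of the two shapes in [petal] arises. *)
Fixpoint pairing beta (s : seq T) :=
  if s is v :: w :: s' then (if beta then (w, v) else (v, w)) :: pairing beta s'
  else [::].

Lemma size_pairing beta s : size (pairing beta s) = (size s)./2.
Proof.
have [n] := ubnP (size s); elim: n s => // n IH [|v [|w s]] //= sn.
by rewrite IH //; lia.
Qed.

Lemma pairing_mem beta s p : p \in pairing beta s -> (p.1 \in s) && (p.2 \in s).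
Proof.
have [n] := ubnP (size s); elim: n s => // n IH [|v [|w s]] //= sn.
rewrite inE => /orP[/eqP->|/IH]; first by case: (beta); rewrite !inE !eqxx ?orbT.
by rewrite !inE => /(_ _)/andP[]; [lia | move=> -> ->; rewrite !orbT].
Qed.

Lemma pairing_apart beta s : uniq s -> pairwise (@apart T) (pairing beta s).
Proof.
have [n] := ubnP (size s); elim: n s => // n IH [|v [|w s]] // sn.
rewrite [uniq _]/= [pairing _ _]/= !inE negb_or -!andbA => /and4P[vw vs ws us].
rewrite pairwise_cons IH //; last by move: sn => /=; lia.
rewrite andbT; apply/allP => p /pairing_mem/andP[p1 p2].
have ne x z : x \notin s -> z \in s -> x != z by move=> xs zs; apply: contraNneq xs => ->.
by case: (beta); rewrite /apart /= !ne.
Qed.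

(** Chain vertices are unedited, so their adjacencies can be read in [h]. As W is a module, y is
    related to both vertices of a pair by the value [beta], whereas x is related to them by opposite
    values. The pair xy itself has the value opposite to [beta] in [e], and this completes a P4
    there. *)
Lemma altern_petal W beta s x y : module h W -> x \in W :&: edited ->
  y \notin W -> e x y != h x y -> h x y = beta ->
  altern W (~~ beta) s -> all (petal e x y) (pairing beta s).
Proof.
have [[es ei] [hs hi]] := (sge, sgh).
move=> Wm xWA yW xy hxy; have /setIP[xW xA] := xWA.
have [n] := ubnP (size s); elim: n s => // n IH [|v [|w s]] //= sn.
case=> /setDP[vW vA] vx vws [/setDP[wW wA] wx _ al]; rewrite IH ?andbT //; last first.
- by rewrite negbK in al.
- by move: sn; clear; lia.
have hwy : h w y = beta by rewrite (Wm w x).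
have hvy : h v y = beta by rewrite (Wm v x).
have {}vx := vx _ xWA; have {}wx := wx _ xWA; rewrite negbK in wx.
have vw := vws w (mem_head _ _).
move: xy vx wx vw hwy hvy; rewrite hxy -!uneditedE // => xy vx wx vw wy vy.
rewrite /petal /p4; case: (beta) xy vx wx vw wy vy => xy vx wx vw wy vy /=.
  by rewrite (es x w) (es y v) (es x v) (es w v) wx wy vy vw vx; case: (e x y) xy.
by rewrite (es y x) (es x v) (es y v) (es x w) (es y w) vx vw wx wy vy orbC; case: (e x y) xy.
Qed.

(** Petals come from pairs that start with the label opposite to the crossing edit's value in [h].
    One entry may be lost at the front to reach that label and one at the end by parity, hence the 2
    on top of two entries per petal. *)
Lemma altern_size W b s : module h W -> W :&: edited != set0 -> ~ covers W ->
  altern W b s -> size s <= s0.*2.+2.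
Proof.
move=> Wm WA ncov al.
have [x [y [xW yW xy]]] := edited_across Wm WA ncov.
have xA : x \in W :&: edited by rewrite inE xW inE; apply/existsP; exists y.
have nxy : x != y by apply: contraNneq yW => <-.
have main s' : altern W (~~ h x y) s' -> size s' <= s0.*2.+1.
  move=> al'; have := @sunflower_small x y (pairing (h x y) s') nxy.
  rewrite /sunflower pairing_apart ?(altern_uniq WA al') //.
  rewrite (altern_petal Wm xA yW xy (erefl _) al') size_pairing => /(_ isT).
  by lia.
have [E|E] := eqVneq b (~~ h x y); first by rewrite E in al; have := main s al; lia.
case: s al => [//|v s] /= [_ _ _ al]; rewrite ltnS; apply: main.
by move: al E; case: (b); case: (h x y).
Qed.

Definition chain_len := s0.*2.+2.
Local Notation K := chain_len.

(* M collects everything that hangs off the topmost nodes with label b; it lets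
   a further node with the same label be merged into the first entry of s. *)
Definition top W b s := if s is v :: _ then
  exists M, [/\ v \in M, M \subset W :\: edited & cross h M (W :\: M) b] else True.

Lemma altern_widen A W b s : A \subset W -> W :&: edited = A :&: edited ->
  altern A b s -> altern W b s.
Proof.
move=> AW WA; elim: s b => [//|v s IH] b /= [vA vx vs /IH al]; split=> //.
  by apply: subsetP vA; apply: setSD.
by move=> x; rewrite WA; apply: vx.
Qed.

(** A potential: [s] holds the classes not yet paid for, each edited vertex brings a credit of
    [K.*2], and a reserve of [K.*2] is held back. When two chains meet, two reserves become one, and
    the one set free pays for both chains, whose lengths are at most [K]. *)
Definition chain_bound W := module h W -> W :&: edited != set0 -> ~ covers W ->
  exists b s, [/\ altern W b s, top W b s &
                  #|nbhs W| + K.*2 <= size s + #|W :&: edited| * K.*2].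

Lemma nbhsU A B : nbhs (A :|: B) = nbhs A :|: nbhs B.
Proof. by rewrite /nbhs setDUl imsetU. Qed.

Lemma card_nbhs_unedited B : module h B -> B :&: edited = set0 -> #|nbhs B| <= 1.
Proof.
move=> Bm B0; have [->|[r rB]] := set_0Vmem B.
  by rewrite /nbhs set0D imset0 cards0.
rewrite -(cards1 (nbh r)); apply: subset_leq_card; apply/subsetP => z.
case/imsetP=> x /setDP[xB _] ->; rewrite inE.
by rewrite (unedited_nbh Bm B0 xB rB).
Qed.

(** The unedited side B contributes at most one class. If [b] differs from the first label of the
    chain, or the chain is empty, a vertex of B becomes its new first entry. If the labels agree, B
    together with the set M of [top] is an unedited module of [h], so B repeats the class of the
    first entry. *)
Lemma chain_bound_unedited W b A B : cut h W b A B -> B :&: edited = set0 ->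
  chain_bound A -> chain_bound W.
Proof.
move=> cAB BA IH Wm WA ncov; have [A0 B0 AB U c] := cAB.
have EA : W :&: edited = A :&: edited by rewrite -U setIUl BA setU0.
have Am := module_cut cAB Wm; have Bm := module_cut (cutC sgh cAB) Wm.
have [AW BW] : A \subset W /\ B \subset W by rewrite -U subsetUl subsetUr.
have Bun z : z \in B -> z \in W :\: edited.
  move=> zB; rewrite inE (subsetP BW) // andbT.
  by move/setP/(_ z): BA; rewrite inE zB in_set0 => /= ->.
have ncovA : ~ covers A by move=> cA; apply: ncov => x y /cA; apply: subsetP.
rewrite EA in WA *; have [b1 [s [al tp le]]] := IH Am WA ncovA.
have [r rB] := set0Pn _ B0.
have cardW : #|nbhs W| <= #|nbhs A| + 1.
  rewrite -U nbhsU cardsU; apply: leq_trans (leq_subr _ _) _.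
  by rewrite leq_add2l card_nbhs_unedited.
have alW := altern_widen AW EA al.
have push : altern W (~~ b) s -> exists b s, [/\ altern W b s, top W b s &
    #|nbhs W| + K.*2 <= size s + #|A :&: edited| * K.*2].
  move=> al'; exists b, (r :: s); split=> /=; last first.
    by rewrite addSn -addn1; apply: leq_trans (_ : #|nbhs A| + 1 + K.*2 <= _);
      rewrite ?leq_add2r // addnAC leq_add2r.
    exists B; split=> //; first by apply/subsetP.
    move=> x z xB /setDP[]; rewrite -U inE => /orP[zA _|zB]; last by rewrite zB.
    by rewrite (proj1 sgh) (c z x).
  split=> //; first exact: Bun.
  by move=> x; rewrite EA => /setIP[xA _]; rewrite (proj1 sgh) (c x r).
  by move=> w /(altern_mem al) /setDP[wA _]; rewrite (proj1 sgh) (c w r).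
case: s al tp le alW push => [|v s] al tp le alW push; first exact: push.
have [bb|bb] := eqVneq b1 b; last by apply: push; move: alW bb; case: (b); case: (b1).
rewrite {}bb in al tp alW; case: tp => M [vM MA cM].
have MA' x : x \in M -> x \in A by move/(subsetP MA)/setDP=> [].
have cMB : cross h (M :|: B) (W :\: (M :|: B)) b.
  move=> x z; rewrite !inE negb_or => /orP[xM|xB] /andP[/andP[zM zB]];
    rewrite -U inE (negPf zB) orbF => zA.
    by apply: cM => //; rewrite inE zM.
  by rewrite (proj1 sgh) (c z x).
have MBW : M :|: B \subset W.
  by rewrite subUset BW andbT; apply/subsetP => x /MA'; apply: subsetP.
have MBm : module h (M :|: B).
  move=> x y z xM yM zM; have [zW|zW] := boolP (z \in W).
    by rewrite !(cMB _ z) // inE zM zW.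
  by apply: Wm => //; apply: (subsetP MBW).
have MB0 : (M :|: B) :&: edited = set0.
  rewrite setIUl BA setU0; apply/setP=> z; rewrite !inE.
  by apply/negP => /andP[/(subsetP MA)/setDP[_ /negPf]]; rewrite inE => ->.
exists b, (v :: s); split=> //; last first.
  apply: leq_trans le; rewrite leq_add2r; apply: subset_leq_card.
  rewrite -U nbhsU subUset subxx /=; apply/subsetP => w /imsetP[x /setDP[xB _] ->].
  rewrite (@unedited_nbh _ MBm MB0 x v) ?inE ?xB ?vM ?orbT //.
  by apply: imset_f; apply: (subsetP MA).
exists (M :|: B); split=> //; first by rewrite inE vM.
rewrite subUset; apply/andP; split; last by apply/subsetP.
by apply: subset_trans MA (setSD _ AW).
Qed.

Lemma chain_boundP W : W != set0 -> chain_bound W.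
Proof.
move: W; apply: (cotree_ind sgh p4h) => [x|W b A B cAB IA IB].
  move=> _ xA _; exists true, [::]; split=> //.
  case/set0Pn: xA => z /setIP[/set1P->] xA.
  have -> : nbhs [set x] = set0.
    rewrite /nbhs (_ : _ :\: _ = set0) ?imset0 //; apply/setP=> y; rewrite !inE.
    by case: eqP => [->|//]; rewrite ?andbF // andbT; move: xA; rewrite inE => ->.
  rewrite (_ : _ :&: _ = [set x]) ?cards0 ?cards1; first by lia.
  by apply/setIidPl; rewrite sub1set.
have [BE|BE] := eqVneq (B :&: edited) set0; first exact: chain_bound_unedited cAB BE IA.
have [AE|AE] := eqVneq (A :&: edited) set0.
  exact: chain_bound_unedited (cutC sgh cAB) AE IB.
move=> Wm WA ncov; exists true, [::]; split=> //=; have [A0 B0 AB U c] := cAB.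
have Am := module_cut cAB Wm; have Bm := module_cut (cutC sgh cAB) Wm.
have [AW BW] : A \subset W /\ B \subset W by rewrite -U subsetUl subsetUr.
have ncovA : ~ covers A by move=> cA; apply: ncov => x y /cA; apply: subsetP.
have ncovB : ~ covers B by move=> cB; apply: ncov => x y /cB; apply: subsetP.
have [b1 [s1 [al1 _ le1]]] := IA Am AE ncovA.
have [b2 [s2 [al2 _ le2]]] := IB Bm BE ncovB.
have sz1 := altern_size Am AE ncovA al1; have sz2 := altern_size Bm BE ncovB al2.
rewrite -/K in sz1 sz2.
have le : #|nbhs W| <= #|nbhs A| + #|nbhs B|.
  by rewrite -U nbhsU cardsU leq_subr.
have -> : #|W :&: edited| = #|A :&: edited| + #|B :&: edited|.
  by rewrite -U setIUl cardsU setIACA AB set0I cards0 subn0.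
rewrite mulnDl; move: le1 le2 sz1 sz2 le; rewrite add0n.
move: (_ * _) (_ * _) => P Q; move: (size s1) (size s2) K => x1 x2 k.
by move: #|nbhs A| #|nbhs B| #|nbhs W|; lia.
Qed.

Lemma card_nbhs_open W : W != set0 -> module h W -> ~ covers W ->
  #|nbhs W| <= (#|W :&: edited| * K).*2.+1.
Proof.
move=> W0 Wm ncov; have [WA|WA] := eqVneq (W :&: edited) set0.
  by apply: leq_trans (card_nbhs_unedited Wm WA) _.
have [b [s [al _ le]]] := chain_boundP W0 Wm WA ncov.
have := altern_size Wm WA ncov al; rewrite -/K; rewrite -doubleMr in le; lia.
Qed.

Lemma coversP W : reflect (covers W) [forall x, forall y, e x y ==> (x \in W)].
Proof.
by apply: (iffP forallP) => [H x y|H x];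
  [move/forallP/(_ y)/implyP: (H x) | apply/forallP => y; apply/implyP; apply: H].
Qed.

(** If one side of a cut already contains all edges, the vertices of the other side are isolated in
    [e]; adding [set0] once accounts for all of them, so the descent is free. The 3 arises where
    neither side covers: 1 from each use of [card_nbhs_open] and 1 for [set0]. *)
Lemma card_nbhs_covers W : W != set0 -> module h W -> covers W ->
  #|set0 |: nbhs W| <= (#|W :&: edited| * K).*2.+3.
Proof.
move: W; apply: (cotree_ind sgh p4h) => [x|W b A B cAB IA IB] Wm cov.
  rewrite cardsU1; have := leq_imset_card nbh ([set x] :\: edited).
  have := subset_leq_card (subsetDl [set x] edited); rewrite cards1 /nbhs.
  by case: (_ \notin _); lia.
have [A0 B0 AB U c] := cAB.
have Am := module_cut cAB Wm; have Bm := module_cut (cutC sgh cAB) Wm.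
have -> : #|W :&: edited| = #|A :&: edited| + #|B :&: edited|.
  by rewrite -U setIUl cardsU setIACA AB set0I cards0 subn0.
rewrite mulnDl.
have isolated A' B' : A' :&: B' = set0 -> covers A' -> set0 |: nbhs B' = [set set0].
  move=> AB' cA; apply/setUidPl/subsetP => z /imsetP[x /setDP[xB _] ->].
  rewrite inE; apply/eqP/setP => y; rewrite !inE; apply/negP => /cA xA.
  by move/setP/(_ x): AB'; rewrite !inE xA xB.
have [cA|ncA] := coversP A.
  rewrite -U nbhsU setUCA (isolated A B) // setUC.
  by apply: leq_trans (IA Am cA) _; lia.
have [cB|ncB] := coversP B.
  rewrite -U nbhsU [nbhs A :|: _]setUC setUCA (isolated B A) // 1?setIC // setUC.
  by apply: leq_trans (IB Bm cB) _; lia.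
have := card_nbhs_open A0 Am ncA; have := card_nbhs_open B0 Bm ncB.
rewrite -U nbhsU cardsU1 cardsU; case: (_ \notin _); lia.
Qed.

Lemma card_edited : #|edited| <= dist e h.
Proof.
rewrite -sum1_card big_mkcond; apply: leq_sum => x _.
case: ifP => //; rewrite inE => /existsP[y xy]; by rewrite (bigD1 y) //= xy.
Qed.

Lemma card_nbhs : #|nbh @: setT| <= dist e h * s0.*2.+4.*2.
Proof.
have [x0] : exists x : T, true.
  have [/existsP[x _]|/existsPn N] := boolP [exists x : T, true]; first by exists x.
  by case: p4e => a; have := N a.
have T0 : [set: T] != set0 by apply/set0Pn; exists x0; rewrite inE.
have Tm : module h setT by move=> x y z _ _; rewrite inE.
have := card_nbhs_covers T0 Tm (fun x y _ => in_setT x); rewrite setTI.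
have -> : nbh @: setT = nbhs setT :|: nbh @: edited.
  by rewrite /nbhs -imsetU setDE setTI setUC setUCr.
have := leq_imset_card nbh edited; have := card_edited.
rewrite cardsU1 cardsU.
(* There is an edit, since [e] has a P4 and [h] has none. So the constant 3 and the neighbourhoods
   of the edited vertices fit when [K] is raised to [K.+2]. *)
have d0 : 0 < dist e h.
  rewrite lt0n; apply/negP => /eqP d0; apply: p4e; apply: eq_p4free p4h => x y.
  move/eqP: d0; rewrite /dist sum_nat_eq0 => /forallP/(_ x)/implyP/(_ isT).
  by rewrite sum_nat_eq0 => /forallP/(_ y)/implyP/(_ isT); case: (e x y); case: (h x y).
rewrite -[s0.*2.+4]/(K.+2) -doubleMr mulnS mulnS; case: (_ \notin _) => /=; nia.
Qed.

End SizeBound.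

(** Every petal meets one of the endpoints of [l0], of which there are two per entry; disjoint
    petals meet different ones. *)
Lemma sunflower_maximal (T : finType) (e : rel T) x y l0 l :
  (forall p, petal e x y p -> exists2 q, q \in l0 & ~~ apart p q) ->
  sunflower e x y l -> size l <= (size l0).*2.
Proof.
move=> mx /andP[pw /allP pt].
pose cov := map fst l0 ++ map snd l0.
have -> : (size l0).*2 = size cov by rewrite size_cat !size_map addnn.
pose f (p : T * T) := if p.1 \in cov then p.1 else p.2.
have fcov p : p \in l -> f p \in cov.
  move=> /pt/mx[q ql]; rewrite /f /apart; case: ifP => // p1.
  have q1 : q.1 \in cov by rewrite mem_cat map_f.
  have q2 : q.2 \in cov by rewrite mem_cat (map_f snd) ?orbT.
  have -> : p.1 != q.1 by apply: contraFneq p1 => ->.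
  have -> /= : p.1 != q.2 by apply: contraFneq p1 => ->.
  by rewrite negb_and !negbK => /orP[]/eqP->.
have fp p : f p = p.1 \/ f p = p.2 by rewrite /f; case: ifP; [left|right].
have inj : {in l &, injective f}.
  move=> p q pl ql E; have [//|pq] := eqVneq p q; exfalso.
  have /and4P[] := pairwise_in (@apart_sym T) pw pl ql pq.
  by move: E; case: (fp p) => ->; case: (fp q) => -> ->; rewrite eqxx.
have ul : uniq l by apply: pairwise_uniq pw => -[a b]; rewrite /apart /= eqxx.
rewrite -(size_map f); apply: uniq_leq_size; first by rewrite map_inj_in_uniq.
by move=> z /mapP[p pl ->]; apply: fcov.
Qed.

(** * Polynomial-time combinators *)

Class encodable (X : Type) := encode : X -> data.

(** Inside the algorithm numbers are loop counters and indices and hence unary; only the budget in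
    the input and output is a list of binary digits. *)
Definition unary (n : nat) : data := iter n (Defs.Cons Defs.Nil) Defs.Nil.

#[export] Instance encodable_bool : encodable bool := enc_bool.
#[export] Instance encodable_unit : encodable unit := fun=> Defs.Nil.
#[export] Instance encodable_nat : encodable nat := unary.
#[export] Instance encodable_seq X (e : encodable X) : encodable (seq X) :=
  enc_seq e.
#[export] Instance encodable_prod X Y (eX : encodable X) (eY : encodable Y) :
  encodable (X * Y) := enc_pair eX eY.

Definition esz X {eX : encodable X} (x : X) := dsize (encode x).

(** Encodings have positive size, so the base is at least 2 and a larger exponent alone absorbs
    constants and sums. *)
Definition pbound X {eX : encodable X} (g : X -> nat) :=
  exists d, forall x, g x <= (esz x).+1 ^ d.

Lemma dsize_gt0 v : 0 < dsize v. Proof. by case: v. Qed.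

Lemma esz_gt0 X {eX : encodable X} (x : X) : 0 < esz x.
Proof. exact: dsize_gt0. Qed.

#[local] Hint Resolve esz_gt0 dsize_gt0 : core.

Section Bounds.
Context {X : Type} {eX : encodable X}.
Implicit Types g : X -> nat.

Lemma pbound_le g g' : (forall x, g x <= g' x) -> pbound g' -> pbound g.
Proof. by move=> gg [d H]; exists d => x; apply: leq_trans (H x). Qed.

Lemma pbound_const c : pbound (fun _ : X => c).
Proof. by exists c => x; apply: ltnW; apply: ltn_expl; rewrite ltnS. Qed.

Lemma pbound_size : pbound (fun x : X => esz x).
Proof. by exists 1 => x; rewrite expn1. Qed.

Lemma pbound_mul g1 g2 : pbound g1 -> pbound g2 -> pbound (fun x => g1 x * g2 x).
Proof.
by move=> [d1 H1] [d2 H2]; exists (d1 + d2) => x; rewrite expnD leq_mul.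
Qed.

Lemma pbound_succ g : pbound g -> pbound (fun x => (g x).+1).
Proof.
move=> [d H]; exists d.+1 => x; rewrite expnS mulSn -addn1.
by apply: leq_add (H x) _; rewrite muln_gt0 esz_gt0 expn_gt0.
Qed.

Lemma pbound_add g1 g2 : pbound g1 -> pbound g2 -> pbound (fun x => g1 x + g2 x).
Proof.
move=> b1 b2; apply: pbound_le (pbound_mul (pbound_succ b1) (pbound_succ b2)) => x.
by rewrite mulSn mulnS; lia.
Qed.

Lemma pbound_exp g c : pbound g -> pbound (fun x => g x ^ c).
Proof.
by move=> [d H]; exists (d * c) => x; rewrite expnM; case: c => // c; rewrite leq_exp2r.
Qed.

Lemma pbound_comp Y {eY : encodable Y} (g : Y -> nat) (f : X -> Y) :
  pbound g -> pbound (fun x => esz (f x)) -> pbound (fun x => g (f x)).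
Proof.
move=> [d H] /pbound_succ/(@pbound_exp _ d) [c Hc]; exists c => x.
exact: leq_trans (H _) (Hc x).
Qed.

End Bounds.

(* A command run at register r reads its input there, leaves its output there
   and uses the registers above r as work space. *)
Definition ptime X Y {eX : encodable X} {eY : encodable Y} (f : X -> Y) :=
  exists (p : nat -> cmd) (t : X -> nat), pbound t /\
  forall x r s, s r = encode x -> exists s' n,
    [/\ exec (p r) s s' n, n <= t x, s' r = encode (f x)
      & forall q, q < r -> s' q = s q].

(** Assignments are charged for the trees they write, so a time bound is also an output bound;
    composition rests on this. *)
Lemma exec_dsize c s s' n : exec c s s' n ->
  forall x, dsize (s' x) <= dsize (s x) + n.
Proof.
elim=> {c s s' n} [s|s y e|c1 c2 s1 s2 s3 t1 t2 _ IH1 _ IH2|e c1 c2 s s' t _ _ IH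
  |e c1 c2 s s' t _ _ IH|e c s1 s2 s3 t1 t2 _ _ IH1 _ IH2|e c s _] x.
- by rewrite leq_addr.
- by rewrite /update; case: eqP => _; lia.
- by have := IH1 x; have := IH2 x; lia.
- by have := IH x; lia.
- by have := IH x; lia.
- by have := IH1 x; have := IH2 x; lia.
- by lia.
Qed.

Lemma ptime_size X Y (eX : encodable X) (eY : encodable Y) (f : X -> Y) :
  ptime f -> pbound (fun x => esz (f x)).
Proof.
case=> p [t [bt H]]; apply: pbound_le (pbound_add pbound_size bt) => x.
have [//|s' [n [ex nt s'0 _]]] := H x 0 (init (encode x)).
have := exec_dsize ex 0; rewrite s'0 /= -/(esz (f x)) -/(esz x); lia.
Qed.

Definition run c s (P : store -> Prop) (B : nat) :=
  exists s' n, [/\ exec c s s' n, n <= B & P s'].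

Lemma run_le c s P B B' : B <= B' -> run c s P B -> run c s P B'.
Proof. by move=> BB [s' [n [? ? ?]]]; exists s', n; split=> //; apply: leq_trans BB. Qed.

Lemma run_seq c1 c2 s (P1 P2 : store -> Prop) B1 B2 : run c1 s P1 B1 ->
  (forall s1, P1 s1 -> run c2 s1 P2 B2) -> run (Seq c1 c2) s P2 (B1 + B2).
Proof.
move=> [s1 [n1 [e1 b1 p1]]] /(_ s1 p1) [s2 [n2 [e2 b2 p2]]].
exists s2, (n1 + n2); split=> //; last exact: leq_add.
exact: exec_seq e1 e2.
Qed.

Lemma run_assign x e s (P : store -> Prop) :
  P (update s x (eval s e)) ->
  run (Assign x e) s P (esize e + dsize (eval s e)).
Proof. by move=> H; exists (update s x (eval s e)), (esize e + dsize (eval s e)); split=> //; constructor. Qed.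

Lemma run_ptime X Y (eX : encodable X) (eY : encodable Y) (f : X -> Y) p t x r s
    (P : store -> Prop) :
  (forall x r s, s r = encode x -> exists s' n,
    [/\ exec (p r) s s' n, n <= t x, s' r = encode (f x)
      & forall q, q < r -> s' q = s q]) ->
  s r = encode x ->
  (forall s', s' r = encode (f x) -> (forall q, q < r -> s' q = s q) -> P s') ->
  run (p r) s P (t x).
Proof.
move=> H sr HP; have [s' [n [ex nt s'r low]]] := H x r s sr.
by exists s', n; split=> //; apply: HP.
Qed.

Lemma ptime_expr X Y (eX : encodable X) (eY : encodable Y) (f : X -> Y) (e : nat -> expr) c :
  (forall r, esize (e r) = c) ->
  (forall x r s, s r = encode x -> eval s (e r) = encode (f x)) ->
  pbound (fun x => esz (f x)) -> ptime f.
Proof.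
move=> ec ee bf; exists (fun r => Assign r (e r)), (fun x => c + esz (f x)).
split; first exact: pbound_add (pbound_const _) bf.
move=> x r s sr; exists (update s r (eval s (e r))), (esize (e r) + dsize (eval s (e r))).
split.
- by constructor.
- by rewrite ec (ee x).
- by rewrite /update eqxx (ee x).
- by move=> q qr; rewrite /update; case: eqP qr => // ->; rewrite ltnn.
Qed.

Section Basics.
Context {X Y Z : Type} {eX : encodable X} {eY : encodable Y} {eZ : encodable Z}.

Lemma eq_ptime (f g : X -> Y) : f =1 g -> ptime f -> ptime g.
Proof.
move=> fg [p [t [bt H]]]; exists p, t; split=> // x r s /H[s' [n [? ? E ?]]].
by exists s', n; split=> //; rewrite E fg.
Qed.

Lemma ptime_id : ptime (fun x : X => x).
Proof. by apply: (@ptime_expr _ _ _ _ _ (fun r => EVar r) 1) => //; apply: pbound_size. Qed.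

Fixpoint quote (v : data) : expr :=
  if v is Defs.Cons a b then ECons (quote a) (quote b) else ENil.

Lemma eval_quote s v : eval s (quote v) = v.
Proof. by elim: v => //= a -> b ->. Qed.

Lemma ptime_const (y : Y) : ptime (fun _ : X => y).
Proof.
apply: (@ptime_expr _ _ _ _ _ (fun r => quote (encode y)) (esize (quote (encode y)))) => //.
  by move=> x r s _; rewrite eval_quote.
exact: pbound_const.
Qed.

Lemma ptime_comp (f : Y -> Z) (g : X -> Y) :
  ptime f -> ptime g -> ptime (fun x => f (g x)).
Proof.
move=> [p [t [bt H]]] pg; have bg := ptime_size pg; case: pg => [q [u [bu G]]].
exists (fun r => Seq (q r) (p r)), (fun x => u x + t (g x)); split.
  by apply: pbound_add => //; apply: pbound_comp.
move=> x r s sr.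
have main : run (Seq (q r) (p r)) s
   (fun s2 => s2 r = encode (f (g x)) /\ forall q, q < r -> s2 q = s q) (u x + t (g x)); last first.
  by have [s' [n [ex le [? ?]]]] := main; exists s', n; split.
apply: (@run_seq _ _ _ (fun s1 => s1 r = encode (g x) /\ forall q, q < r -> s1 q = s q)).
  by apply: (run_ptime G sr).
move=> s1 [s1r low]; apply: (run_ptime H s1r) => s2 s2r low2; split=> // z zr.
by rewrite low2 // low.
Qed.

Lemma ptime_pair (f : X -> Y) (g : X -> Z) :
  ptime f -> ptime g -> ptime (fun x => (f x, g x)).
Proof.
move=> pf pg; have bf := ptime_size pf; have bg := ptime_size pg.
case: pf pg => [p [t [bt H]]] [q [u [bu G]]].
exists (fun r => Seq (Assign r.+1 (EVar r)) (Seq (p r.+1)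
  (Seq (Assign r.+2 (EVar r)) (Seq (q r.+2) (Assign r (ECons (EVar r.+1) (EVar r.+2))))))),
  (fun x => (1 + esz x) + (t x + ((1 + esz x) + (u x + (3 + esz (f x, g x)))))).
split.
  do ?[apply: pbound_add]; rewrite ?pbound_const //; try exact: pbound_const;
    try exact: pbound_size.
  apply: pbound_le (pbound_succ (pbound_add bf bg)) => x; exact: leqnn.
move=> x r s sr.
have main : run (Seq (Assign r.+1 (EVar r)) (Seq (p r.+1)
  (Seq (Assign r.+2 (EVar r)) (Seq (q r.+2) (Assign r (ECons (EVar r.+1) (EVar r.+2)))))))
  s (fun s2 => s2 r = encode (f x, g x) /\ forall q, q < r -> s2 q = s q)
  ((1 + esz x) + (t x + ((1 + esz x) + (u x + (3 + esz (f x, g x)))))); last first.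
  by have [s' [n [ex le [? ?]]]] := main; exists s', n; split.
apply: (@run_seq _ _ _ (fun s1 => s1 r.+1 = encode x /\ forall q, q <= r -> s1 q = s q)).
    apply: run_le (run_assign _); first by rewrite /= sr.
    rewrite /= /update eqxx; split=> // z zr; case: eqP zr => // ->.
    by rewrite ltnn.
  move=> s1 [s1r low1]; apply: (@run_seq _ _ _ (fun s2 => s2 r.+1 = encode (f x) /\ forall q, q <= r -> s2 q = s q)).
    apply: (run_ptime H s1r) => s2 s2r low2; split=> // z zr.
    by rewrite low2 // low1.
  move=> s2 [s2r low2]; apply: (@run_seq _ _ _ (fun s3 => [/\ s3 r.+2 = encode x, s3 r.+1 = encode (f x) & forall q, q <= r -> s3 q = s q])).
    apply: run_le (run_assign _); first by rewrite /= low2 // sr.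
    rewrite /= /update eqxx low2 // sr; split=> //.
      by rewrite -[r.+2]addn1 -[X in X == _]addn0 eqn_add2l.
    move=> z zr; case: eqP => [E|_]; last exact: low2.
    by move: zr; rewrite E; lia.
  move=> s3 [s3a s3b low3]; apply: (@run_seq _ _ _ (fun s4 => [/\ s4 r.+2 = encode (g x), s4 r.+1 = encode (f x) & forall q, q < r -> s4 q = s q])).
    apply: (run_ptime G s3a) => s4 s4r low4; split=> //.
      by rewrite low4.
    by move=> z zr; rewrite low4 ?low3 //; lia.
  move=> s4 [s4a s4b low4]; apply: run_le (run_assign _); first by rewrite /= s4a s4b.
  rewrite /= /update eqxx s4a s4b; split=> // z zr; case: eqP zr => [->|_ /low4 //].
  by rewrite ltnn.
Qed.

Lemma ptime_if (b : X -> bool) (f g : X -> Y) :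
  ptime b -> ptime f -> ptime g -> ptime (fun x => if b x then f x else g x).
Proof.
move=> [p0 [t0 [bt0 H0]]] [p1 [t1 [bt1 H1]]] [p2 [t2 [bt2 H2]]].
exists (fun r => Seq (Assign r.+1 (EVar r)) (Seq (p0 r.+1) (If (EVar r.+1) (p1 r) (p2 r)))),
  (fun x => (1 + esz x) + (t0 x + (1 + (t1 x + t2 x)))); split.
  by do ?[apply: pbound_add] => //; try exact: pbound_const; exact: pbound_size.
move=> x r s sr; set F := if b x then f x else g x.
have main : run (Seq (Assign r.+1 (EVar r)) (Seq (p0 r.+1) (If (EVar r.+1) (p1 r) (p2 r))))
    s (fun s2 => s2 r = encode F /\ forall q, q < r -> s2 q = s q)
    ((1 + esz x) + (t0 x + (1 + (t1 x + t2 x)))); last first.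
  by have [s' [n [ex le [? ?]]]] := main; exists s', n; split.
apply: (@run_seq _ _ _ (fun s1 => s1 r.+1 = encode x /\ forall q, q <= r -> s1 q = s q)).
  apply: run_le (run_assign _); first by rewrite /= sr.
  rewrite /= /update eqxx; split=> // z zr; case: eqP zr => // ->.
  by rewrite ltnn.
move=> s1 [s1r low1]; apply: (@run_seq _ _ _ (fun s2 => s2 r.+1 = encode (b x) /\ forall q, q <= r -> s2 q = s q)).
  apply: (run_ptime H0 s1r) => s2 s2r low2; split=> // z zr.
  by rewrite low2 // low1.
move=> s2 [s2r low2]; have s2x : s2 r = encode x by rewrite low2.
rewrite /F; case Eb: (b x) s2r => s2r.
  have [s' [n [ex le E low]]] := H1 x r s2 s2x.
  exists s', (1 + n); split; first 1 last.
  - by lia.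
  - by split=> // z zr; rewrite low // low2 // ltnW.
  - by apply: exec_if_true => //=; rewrite s2r.
have [s' [n [ex le E low]]] := H2 x r s2 s2x.
exists s', (1 + n); split; first 1 last.
- by lia.
- by split=> // z zr; rewrite low // low2 // ltnW.
- by apply: exec_if_false => //=; rewrite s2r.
Qed.

End Basics.

Lemma esz_pair X Y (eX : encodable X) (eY : encodable Y) (x : X) (y : Y) :
  esz (x, y) = (esz x + esz y).+1.
Proof. by []. Qed.

Lemma esz_cons X (eX : encodable X) (x : X) (s : seq X) :
  esz (x :: s) = (esz x + esz s).+1.
Proof. by []. Qed.

Lemma esz_seq X (eX : encodable X) (s : seq X) :
  esz s = (sumn [seq (esz x).+1 | x <- s]).+1.
Proof. by elim: s => //= x s IH; rewrite esz_cons IH addnS. Qed.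

Lemma esz_rev X (eX : encodable X) (s : seq X) : esz (rev s) = esz s.
Proof. by rewrite !esz_seq map_rev sumn_rev. Qed.

Lemma esz_cat X (eX : encodable X) (s1 s2 : seq X) :
  (esz (s1 ++ s2)).+1 = esz s1 + esz s2.
Proof. by rewrite !esz_seq map_cat sumn_cat; lia. Qed.

Lemma size_esz X (eX : encodable X) (s : seq X) : size s <= esz s.
Proof. by elim: s => //= x s; rewrite esz_cons ltnS; lia. Qed.

Lemma esz_mid X (eX : encodable X) (s1 s2 : seq X) x : esz x <= esz (s1 ++ x :: s2).
Proof. by have := esz_cat eX s1 (x :: s2); rewrite esz_cons; have := esz_gt0 s1; lia. Qed.

Lemma esz_nat (n : nat) : esz n = n.*2.+1.
Proof. by elim: n => // n; rewrite /esz /encode /= => ->; rewrite doubleS. Qed.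

Lemma esz_bool (b : bool) : esz b <= 3. Proof. by case: b. Qed.

(** * Loops over lists *)

Section Fold.
Context {X S A : Type} {eX : encodable X} {eS : encodable S} {eA : encodable A}.
Variables (l : X -> seq A) (i : X -> S) (f : X -> S -> A -> S) (g : X -> nat).
Hypotheses (pl : ptime l) (pi : ptime i).
Hypothesis pf : ptime (fun z : X * S * A => f z.1.1 z.1.2 z.2).
Hypothesis bg : pbound g.
Hypothesis sizeP : forall x l1 l2, l x = l1 ++ l2 ->
  esz (foldl (f x) (i x) l1) <= g x.

(** A polynomial step can let the state grow exponentially under iteration. The hypothesis [sizeP]
    bounds all intermediate states in terms of the input alone, and therefore the cost of every
    round. *)
Lemma ptime_foldl : ptime (fun x => foldl (f x) (i x) (l x)).
Proof.
have bl := ptime_size pl; have bi := ptime_size pi.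
case: pl pi pf => [p1 [t1 [bt1 H1]]] [p2 [t2 [bt2 H2]]] [p3 [t3 [[d Ht3] H3]]].
pose lsz x := @esz _ (encodable_seq eA) (l x).
(* Bounds the encoding of the triple of input, state and entry that is passed to the step. *)
pose M x := (@esz _ eX x + g x + lsz x).+2.
have bM : pbound M.
  by do 2!apply: pbound_succ; do ?[apply: pbound_add] => //; exact: pbound_size.
pose iter_cost x := 1 + (6 + M x + ((M x).+1 ^ d + (1 + g x + (2 + lsz x)))).
have bI : pbound iter_cost.
  rewrite /iter_cost; do ?[apply: pbound_add] => //; try exact: pbound_const.
  by apply: pbound_exp; apply: pbound_succ.
pose body r := Seq (Assign r.+3 (ECons (ECons (EVar r) (EVar r.+2)) (EHd (EVar r.+1))))
  (Seq (p3 r.+3) (Seq (Assign r.+2 (EVar r.+3)) (Assign r.+1 (ETl (EVar r.+1))))).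
pose prog r := Seq (Assign r.+1 (EVar r)) (Seq (p1 r.+1) (Seq (Assign r.+2 (EVar r))
  (Seq (p2 r.+2) (Seq (While (EVar r.+1) (body r)) (Assign r (EVar r.+2)))))).
pose cost x := 1 + @esz _ eX x + (t1 x + (1 + @esz _ eX x + (t2 x +
  (lsz x * iter_cost x + 1 + (1 + g x))))).
exists prog, cost; split.
  rewrite /cost; do ?[apply: pbound_add] => //; try exact: pbound_const;
   try exact: pbound_size.
  exact: pbound_mul.
move=> x r s sr.
have main : run (prog r) s (fun s2 =>
    s2 r = encode (foldl (f x) (i x) (l x)) /\ forall q, q < r -> s2 q = s q) (cost x);
  last first.
  by have [s' [n [ex le [? ?]]]] := main; exists s', n; split.
have upd (s1 : store) z v q : q != z -> update s1 z v q = s1 q.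
  by move=> qz; rewrite /update (negPf qz).
have updd (s1 : store) z v : update s1 z v z = v by rewrite /update eqxx.
apply: (@run_seq _ _ _ (fun s1 => s1 r.+1 = encode x /\ forall q, q <= r -> s1 q = s q)).
  apply: run_le (run_assign _); first by rewrite /= sr.
  by rewrite /= updd; split=> // z zr; rewrite upd //; lia.
move=> s1 [s1r low1].
apply: (@run_seq _ _ _ (fun s2 => s2 r.+1 = encode (l x) /\ forall q, q <= r -> s2 q = s q)).
  apply: (run_ptime H1 s1r) => s2 s2r low2; split=> // z zr.
  by rewrite low2 // low1.
move=> s2 [s2r low2].
apply: (@run_seq _ _ _ (fun s3 => [/\ s3 r.+2 = encode x, s3 r.+1 = encode (l x)
    & forall q, q <= r -> s3 q = s q])).
  apply: run_le (run_assign _); first by rewrite /= low2 // sr.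
  rewrite /= updd low2 // sr; split=> //; first by rewrite upd //; lia.
  by move=> z zr; rewrite upd ?low2 //; lia.
move=> s3 [s3a s3b low3].
apply: (@run_seq _ _ _ (fun s4 => [/\ s4 r.+2 = encode (i x), s4 r.+1 = encode (l x)
    & forall q, q <= r -> s4 q = s q])).
  apply: (run_ptime H2 s3a) => s4 s4r low4; split=> //; first by rewrite low4.
  by move=> z zr; rewrite low4 ?low3 //; lia.
move=> s4 [s4a s4b low4].
apply: (@run_seq _ _ _ (fun s5 => s5 r.+2 = encode (foldl (f x) (i x) (l x)) /\
    forall q, q <= r -> s5 q = s q)).
  (* Loop invariant: [l1] has been consumed, register r.+1 holds what remains, r.+2 the state, and r
     still holds the input. *)
  have step : forall l2 l1 s5, l x = l1 ++ l2 ->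
    s5 r.+2 = encode (foldl (f x) (i x) l1) -> s5 r.+1 = encode l2 ->
    (forall q, q <= r -> s5 q = s q) ->
    run (While (EVar r.+1) (body r)) s5 (fun s6 =>
      s6 r.+2 = encode (foldl (f x) (i x) (l x)) /\ forall q, q <= r -> s6 q = s q)
      (size l2 * iter_cost x + 1).
    elim=> [|a l2 IH] l1 s5 El s5a s5b low5.
      exists s5, 1; split=> //; first exact: exec_while_false.
      by rewrite El cats0.
    pose st := foldl (f x) (i x) l1.
    have El' : l x = rcons l1 a ++ l2 by rewrite cat_rcons.
    have szst : esz st <= g x := sizeP El.
    have szst' : esz (f x st a) <= g x by have := sizeP El'; rewrite foldl_rcons.
    have sza : esz a <= esz (l x) by rewrite El esz_mid.
    have szl2 : esz l2 <= esz (l x).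
      by rewrite El; have := esz_cat eA l1 (a :: l2); rewrite esz_cons; have := esz_gt0 l1;
        have := esz_gt0 a; lia.
    have szM : esz (x, st, a) <= M x.
      have le5 (n1 n2 n3 n4 n5 : nat) : n2 <= n4 -> n3 <= n5 ->
        ((n1 + n2).+1 + n3).+1 <= (n1 + n4 + n5).+2 by lia.
      exact: le5 szst sza.
    have [s6 [n [ex le [s6a s6b low6]]]] : run (body r) s5 (fun s6 =>
       [/\ s6 r.+2 = encode (f x st a), s6 r.+1 = encode l2 & forall q, q <= r -> s6 q = s q])
       (6 + M x + ((M x).+1 ^ d + (1 + g x + (2 + esz (l x))))).
      apply: (@run_seq _ _ _ (fun s6 => [/\ s6 r.+3 = encode (x, st, a),
        s6 r.+1 = encode (a :: l2) & forall q, q <= r -> s6 q = s q])).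
        apply: run_le (run_assign _).
          rewrite /= s5a s5b low5 // sr /=; move: szM.
          by rewrite /esz /encode /= -/st; lia.
        rewrite /= updd s5a s5b low5 // sr; split=> //; first by rewrite upd //; lia.
        by move=> z zr; rewrite upd ?low5 //; lia.
      move=> s6 [s6a s6b low6].
      apply: (@run_seq _ _ _ (fun s7 => [/\ s7 r.+3 = encode (f x st a),
        s7 r.+1 = encode (a :: l2) & forall q, q <= r -> s7 q = s q])).
        apply: (@run_le _ _ _ (t3 (x, st, a))).
          apply: leq_trans (Ht3 _) _; case: (d) => // d'; rewrite leq_exp2r //.
        apply: (run_ptime H3 s6a) => s7 s7r low7; split=> //; first by rewrite low7 //; lia.
        by move=> z zr; rewrite low7 ?low6 //; lia.
      move=> s7 [s7a s7b low7].
      apply: (@run_seq _ _ _ (fun s8 => [/\ s8 r.+2 = encode (f x st a),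
        s8 r.+1 = encode (a :: l2) & forall q, q <= r -> s8 q = s q])).
        apply: run_le (run_assign _); first by rewrite /= s7a leq_add2l.
        rewrite /= updd s7a; split=> //; first by rewrite upd //; lia.
        by move=> z zr; rewrite upd ?low7 //; lia.
      move=> s8 [s8a s8b low8].
      apply: run_le (run_assign _); first by rewrite /= s8b leq_add2l.
      rewrite /= updd s8b; split=> //; first by rewrite upd //; lia.
      by move=> z zr; rewrite upd ?low8 //; lia.
    have [||||s9 [n9 [ex9 le9 P9]]] := IH (rcons l1 a) s6 => //.
      by rewrite foldl_rcons.
    exists s9, (1 + n + n9); split=> //; last first.
      by rewrite [size _]/= mulSn -[leqRHS]addnA; apply: leq_add le9; rewrite /iter_cost leq_add2l.
    by apply: (@exec_while_true (EVar r.+1)) ex ex9; rewrite /= s5b.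
  apply: run_le (step (l x) [::] s4 _ _ _ _) => //.
  by rewrite leq_add2r leq_mul2r size_esz orbT.
move=> s5 [s5a low5]; apply: run_le (run_assign _).
  by rewrite /= s5a leq_add2l; apply: (sizeP (l2 := [::])); rewrite cats0.
rewrite /= updd s5a; split=> // z zr; rewrite upd ?low5 //; lia.
Qed.

End Fold.

Lemma esz_prefix X (eX : encodable X) (s1 s2 : seq X) : esz s1 <= esz (s1 ++ s2).
Proof. by rewrite !esz_seq map_cat sumn_cat ltnS leq_addr. Qed.

Section Derived.
Context {X Y Z A B : Type} {eX : encodable X} {eY : encodable Y}
  {eZ : encodable Z} {eA : encodable A} {eB : encodable B}.

Lemma ptime_app2 (f : A -> B -> Y) (g : X -> A) (h : X -> B) :
  ptime (fun p : A * B => f p.1 p.2) -> ptime g -> ptime h ->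
  ptime (fun x => f (g x) (h x)).
Proof.
move=> pf pg ph.
exact: (ptime_comp (f := fun p : A * B => f p.1 p.2) pf (ptime_pair pg ph)).
Qed.

Lemma pbound_nat (n : X -> nat) : ptime n -> pbound n.
Proof.
by move/ptime_size; apply: pbound_le => x; rewrite esz_nat; lia.
Qed.

Lemma ptime_fst (f : X -> A * B) : ptime f -> ptime (fun x => (f x).1).
Proof.
apply: (ptime_comp (f := fun p : A * B => p.1)).
apply: (@ptime_expr _ _ _ _ _ (fun r => EHd (EVar r)) 2) => // [[a b] r s /= ->//|].
by apply: pbound_le pbound_size => -[a b]; rewrite esz_pair /=; lia.
Qed.

Lemma ptime_snd (f : X -> A * B) : ptime f -> ptime (fun x => (f x).2).
Proof.
apply: (ptime_comp (f := fun p : A * B => p.2)).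
apply: (@ptime_expr _ _ _ _ _ (fun r => ETl (EVar r)) 2) => // [[a b] r s /= ->//|].
by apply: pbound_le pbound_size => -[a b]; rewrite esz_pair /=; lia.
Qed.

Lemma ptime_cons (f : X -> A) (l : X -> seq A) :
  ptime f -> ptime l -> ptime (fun x => f x :: l x).
Proof.
by move=> pf pl; have [p [t [bt H]]] := ptime_pair pf pl; exists p, t.
Qed.

Lemma ptime_behead (l : X -> seq A) : ptime l -> ptime (fun x => behead (l x)).
Proof.
apply: (ptime_comp (f := @behead A)).
apply: (@ptime_expr _ _ _ _ _ (fun r => ETl (EVar r)) 2) => // [[|a b] r s /= ->//|].
by apply: pbound_le pbound_size => -[|a b] //=; rewrite esz_cons; lia.
Qed.

Lemma ptime_pred (n : X -> nat) : ptime n -> ptime (fun x => (n x).-1).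
Proof.
apply: (ptime_comp (f := predn)).
apply: (@ptime_expr _ _ _ _ _ (fun r => ETl (EVar r)) 2) => // [[|a] r s /= ->//|].
by apply: pbound_le pbound_size => n'; rewrite !esz_nat; lia.
Qed.

Lemma ptime_succ (n : X -> nat) : ptime n -> ptime (fun x => (n x).+1).
Proof.
apply: (ptime_comp (f := succn)).
apply: (@ptime_expr _ _ _ _ _ (fun r => ECons ENil (EVar r)) 3) => // [a r s /= ->//|].
by apply: pbound_le (pbound_succ (pbound_succ pbound_size)) => n'; rewrite !esz_nat; lia.
Qed.

(** A unary number and a list of that many units have the same encoding, so the program is
    unchanged; this turns [ptime_foldl] into bounded iteration. *)
Lemma ptime_nseq (n : X -> nat) : ptime n -> ptime (fun x => nseq (n x) tt).
Proof.
move=> [p [t [bt H]]]; exists p, t; split=> // x r s /H[s' [k [ex le E low]]].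
exists s', k; split=> //; rewrite E.
by elim: (n x) => // m; rewrite /encode /= /unary /= => ->.
Qed.

Lemma ptime_nil (l : X -> seq A) : ptime l -> ptime (fun x => nilp (l x)).
Proof.
move=> pl; apply: (@eq_ptime _ _ _ _ (fun x => foldl (fun _ _ => false) true (l x))).
  by move=> x; case: (l x) => //= a s; rewrite /nilp /=; elim: s.
apply: (@ptime_foldl _ _ _ _ _ _ l (fun=> true) (fun _ _ _ => false) (fun=> 3)) => //.
- exact: ptime_const.
- exact: ptime_const.
- exact: pbound_const.
- by move=> x l1 l2 _; apply: esz_bool.
Qed.

Lemma ptime_head (a0 : A) (l : X -> seq A) :
  ptime l -> ptime (fun x => head a0 (l x)).
Proof.
apply: (ptime_comp (f := head a0)).
apply: (@eq_ptime _ _ _ _ (fun s => if nilp s then a0 else head a0 s)); first by case.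
pose d := @encode A eA a0.
exists (fun r => If (EVar r) (Assign r (EHd (EVar r))) (Assign r (quote d))),
  (fun s => 3 + esz s + (esize (quote d) + dsize d)); split.
  do ?[apply: pbound_add]; try exact: pbound_const; exact: pbound_size.
move=> s r st sr.
have fin v : exists s', [/\ s' = update st r v, s' r = v
    & forall q, q < r -> s' q = st q].
  exists (update st r v); split=> //; first by rewrite /update eqxx.
  by move=> q qr; rewrite /update; case: eqP qr => // ->; rewrite ltnn.
case: s sr => [|a s] sr.
  have [s' [E s'r low]] := fin (eval st (quote d)).
  exists s', (1 + (esize (quote d) + dsize (eval st (quote d)))); split=> //.
  - by rewrite E; apply: exec_if_false; [rewrite /= sr | apply: exec_assign].
  - by rewrite eval_quote; lia.
  - by rewrite s'r eval_quote.
have [s' [E s'r low]] := fin (eval st (EHd (EVar r))).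
exists s', (1 + (2 + dsize (eval st (EHd (EVar r))))); split=> //.
- by rewrite E; apply: exec_if_true; [rewrite /= sr | apply: exec_assign].
- by rewrite /= sr /= -/(esz a) esz_cons; lia.
- by rewrite s'r /= sr.
Qed.

Lemma ptime_andb (b c : X -> bool) :
  ptime b -> ptime c -> ptime (fun x => b x && c x).
Proof. by move=> pb pc; apply: (ptime_if pb pc (ptime_const false)). Qed.

Lemma ptime_orb (b c : X -> bool) :
  ptime b -> ptime c -> ptime (fun x => b x || c x).
Proof. by move=> pb pc; apply: (ptime_if pb (ptime_const true) pc). Qed.

Lemma ptime_negb (b : X -> bool) : ptime b -> ptime (fun x => ~~ b x).
Proof. by move=> pb; apply: (ptime_if pb (ptime_const false) (ptime_const true)). Qed.

Lemma ptime_addb (b c : X -> bool) :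
  ptime b -> ptime c -> ptime (fun x => b x (+) c x).
Proof.
move=> pb pc; apply: eq_ptime (ptime_if pb (ptime_negb pc) pc) => x.
by case: (b x).
Qed.

End Derived.

Lemma ptime_eqb X (eX : encodable X) (b c : X -> bool) :
  ptime b -> ptime c -> ptime (fun x => b x == c x).
Proof.
move=> pb pc; apply: eq_ptime (ptime_negb (ptime_addb pb pc)) => x.
by case: (b x); case: (c x).
Qed.

Lemma ptime_prefix_size X A B (eX : encodable X) (eA : encodable A)
    (eB : encodable B) (l : X -> seq A) (f : X -> A -> B) :
  ptime l -> ptime (fun z : X * A => f z.1 z.2) ->
  exists2 M : X -> nat, pbound M & forall x l1 l2, l x = l1 ++ l2 ->
    sumn [seq (esz (f x a)).+1 | a <- l1] <= M x.
Proof.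
move=> pl pf; have bl := ptime_size pl; have [d Hd] := ptime_size pf.
exists (fun x => esz (l x) * ((esz x + esz (l x)).+2 ^ d).+1).
  apply: pbound_mul => //; apply: pbound_succ; apply: pbound_exp.
  by do 2!apply: pbound_succ; apply: pbound_add => //; apply: pbound_size.
move=> x l1 l2 El.
have le : forall m1 m2, l x = m1 ++ m2 ->
    sumn [seq (esz (f x a)).+1 | a <- m2] <= size m2 * ((esz x + esz (l x)).+2 ^ d).+1.
  move=> m1 m2; elim: m2 m1 => // a m2 IH m1 Em /=.
  rewrite mulSn; apply: leq_add; last by apply: (IH (rcons m1 a)); rewrite cat_rcons.
  rewrite ltnS; apply: leq_trans (Hd (x, a)) _; case: (d) => // d'.
  rewrite leq_exp2r // ltnS esz_pair ltnS leq_add2l Em; exact: esz_mid.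
have := le [::] (l x) erefl; rewrite El map_cat sumn_cat => le1.
apply: leq_trans (leq_addr _ _) (leq_trans le1 _).
by rewrite leq_mul2r size_esz orbT.
Qed.

Lemma ptime_rev X A (eX : encodable X) (eA : encodable A) (l : X -> seq A) :
  ptime l -> ptime (fun x => rev (l x)).
Proof.
move=> pl.
have E s acc : foldl (fun s a => a :: s) acc s = catrev s acc :> seq A.
  by elim: s acc => //= a s IH acc; rewrite IH.
apply: (@eq_ptime _ _ _ _ (fun x => foldl (fun s a => a :: s) [::] (l x))).
  by move=> x; rewrite E.
apply: (@ptime_foldl _ _ _ _ _ _ l (fun=> [::]) (fun _ s a => a :: s) (fun x => esz (l x))) => //.
- exact: ptime_const.
- apply: ptime_cons; first by apply: ptime_snd; apply: ptime_id.
  by apply: ptime_snd; apply: ptime_fst; apply: ptime_id.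
- exact: ptime_size.
- move=> x l1 l2 ->; rewrite E catrevE cats0 esz_rev; exact: esz_prefix.
Qed.

Lemma ptime_map X A B (eX : encodable X) (eA : encodable A) (eB : encodable B)
    (l : X -> seq A) (f : X -> A -> B) :
  ptime l -> ptime (fun z : X * A => f z.1 z.2) ->
  ptime (fun x => map (f x) (l x)).
Proof.
move=> pl pf; have [M bM HM] := ptime_prefix_size pl pf.
have E x s acc : foldl (fun s a => f x a :: s) acc s = catrev (map (f x) s) acc.
  by elim: s acc => //= a s IH acc; rewrite IH.
apply: (@eq_ptime _ _ _ _ (fun x => rev (foldl (fun s a => f x a :: s) [::] (l x)))).
  by move=> x; rewrite E catrevE cats0 revK.
apply: ptime_rev.
apply: (@ptime_foldl _ _ _ _ _ _ l (fun=> [::]) (fun x s a => f x a :: s)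
  (fun x => (M x).+1)) => //.
- exact: ptime_const.
- apply: ptime_cons; last by apply: ptime_snd; apply: ptime_fst; apply: ptime_id.
  apply: (ptime_app2 (f := f)) => //.
    by do 2!apply: ptime_fst; apply: ptime_id.
  by apply: ptime_snd; apply: ptime_id.
- exact: pbound_succ.
- move=> x l1 l2 El; rewrite E catrevE cats0 esz_rev esz_seq ltnS -map_comp.
  exact: HM El.
Qed.

Lemma ptime_filter X A (eX : encodable X) (eA : encodable A)
    (l : X -> seq A) (f : X -> A -> bool) :
  ptime l -> ptime (fun z : X * A => f z.1 z.2) ->
  ptime (fun x => filter (f x) (l x)).
Proof.
move=> pl pf.
have E x s acc : foldl (fun s a => if f x a then a :: s else s) acc s
     = catrev (filter (f x) s) acc.
  by elim: s acc => //= a s IH acc; rewrite IH; case: ifP.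
apply: (@eq_ptime _ _ _ _ (fun x => rev (foldl (fun s a => if f x a then a :: s else s) [::] (l x)))).
  by move=> x; rewrite E catrevE cats0 revK.
apply: ptime_rev.
apply: (@ptime_foldl _ _ _ _ _ _ l (fun=> [::]) (fun x s a => if f x a then a :: s else s)
  (fun x => esz (l x))) => //.
- exact: ptime_const.
- apply: ptime_if; [|apply: ptime_cons|]; last 2 first.
  + by apply: ptime_snd; apply: ptime_fst; apply: ptime_id.
  + by apply: ptime_snd; apply: ptime_fst; apply: ptime_id.
  + apply: (ptime_app2 (f := f)) => //.
      by do 2!apply: ptime_fst; apply: ptime_id.
    by apply: ptime_snd; apply: ptime_id.
  + by apply: ptime_snd; apply: ptime_id.
- exact: ptime_size.
- move=> x l1 l2 ->; rewrite E catrevE cats0 esz_rev.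
  apply: leq_trans (esz_prefix _ l1 l2).
  by elim: l1 => //= a s; case: ifP; rewrite !esz_cons; lia.
Qed.

Section Lists.
Context {X A : Type} {eX : encodable X} {eA : encodable A}.
Implicit Types (l : X -> seq A) (f : X -> A -> bool).

Lemma ptime_has l f : ptime l -> ptime (fun z : X * A => f z.1 z.2) ->
  ptime (fun x => has (f x) (l x)).
Proof.
move=> pl pf; apply: eq_ptime (ptime_negb (ptime_nil (ptime_filter pl pf))) => x.
by rewrite /nilp size_filter has_count lt0n.
Qed.

Lemma ptime_all l f : ptime l -> ptime (fun z : X * A => f z.1 z.2) ->
  ptime (fun x => all (f x) (l x)).
Proof.
move=> pl pf; apply: eq_ptime (ptime_negb (ptime_has pl (ptime_negb pf))) => x.
by rewrite -all_predC; apply: eq_all => a; apply: negbK.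
Qed.

Lemma ptime_size_seq l : ptime l -> ptime (fun x => size (l x)).
Proof.
move=> pl; have E (s : seq A) n : foldl (fun n _ => n.+1) n s = n + size s.
  by elim: s n => [|a s IH] n /=; rewrite ?addn0 // IH addSnnS.
apply: (@eq_ptime _ _ _ _ (fun x => foldl (fun n _ => n.+1) 0 (l x))).
  by move=> x; rewrite E.
apply: (@ptime_foldl _ _ _ _ _ _ l (fun=> 0) (fun _ n _ => n.+1)
  (fun x => (esz (l x)).*2.+1)) => //.
- exact: ptime_const.
- by apply: ptime_succ; apply: ptime_snd; apply: ptime_fst; apply: ptime_id.
- apply: pbound_succ; apply: pbound_le (pbound_add (ptime_size pl) (ptime_size pl)) => x.
  by rewrite addnn.
- move=> x l1 l2 El; rewrite E esz_nat ltnS leq_double.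
  by apply: leq_trans (size_esz eA (l x)); rewrite El size_cat leq_addr.
Qed.

Lemma ptime_cat l l' : ptime l -> ptime l' -> ptime (fun x => l x ++ l' x).
Proof.
move=> pl pl'; have E (s acc : seq A) : foldl (fun s a => a :: s) acc s = rev s ++ acc.
  by elim: s acc => //= a s IH acc; rewrite IH rev_cons cat_rcons.
apply: (@eq_ptime _ _ _ _ (fun x => foldl (fun s a => a :: s) (l' x) (rev (l x)))).
  by move=> x; rewrite E revK.
apply: (@ptime_foldl _ _ _ _ _ _ (fun x => rev (l x)) l' (fun _ s a => a :: s)
   (fun x => esz (l x) + esz (l' x))) => //.
- exact: ptime_rev.
- apply: ptime_cons; first by apply: ptime_snd; apply: ptime_id.
  by apply: ptime_snd; apply: ptime_fst; apply: ptime_id.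
- by apply: pbound_add; apply: ptime_size.
- move=> x l1 l2 El; rewrite E -(esz_rev _ (l x)) El.
  apply: leq_trans (leqnSn _) _; rewrite esz_cat leq_add2r esz_rev.
  exact: esz_prefix.
Qed.

Lemma ptime_iter (S : Type) (eS : encodable S) (n : X -> nat) (f : X -> S -> S)
    (i : X -> S) (g : X -> nat) :
  ptime n -> ptime i -> ptime (fun z : X * S => f z.1 z.2) -> pbound g ->
  (forall x k, k <= n x -> esz (iter k (f x) (i x)) <= g x) ->
  ptime (fun x => iter (n x) (f x) (i x)).
Proof.
move=> pn pi pf bg H.
have E x k : foldl (fun s _ => f x s) (i x) (nseq k tt) = iter k (f x) (i x).
  by elim: k (i x) => //= k IH s; rewrite IH -iterSr.
apply: (@eq_ptime _ _ _ _ (fun x => foldl (fun s _ => f x s) (i x) (nseq (n x) tt))).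
  by move=> x.
apply: (@ptime_foldl _ _ _ _ _ _ (fun x => nseq (n x) tt) i (fun x s _ => f x s) g) => //.
- exact: ptime_nseq.
- apply: (ptime_app2 (f := f)) => //.
    by do 2!apply: ptime_fst; apply: ptime_id.
  by apply: ptime_snd; apply: ptime_fst; apply: ptime_id.
move=> x l1 l2 El; have sz : size l1 + size l2 = n x by rewrite -size_cat -El size_nseq.
have -> : l1 = nseq (size l1) tt by elim: (l1) => //= -[] s {1}->.
by rewrite E; apply: H; rewrite -sz leq_addr.
Qed.

Lemma ptime_nth (a0 : A) l (n : X -> nat) :
  ptime l -> ptime n -> ptime (fun x => nth a0 (l x) (n x)).
Proof.
move=> pl pn; apply: (@eq_ptime _ _ _ _ (fun x => head a0 (iter (n x) behead (l x)))).
  move=> x; elim: (n x) (l x) => [|k IH] s; first by case: s.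
  by rewrite iterSr IH; case: s => //=; rewrite nth_nil.
apply: ptime_head.
apply: (@ptime_iter _ _ n (fun _ => behead) l (fun x => esz (l x))) => //.
- by apply: ptime_behead; apply: ptime_snd; apply: ptime_id.
- exact: ptime_size.
- move=> x k _; elim: k => //= k; apply: leq_trans; case: (iter _ _ _) => //= a s.
  by rewrite esz_cons; lia.
Qed.

End Lists.

Lemma ptime_addn X (eX : encodable X) (m n : X -> nat) : ptime m -> ptime n -> ptime (fun x => m x + n x).
Proof.
move=> pm pn; apply: (@eq_ptime _ _ _ _ (fun x => iter (m x) succn (n x))).
  by move=> x; rewrite iter_succn addnC.
apply: (@ptime_iter _ _ _ _ m (fun _ => succn) n (fun x => (m x + n x).*2.+1)) => //.
- by apply: ptime_succ; apply: ptime_snd; apply: ptime_id.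
- apply: pbound_succ; apply: pbound_le
   (pbound_mul (pbound_const 2) (pbound_add (pbound_nat pm) (pbound_nat pn))) => x.
  by rewrite mul2n.
- move=> x k km; rewrite iter_succn esz_nat ltnS leq_double addnC leq_add2r; exact: km.
Qed.

Lemma ptime_muln X (eX : encodable X) (m n : X -> nat) : ptime m -> ptime n -> ptime (fun x => m x * n x).
Proof.
move=> pm pn; apply: (@eq_ptime _ _ _ _ (fun x => iter (m x) (addn (n x)) 0)).
  by move=> x; rewrite iter_addn_0 mulnC.
apply: (@ptime_iter _ _ _ _ m (fun x => addn (n x)) (fun=> 0)
  (fun x => (m x * n x).*2.+1)) => //.
- exact: ptime_const.
- apply: ptime_addn; last by apply: ptime_snd; apply: ptime_id.
  apply: (ptime_comp (f := n)) => //; by apply: ptime_fst; apply: ptime_id.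
- apply: pbound_succ; apply: pbound_le
   (pbound_mul (pbound_const 2) (pbound_mul (pbound_nat pm) (pbound_nat pn))) => x.
  by rewrite mul2n.
- by move=> x k km; rewrite iter_addn_0 esz_nat ltnS leq_double mulnC leq_mul2r km orbT.
Qed.

Lemma ptime_subn X (eX : encodable X) (m n : X -> nat) : ptime m -> ptime n -> ptime (fun x => m x - n x).
Proof.
move=> pm pn; apply: (@eq_ptime _ _ _ _ (fun x => iter (n x) predn (m x))).
  by move=> x; rewrite iter_predn.
apply: (@ptime_iter _ _ _ _ n (fun _ => predn) m (fun x => esz (m x))) => //.
- by apply: ptime_pred; apply: ptime_snd; apply: ptime_id.
- exact: ptime_size.
- by move=> x k _; rewrite iter_predn !esz_nat; lia.
Qed.

Lemma ptime_leq X (eX : encodable X) (m n : X -> nat) : ptime m -> ptime n -> ptime (fun x => m x <= n x).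
Proof.
move=> pm pn; apply: (@eq_ptime _ _ _ _ (fun x => nilp (nseq (m x - n x) tt))).
  by move=> x; rewrite /nilp size_nseq.
by apply: ptime_nil; apply: ptime_nseq; apply: ptime_subn.
Qed.

Lemma ptime_eqn X (eX : encodable X) (m n : X -> nat) : ptime m -> ptime n -> ptime (fun x => m x == n x).
Proof.
move=> pm pn; apply: eq_ptime (ptime_andb (ptime_leq pm pn) (ptime_leq pn pm)) => x.
by rewrite eqn_leq.
Qed.

Lemma ptime_minn X (eX : encodable X) (m n : X -> nat) : ptime m -> ptime n -> ptime (fun x => minn (m x) (n x)).
Proof.
by move=> pm pn; apply: (ptime_if (ptime_leq (ptime_succ pm) pn) pm pn).
Qed.

Lemma ptime_mem_seq X (eX : encodable X) (n : X -> nat) (l : X -> seq nat) :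
  ptime n -> ptime l -> ptime (fun x => n x \in l x).
Proof.
move=> pn pl; apply: (@eq_ptime _ _ _ _ (fun x => has (fun a => a == n x) (l x))).
  by move=> x; rewrite -has_pred1; apply: eq_has.
apply: ptime_has => //; apply: ptime_eqn; first by apply: ptime_snd; apply: ptime_id.
by apply: (ptime_comp (f := n)) => //; apply: ptime_fst; apply: ptime_id.
Qed.

Lemma esz_le_all A (eA : encodable A) c (s : seq A) :
  all (fun a => esz a <= c) s -> esz s <= (size s * c.+1).+1.
Proof.
by elim: s => //= a s IH /andP[ac /IH le]; rewrite esz_cons mulSn ltnS; lia.
Qed.

Lemma ptime_iota0 X (eX : encodable X) (n : X -> nat) : ptime n -> ptime (fun x => iota 0 (n x)).
Proof.
move=> pn; have E k : iter k (fun s : seq nat => size s :: s) [::] = rev (iota 0 k).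
  by elim: k => // k IH; rewrite iterS IH size_rev size_iota -addn1 iotaD rev_cat.
apply: (@eq_ptime _ _ _ _ (fun x => rev (iter (n x) (fun s : seq nat => size s :: s) [::]))).
  by move=> x; rewrite E revK.
apply: ptime_rev.
apply: (@ptime_iter _ _ _ _ n (fun _ s => size s :: s) (fun=> [::])
  (fun x => (n x * (n x + n x + 1).+1).+1)) => //.
- exact: ptime_const.
- apply: ptime_cons; last by apply: ptime_snd; apply: ptime_id.
  by apply: ptime_size_seq; apply: ptime_snd; apply: ptime_id.
- have bn := pbound_nat pn.
  apply: pbound_succ; apply: pbound_mul => //; apply: pbound_succ.
  by do ?apply: pbound_add => //; apply: pbound_const.
move=> x k kn; rewrite E.
apply: leq_trans (@esz_le_all _ _ (n x + n x + 1) _ _) _.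
  by apply/allP => a; rewrite mem_rev mem_iota esz_nat; lia.
by rewrite ltnS size_rev size_iota leq_mul2r kn orbT.
Qed.

Lemma ptime_flatten X A (eX : encodable X) (eA : encodable A) (l : X -> seq (seq A)) :
  ptime l -> ptime (fun x => flatten (l x)).
Proof.
move=> pl; have E (s : seq (seq A)) acc : foldl cat acc s = acc ++ flatten s.
  by elim: s acc => [|a s IH] acc /=; rewrite ?cats0 // IH catA.
apply: (@eq_ptime _ _ _ _ (fun x => foldl cat [::] (l x))).
  by move=> x; rewrite E.
apply: (@ptime_foldl _ _ _ _ _ _ l (fun=> [::]) (fun _ => cat) (fun x => esz (l x))) => //.
- exact: ptime_const.
- apply: ptime_cat; last by apply: ptime_snd; apply: ptime_id.
  by apply: ptime_snd; apply: ptime_fst; apply: ptime_id.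
- exact: ptime_size.
move=> x l1 l2 ->; rewrite E /=; apply: leq_trans (esz_prefix _ l1 l2).
elim: l1 => //= a s IH; rewrite esz_cons -ltnS esz_cat.
by apply: leq_trans (leq_add (leqnn _) IH) _; rewrite !leqW.
Qed.

Lemma ptime_fst0 A B (eA : encodable A) (eB : encodable B) : ptime (@fst A B).
Proof. exact: (ptime_fst (@ptime_id _ _)). Qed.

Lemma ptime_snd0 A B (eA : encodable A) (eB : encodable B) : ptime (@snd A B).
Proof. exact: (ptime_snd (@ptime_id _ _)). Qed.

Ltac ptime_step := cbv beta; match goal with
  | H : ptime ?f |- ptime ?f => exact: H
  | H : ptime ?f |- ptime (fun x => ?f _) => apply: (ptime_comp (f := f)); first exact: H
  | |- ptime size => exact: (ptime_size_seq (@ptime_id _ _))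
  | |- ptime fst => exact: ptime_fst0
  | |- ptime snd => exact: ptime_snd0
  | |- ptime (fun x => x) => exact: ptime_id
  | |- ptime (fun x => ?c) => exact: ptime_const
  | |- ptime (fun x => _.1) => apply: ptime_fst
  | |- ptime (fun x => _.2) => apply: ptime_snd
  | |- ptime (fun x => (_, _)) => apply: ptime_pair
  | |- ptime (fun x => if _ then _ else _) => apply: ptime_if
  | |- ptime (fun x => _ :: _) => apply: ptime_cons
  | |- ptime (fun x => _ && _) => apply: ptime_andb
  | |- ptime (fun x => _ || _) => apply: ptime_orb
  | |- ptime (fun x => ~~ _) => apply: ptime_negb
  | |- ptime (fun x => _ (+) _) => apply: ptime_addb
  | |- ptime (fun x => nilp _) => apply: ptime_nil
  | |- ptime (fun x => head _ _) => apply: ptime_head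
  | |- ptime (fun x => behead _) => apply: ptime_behead
  | |- ptime (fun x => nth _ _ _) => apply: ptime_nth
  | |- ptime (fun x => size _) => apply: ptime_size_seq
  | |- ptime (fun x => map _ _) => apply: ptime_map
  | |- ptime (fun x => filter _ _) => apply: ptime_filter
  | |- ptime (fun x => has _ _) => apply: ptime_has
  | |- ptime (fun x => all _ _) => apply: ptime_all
  | |- ptime (fun x => flatten _) => apply: ptime_flatten
  | |- ptime (fun x => _ ++ _) => apply: ptime_cat
  | |- ptime (fun x => rev _) => apply: ptime_rev
  | |- ptime (fun x => iota 0 _) => apply: ptime_iota0
  | |- ptime (fun x => _.+1) => apply: ptime_succ
  | |- ptime (fun x => _.-1) => apply: ptime_pred
  | |- ptime (fun x => _ + _) => apply: ptime_addn
  | |- ptime (fun x => _ * _) => apply: ptime_muln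
  | |- ptime (fun x => _ <= _) => apply: ptime_leq
  | |- ptime (fun x => minn _ _) => apply: ptime_minn
  | |- ptime (fun x => _ == _) => first [apply: ptime_eqn | apply: ptime_eqb]
  | |- ptime (fun x => _ \in _) => apply: ptime_mem_seq
  end.
Ltac ptime_auto := repeat ptime_step.

(** * The algorithm *)

Notation bmat := (seq (seq bool)).

Definition greedy A (ok : seq A -> A -> bool) (l : seq A) :=
  foldl (fun acc a => if ok acc a then a :: acc else acc) [::] l.

Definition bentry (m : bmat) i j := nth false (nth [::] m i) j.

Definition mk_bmat n (f : rel nat) : bmat :=
  [seq [seq f i j | j <- iota 0 n] | i <- iota 0 n].

Definition grid n p := flatten [seq [seq (i, j) | j <- iota 0 n] | i <- iota 0 p].

Definition petals (m : bmat) x y :=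
  greedy (fun acc p => petal (bentry m) x y p && all (apart p) acc)
    (grid (size m) (size m)).

Definition heavy_pairs (m : bmat) k :=
  [seq p <- grid (size m) (size m) | (p.1 != p.2) && (k < size (petals m p.1 p.2))].

Definition flip_bmat (m : bmat) x y :=
  mk_bmat (size m) (fun i j =>
    bentry m i j (+) ((i == x) && (j == y) || (i == y) && (j == x))).

(* The boolean becomes false when an edit is forced but none is left. *)
Definition sunflower_step (st : bmat * (nat * bool)) :=
  if nilp (heavy_pairs st.1 st.2.1) then st
  else if st.2.1 == 0 then (st.1, (0, false))
  else (flip_bmat st.1 (head (0, 0) (heavy_pairs st.1 st.2.1)).1
          (head (0, 0) (heavy_pairs st.1 st.2.1)).2, (st.2.1.-1, st.2.2)).

(** Each flip spends a unit of the budget, so there are at most k flips; the extra step detects a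
    pair that is still heavy at budget 0. *)
Definition sunflower_loop (m : bmat) k :=
  iter k.+1 sunflower_step (m, (k, true)).

(** A vertex that distinguishes two members belongs to every module containing them. The operator is
    monotone, so iterating it from the empty list as often as there are vertices reaches its least
    fixed point, the module generated by p. *)
Definition hull_step (m : bmat) (p : nat * nat) (s : seq nat) :=
  [seq z <- iota 0 (size m) | [|| z == p.1, z == p.2
     | has (fun a => has (fun b => bentry m z a != bentry m z b) s) s]].

Definition hull (m : bmat) p := iter (size m) (hull_step m p) [::].

Definition both_in (s : seq nat) (p : nat * nat) := (p.1 \in s) && (p.2 \in s).

Definition arcs (m : bmat) :=
  [seq p <- grid (size m) (size m) | bentry m p.1 p.2].

Definition cuts (m : bmat) :=
  [seq p <- arcs m | has (fun q => ~~ both_in (hull m p) q) (arcs m)].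

Definition inside_bmat (m : bmat) s :=
  mk_bmat (size m) (fun i j => both_in s (i, j) && bentry m i j).

Definition outside_bmat (m : bmat) s :=
  mk_bmat (size m) (fun i j => ~~ both_in s (i, j) && bentry m i j).

Definition split_bmat (m : bmat) :=
  if nilp (cuts m) then [:: m]
  else [:: inside_bmat m (hull m (head (0, 0) (cuts m)));
           outside_bmat m (hull m (head (0, 0) (cuts m)))].

Definition split_round (ps : seq bmat) := flatten [seq split_bmat m | m <- ps].

Definition has_p4 (m : bmat) :=
  has (fun a => has (fun b => has (fun c => has (fun d => p4 (bentry m) a b c d)
    (iota 0 (size m))) (iota 0 (size m))) (iota 0 (size m))) (iota 0 (size m)).

(** A split distributes the arcs over two parts, each receiving at least one, so a piece can be
    split further at most as often as it has arcs; hence the number of rounds. *)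
Definition pieces (m : bmat) :=
  [seq p <- iter (size m * size m) split_round [:: m] | has_p4 p].

Definition union_entry (ps : seq bmat) (a b : nat * nat) :=
  (a.1 == b.1) && bentry (nth [::] ps a.1) a.2 b.2.

Definition union_twin (ps : seq bmat) V (a b : nat * nat) :=
  all (fun z => union_entry ps a z == union_entry ps b z) V.

(** The threshold leaves up to 2k+1 vertices of each class, one more than the 2k ordered pairs of a
    solution can touch. *)
Definition kept (n : nat) (ps : seq bmat) (k : nat) :=
  greedy (fun acc a => size [seq b <- acc | union_twin ps (grid n (size ps)) b a] <= k + k)
    (grid n (size ps)).

Definition union_bmat (ps : seq bmat) (l : seq (nat * nat)) : bmat :=
  [seq [seq union_entry ps a b | b <- l] | a <- l].

Definition incr_bits (l : seq bool) :=
  (foldl (fun (p : seq bool * seq bool) b =>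
     (b :: p.1, if b then false :: p.2 else true :: p.1)) ([::], [:: true]) (rev l)).2.

Definition bits_of (k : nat) : seq bool := iter k incr_bits [::].

(* The budget comes in binary, so its unary value may be exponential; beyond the
   square of the number of vertices it is irrelevant. *)
Definition capped_value c (l : seq bool) : nat :=
  foldl (fun acc b => minn c ((if b then 1 else 0) + (acc + acc))) 0 (rev l).

Definition p4_bmat : bmat :=
  mk_bmat 4 (fun i j => (i.+1 == j) || (j.+1 == i)).

(** A fixed negative instance: a P4 with budget 0, which has no binary digits. *)
Definition no_instance : bmat * seq bool := (p4_bmat, [::]).

(** A positive instance keeps at most 96 k^3 vertices by [size_kept], so exceeding this number
    certifies a negative one. *)
Definition reduce (m : bmat) (ps : seq bmat) (k : nat) : bmat * seq bool :=
  if size (kept (size m) ps k) <= 96 * (k * (k * k)) then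
    (union_bmat ps (kept (size m) ps k), bits_of k)
  else no_instance.

Definition after_sunflowers (st : bmat * (nat * bool)) : bmat * seq bool :=
  if st.2.2 then reduce st.1 (pieces st.1) st.2.1 else no_instance.

Definition kernel_of (m : bmat) k : bmat * seq bool :=
  if size m * size m <= k then ([::], [::])
  else after_sunflowers (sunflower_loop m k).

Definition kernel_alg (x : bmat * seq bool) : bmat * seq bool :=
  kernel_of x.1 (capped_value (size x.1 * size x.1) x.2).

(** * Running time of the algorithm *)

Lemma ptime_greedy X A (eX : encodable X) (eA : encodable A) (l : X -> seq A)
    (ok : X -> seq A -> A -> bool) :
  ptime l -> ptime (fun z : X * seq A * A => ok z.1.1 z.1.2 z.2) ->
  ptime (fun x => greedy (ok x) (l x)).
Proof.
move=> pl pok.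
apply: (@ptime_foldl _ _ _ _ _ _ l (fun=> [::])
  (fun x acc a => if ok x acc a then a :: acc else acc) (fun x => (esz (l x)).+1)) => //.
- by ptime_auto.
- by ptime_auto.
- by apply: pbound_succ; apply: ptime_size.
move=> x l1 l2 ->; apply: leq_trans (_ : (esz l1).+1 <= _); last by rewrite ltnS esz_prefix.
have H s acc : esz (foldl (fun acc a => if ok x acc a then a :: acc else acc) acc s)
    <= esz acc + esz s.
  elim: s acc => [|a s IH] acc /=; first by rewrite leq_addr.
  apply: leq_trans (IH _) _; rewrite esz_cons.
  by case: ifP => _; rewrite ?esz_cons; lia.
exact: H.
Qed.

Lemma pbound_size_seq X A (eX : encodable X) (eA : encodable A) (l : X -> seq A) :
  ptime l -> pbound (fun x => size (l x)).
Proof. by move/ptime_size; apply: pbound_le => x; apply: size_esz. Qed.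

Lemma esz_mk_bmat n f : esz (mk_bmat n f) <= (n * (n * 4).+2).+1.
Proof.
apply: leq_trans (@esz_le_all _ _ (n * 4).+1 _ _) _; last by rewrite size_map size_iota.
apply/allP => _ /mapP[i _ ->].
apply: leq_trans (@esz_le_all _ _ 3 _ _) _; last by rewrite size_map size_iota.
by apply/allP => b _; apply: esz_bool.
Qed.

Lemma esz_filter A (eA : encodable A) (p : pred A) s : esz (filter p s) <= esz s.
Proof. by elim: s => //= a s; case: ifP; rewrite !esz_cons; lia. Qed.

Lemma size_mk_bmat n f : size (mk_bmat n f) = n.
Proof. by rewrite size_map size_iota. Qed.

Section AlgTime.
Context {X : Type} {eX : encodable X}.
Implicit Types (m : X -> bmat) (ps : X -> seq bmat).

Lemma ptime_bentry m i j : ptime m -> ptime i -> ptime j ->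
  ptime (fun x => bentry (m x) (i x) (j x)).
Proof. by move=> *; rewrite /bentry; ptime_auto. Qed.

Lemma ptime_mk_bmat (n : X -> nat) (f : X -> rel nat) : ptime n ->
  ptime (fun z : X * nat * nat => f z.1.1 z.1.2 z.2) ->
  ptime (fun x => mk_bmat (n x) (f x)).
Proof.
move=> pn pf; rewrite /mk_bmat; apply: ptime_map; first by ptime_auto.
by apply: ptime_map => //; ptime_auto.
Qed.

Lemma ptime_grid (n p : X -> nat) : ptime n -> ptime p ->
  ptime (fun x => grid (n x) (p x)).
Proof. by move=> pn pp; rewrite /grid; ptime_auto. Qed.

End AlgTime.

Ltac ptime_alg := repeat first [ptime_step |
  match goal with
  | |- ptime (fun x => bentry _ _ _) => apply: ptime_bentry
  | |- ptime (fun x => grid _ _) => apply: ptime_grid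
  | |- ptime (fun x => mk_bmat _ _) => apply: ptime_mk_bmat
  | |- ptime (fun x => greedy _ _) => apply: ptime_greedy
  | |- ptime (fun x => p4 _ _ _ _ _) => rewrite /p4
  | |- ptime (fun x => petal _ _ _ _) => rewrite /petal
  | |- ptime (fun x => apart _ _) => rewrite /apart
  | |- ptime (fun x => both_in _ _) => rewrite /both_in
  end].

Lemma ptime_petals : ptime (fun z : bmat * (nat * nat) => petals z.1 z.2.1 z.2.2).
Proof. by rewrite /petals; ptime_alg. Qed.

Lemma ptime_heavy_pairs : ptime (fun z : bmat * nat => heavy_pairs z.1 z.2).
Proof.
rewrite /heavy_pairs; ptime_alg.
by apply: (ptime_comp (f := fun z : bmat * (nat * nat) => petals z.1 z.2.1 z.2.2)
  (g := fun z : bmat * nat * (nat * nat) => (z.1.1, z.2)) ptime_petals); ptime_alg.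
Qed.

Lemma ptime_flip_bmat : ptime (fun z : bmat * (nat * nat) => flip_bmat z.1 z.2.1 z.2.2).
Proof. by rewrite /flip_bmat; ptime_alg. Qed.

Lemma ptime_sunflower_step : ptime sunflower_step.
Proof.
have ph : ptime (fun st : bmat * (nat * bool) => heavy_pairs st.1 st.2.1).
  by apply: (ptime_comp (f := fun z : bmat * nat => heavy_pairs z.1 z.2)
    (g := fun st : bmat * (nat * bool) => (st.1, st.2.1)) ptime_heavy_pairs); ptime_alg.
rewrite /sunflower_step; ptime_alg.
by apply: (ptime_comp (f := fun z : bmat * (nat * nat) => flip_bmat z.1 z.2.1 z.2.2)
  (g := fun st : bmat * (nat * bool) => (st.1, head (0, 0) (heavy_pairs st.1 st.2.1)))
  ptime_flip_bmat); ptime_alg.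
Qed.

Lemma sunflower_iter m k t : let st := iter t sunflower_step (m, (k, true)) in
  [/\ size st.1 = size m, st.2.1 <= k &
      esz st.1 <= esz m + (size m * (size m * 4).+2).+1].
Proof.
elim: t => [|t]; first by split=> //; rewrite leq_addr.
rewrite iterS; move: (iter _ _ _) => [m' [k' b]] /= [E le sz].
rewrite /sunflower_step /=; case: ifP => // _; case: eqP => _ /=; first by split.
rewrite /flip_bmat size_mk_bmat E; split=> //; first by lia.
by apply: leq_trans (esz_mk_bmat _ _) _; rewrite leq_addl.
Qed.

Lemma ptime_sunflower_loop : ptime (fun z : bmat * nat => sunflower_loop z.1 z.2).
Proof.
rewrite /sunflower_loop.
apply: (@ptime_iter _ _ _ _ (fun z : bmat * nat => z.2.+1) (fun _ => sunflower_step)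
  (fun z => (z.1, (z.2, true)))
  (fun z => esz z.1 + (size z.1 * (size z.1 * 4).+2).+1 + (z.2 + z.2 + 7))) => //; try by ptime_alg.
- by apply: (ptime_comp (f := sunflower_step) ptime_sunflower_step); ptime_alg.
- have pm : ptime (fun z : bmat * nat => z.1) by ptime_alg.
  have bs := pbound_size_seq pm; have bk : pbound (fun z : bmat * nat => z.2).
    by apply: pbound_nat; ptime_alg.
  apply: pbound_add; last by do ?apply: pbound_add => //; apply: pbound_const.
  apply: pbound_add; first exact: ptime_size.
  apply: pbound_succ; apply: pbound_mul => //; do 2!apply: pbound_succ.
  by apply: pbound_mul => //; apply: pbound_const.
move=> [m k] t _ /=; have [_] := sunflower_iter m k t.
case: (iter _ _ _) => m' [k' b] /= lek lem.
rewrite !esz_pair esz_nat; have := esz_bool b; lia.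
Qed.

Lemma hull_iter m p t : esz (iter t (hull_step m p) [::]) <= esz (iota 0 (size m)).
Proof. by case: t => [|t]; [exact: (@esz_gt0 _ _ (iota 0 (size m))) | rewrite iterS; apply: esz_filter]. Qed.

Lemma ptime_hull : ptime (fun z : bmat * (nat * nat) => hull z.1 z.2).
Proof.
rewrite /hull.
apply: (@ptime_iter _ _ _ _ (fun z : bmat * (nat * nat) => size z.1)
  (fun z => hull_step z.1 z.2) (fun=> [::]) (fun z => esz (iota 0 (size z.1)))) => //.
- by ptime_alg.
- by ptime_alg.
- by rewrite /hull_step; ptime_alg.
- by apply: ptime_size; ptime_alg.
- by move=> [m p] t _ /=; apply: hull_iter.
Qed.

Lemma ptime_arcs : ptime arcs.
Proof. by rewrite /arcs; ptime_alg. Qed.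

Lemma ptime_cuts : ptime cuts.
Proof.
have pa := ptime_arcs.
have ph : ptime (fun z : bmat * (nat * nat) * (nat * nat) => hull z.1.1 z.1.2).
  by apply: (ptime_comp (f := fun z : bmat * (nat * nat) => hull z.1 z.2)
    (g := fun z : bmat * (nat * nat) * (nat * nat) => z.1) ptime_hull); ptime_alg.
by rewrite /cuts; ptime_alg.
Qed.

Lemma ptime_split_bmat : ptime split_bmat.
Proof.
have pc := ptime_cuts; have ph := ptime_hull.
have pS : ptime (fun m => hull m (head (0, 0) (cuts m))).
  by apply: (ptime_comp (f := fun z : bmat * (nat * nat) => hull z.1 z.2)
    (g := fun m => (m, head (0, 0) (cuts m))) ph); ptime_alg.
have pS' : ptime (fun z : bmat * nat * nat => hull z.1.1 (head (0, 0) (cuts z.1.1))).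
  by apply: (ptime_comp (g := fun z : bmat * nat * nat => z.1.1) pS); ptime_alg.
by rewrite /split_bmat /inside_bmat /outside_bmat; ptime_alg.
Qed.

Lemma ptime_has_p4 : ptime has_p4.
Proof. by rewrite /has_p4; ptime_alg. Qed.

Lemma mem_grid n p (a : nat * nat) : (a \in grid n p) = (a.1 < p) && (a.2 < n).
Proof.
apply/flattenP/andP => [[_ /mapP[i + ->] /mapP[j + ->]]|[i j]].
  by rewrite !mem_iota.
exists [seq (a.1, k) | k <- iota 0 n]; first by apply: map_f; rewrite mem_iota.
by apply/mapP; exists a.2; rewrite ?mem_iota //; case: (a).
Qed.

Lemma size_grid n p : size (grid n p) = p * n.
Proof.
by rewrite -[LHS]/(size [seq (i, j) | i <- iota 0 p, j <- iota 0 n]) size_allpairs !size_iota.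
Qed.

Lemma bentry_mk n f i j : i < n -> j < n -> bentry (mk_bmat n f) i j = f i j.
Proof.
move=> lin ljn; rewrite /bentry /mk_bmat (nth_map 0) ?size_iota // (nth_map 0) ?size_iota //.
by rewrite !nth_iota.
Qed.

Lemma arcs_mk n f : arcs (mk_bmat n f) = [seq p <- grid n n | f p.1 p.2].
Proof.
rewrite /arcs size_mk_bmat; apply: eq_in_filter => p; rewrite mem_grid => /andP[? ?].
exact: bentry_mk.
Qed.

Lemma arcs_split m s :
  size (arcs (inside_bmat m s)) + size (arcs (outside_bmat m s)) = size (arcs m).
Proof.
rewrite /inside_bmat /outside_bmat !arcs_mk /arcs !size_filter.
elim: (grid _ _) => //= -[i j] l; rewrite /=.
by case: (both_in _ _); case: (bentry _ _ _) => /=; lia.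
Qed.

Lemma hull_mem m p : 0 < size m -> p.1 < size m -> p.2 < size m ->
  (p.1 \in hull m p) && (p.2 \in hull m p).
Proof.
rewrite /hull; case E : (size m) => [//|n] _ p1 p2.
by rewrite iterS !mem_filter !mem_iota !eqxx orbT E p1 p2.
Qed.

Lemma cuts_head m : ~~ nilp (cuts m) -> head (0, 0) (cuts m) \in cuts m.
Proof. by case: (cuts m) => //= p l _; rewrite mem_head. Qed.

Lemma cuts_arcs m p : p \in cuts m ->
  0 < size (arcs (inside_bmat m (hull m p))) /\
  0 < size (arcs (outside_bmat m (hull m p))).
Proof.
rewrite mem_filter => /andP[/hasP[q qm qout]]; move: qm.
rewrite !mem_filter !mem_grid => /andP[qm /andP[q1 q2]] /andP[pm /andP[p1 p2]].
rewrite /inside_bmat /outside_bmat !arcs_mk !size_filter -!has_count.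
have n0 : 0 < size m by apply: leq_trans p1.
split; apply/hasP.
- exists p; rewrite ?mem_grid ?p1 ?p2 //= pm andbT /both_in /=.
  exact: hull_mem.
- by exists q; rewrite ?mem_grid ?q1 ?q2 //= qm andbT; case: (q) qout.
Qed.

Lemma arcs_round_sum ps :
  sumn [seq size (arcs p) | p <- split_round ps] = sumn [seq size (arcs p) | p <- ps].
Proof.
rewrite /split_round; elim: ps => //= m ps IH; rewrite map_cat sumn_cat IH; congr (_ + _).
by rewrite /split_bmat; case: ifP => _ /=; rewrite ?addn0 // arcs_split.
Qed.

Lemma split_roundP (P : bmat -> Prop) ps :
  (forall m, List.In m ps -> P m) ->
  (forall m p, P m -> p \in cuts m -> P (inside_bmat m (hull m p))) ->
  (forall m p, P m -> p \in cuts m -> P (outside_bmat m (hull m p))) ->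
  forall m, List.In m (split_round ps) -> P m.
Proof.
move=> Pps Pin Pout; rewrite /split_round.
elim: ps Pps => //= m ps IH Pps m' /List.in_app_iff [|]; last first.
  by apply: IH => x xp; apply: Pps; right.
have Pm : P m by apply: Pps; left.
rewrite /split_bmat; case: ifP => [_ [<-|//]|/negbT/cuts_head hc] //=.
by case=> [<-|[<-|//]]; [apply: Pin | apply: Pout].
Qed.

Definition rounds m t := iter t split_round [:: m].

Lemma rounds_ind (P : bmat -> Prop) m t : P m ->
  (forall m p, P m -> p \in cuts m -> P (inside_bmat m (hull m p))) ->
  (forall m p, P m -> p \in cuts m -> P (outside_bmat m (hull m p))) ->
  forall m', List.In m' (rounds m t) -> P m'.
Proof.
move=> Pm Pin Pout; elim: t => [|t IH] m'; first by case=> // <-.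
by rewrite /rounds iterS; apply: split_roundP.
Qed.

(** A round may double the number of pieces, so polynomial time needs an argument: pieces partition
    the arcs of [m] and none is without arcs, except for an arcless [m], which is never split. *)
Lemma size_rounds m t : size (rounds m t) <= (size m * size m).+1.
Proof.
have [arc0|arc1] := posnP (size (arcs m)).
  suff -> : rounds m t = [:: m] by [].
  elim: t => // t IH; rewrite /rounds iterS -/(rounds m t) IH /split_round /=.
  by rewrite cats0 /split_bmat /cuts; case: (arcs m) arc0.
have szr : sumn [seq size (arcs p) | p <- rounds m t] = size (arcs m).
  elim: t => [|t IH]; first by rewrite /= addn0.
  by rewrite /rounds iterS arcs_round_sum.
have pos m' : List.In m' (rounds m t) -> 0 < size (arcs m').
  apply: (rounds_ind (P := fun m' => 0 < size (arcs m'))) => // m1 p _ pc; by have [] := cuts_arcs pc.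
apply: leqW; apply: leq_trans (_ : size (arcs m) <= _).
  rewrite -szr; elim: (rounds m t) pos => //= a s IH pos.
  rewrite -add1n; apply: leq_add; first by apply: pos; left.
  by apply: IH => x xs; apply: pos; right.
rewrite size_filter; apply: leq_trans (count_size _ _) _.
by rewrite size_grid.
Qed.

Lemma esz_le_In A (eA : encodable A) c (s : seq A) :
  (forall a, List.In a s -> esz a <= c) -> esz s <= (size s * c.+1).+1.
Proof.
move=> H; apply: esz_le_all; elim: s H => //= a s IH H.
by rewrite H ?IH //; [move=> x xs; apply: H; right | left].
Qed.

Definition bmat_bound (m : bmat) := esz m + (size m * (size m * 4).+2).+1.

Lemma ptime_pieces : ptime pieces.
Proof.
have ps := ptime_split_bmat; have pp := ptime_has_p4.
rewrite /pieces; apply: ptime_filter; last by ptime_alg.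
have pm : ptime (fun m : bmat => m) by ptime_alg.
have bs := pbound_size_seq pm.
apply: (@ptime_iter _ _ _ _ (fun m : bmat => size m * size m) (fun _ => split_round)
  (fun m => [:: m]) (fun m => ((size m * size m).+1 * (bmat_bound m).+1).+1)) => //.
- by ptime_alg.
- by ptime_alg.
- by rewrite /split_round; ptime_alg.
- apply: pbound_succ; apply: pbound_mul; first by apply: pbound_succ; apply: pbound_mul.
  apply: pbound_succ; rewrite /bmat_bound; apply: pbound_add; first exact: pbound_size.
  apply: pbound_succ; apply: pbound_mul => //; do 2!apply: pbound_succ.
  by apply: pbound_mul => //; apply: pbound_const.
move=> m t _; rewrite -[iter _ _ _]/(rounds m t); apply: leq_trans (esz_le_In (c := bmat_bound m) _) _.
  have key f : esz (mk_bmat (size m) f) <= bmat_bound m.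
    by apply: leq_trans (esz_mk_bmat _ _) _; rewrite /bmat_bound leq_addl.
  pose P (m' : bmat) := size m' = size m /\ is_true (@esz _ (encodable_seq (encodable_seq encodable_bool)) m' <= bmat_bound m).
  move=> m' Hm'; have [] : P m' => //; move: m' Hm'; apply: (rounds_ind (P := P)).
  - by split=> //; rewrite /bmat_bound leq_addr.
  - by move=> m1 p [E _] _; rewrite /P /inside_bmat size_mk_bmat E.
  - by move=> m1 p [E _] _; rewrite /P /outside_bmat size_mk_bmat E.
by rewrite ltnS leq_mul2r size_rounds orbT.
Qed.

Lemma ptime_union_entry X (eX : encodable X) (ps : X -> seq bmat) (a b : X -> nat * nat) :
  ptime ps -> ptime a -> ptime b -> ptime (fun x => union_entry (ps x) (a x) (b x)).
Proof. by move=> pp pa pb; rewrite /union_entry; ptime_alg. Qed.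

Lemma ptime_kept :
  ptime (fun z : nat * seq bmat * nat => kept z.1.1 z.1.2 z.2).
Proof.
rewrite /kept /union_twin; ptime_alg; apply: ptime_union_entry; ptime_alg.
Qed.

Lemma ptime_union_bmat :
  ptime (fun z : seq bmat * seq (nat * nat) => union_bmat z.1 z.2).
Proof. by rewrite /union_bmat; ptime_alg; apply: ptime_union_entry; ptime_alg. Qed.

Lemma esz_bits (l : seq bool) : esz l <= (size l * 4).+1.
Proof. by apply: esz_le_all; apply/allP => b _; apply: esz_bool. Qed.

Lemma incr_bits_foldl (l : seq bool) p :
  size p.2 <= (size p.1).+1 ->
  let q := foldl (fun (p : seq bool * seq bool) b =>
     (b :: p.1, if b then false :: p.2 else true :: p.1)) p l in
  size q.1 = size p.1 + size l /\ size q.2 <= (size q.1).+1.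
Proof.
elim: l p => [|b l IH] p le /=; first by rewrite addn0.
have [|E le'] := IH (b :: p.1, if b then false :: p.2 else true :: p.1).
  by case: (b); rewrite /= ltnS.
by split=> //; rewrite E /= addSnnS.
Qed.

Lemma size_incr_bits l : size (incr_bits l) <= (size l).+1.
Proof.
have [|E le] := @incr_bits_foldl (rev l) ([::], [:: true]); first by [].
by apply: leq_trans le _; rewrite E size_rev.
Qed.

Lemma ptime_incr_bits : ptime incr_bits.
Proof.
rewrite /incr_bits; apply: ptime_snd.
apply: (@ptime_foldl _ _ _ _ _ _ (fun l : seq bool => rev l) (fun=> ([::], [:: true]))
  (fun _ (p : seq bool * seq bool) b => (b :: p.1, if b then false :: p.2 else true :: p.1))
  (fun l => ((size l * 4).+1 + ((size l).+1 * 4).+1).+1)); try by ptime_alg.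
- have bs : pbound (fun l : seq bool => size l) by apply: (pbound_size_seq (l := fun l => l)); ptime_alg.
  apply: pbound_succ; apply: pbound_add; apply: pbound_succ; apply: pbound_mul;
    by do ?[exact: pbound_const | apply: pbound_succ].
move=> l l1 l2 El; have szl : size l1 <= size l by rewrite -(size_rev l) El size_cat leq_addr.
have /= := @incr_bits_foldl l1 ([::], [:: true]) isT.
case: (foldl _ _ _) => p1 p2 /= [E le]; rewrite esz_pair.
have := esz_bits p1; have := esz_bits p2; lia.
Qed.

Lemma ptime_bits_of : ptime bits_of.
Proof.
rewrite /bits_of.
apply: (@ptime_iter _ _ _ _ (fun k : nat => k) (fun _ => incr_bits) (fun=> [::])
  (fun k => (k * 4).+1)); try by ptime_alg.
- by have pi := ptime_incr_bits; ptime_alg.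
- apply: pbound_succ; apply: pbound_mul; last exact: pbound_const.
  by apply: pbound_nat; ptime_alg.
move=> k t tk; apply: leq_trans (esz_bits _) _; rewrite ltnS leq_mul2r /=.
apply: leq_trans tk; elim: t => [|t IH]; first by [].
by apply: leq_trans (size_incr_bits _) _; rewrite ltnS.
Qed.

Lemma ptime_capped_value : ptime (fun z : nat * seq bool => capped_value z.1 z.2).
Proof.
rewrite /capped_value.
apply: (@ptime_foldl _ _ _ _ _ _ (fun z : nat * seq bool => rev z.2) (fun=> 0)
  (fun z acc b => minn z.1 ((if b then 1 else 0) + (acc + acc))) (fun z => z.1 + z.1 + 1));
  try by ptime_alg.
- by have b1 : pbound (fun z : nat * seq bool => z.1);
    [apply: pbound_nat; ptime_alg | do ?apply: pbound_add => //; exact: pbound_const].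
move=> [c l] l1 l2 _ /=; rewrite esz_nat.
suff : foldl (fun acc (b : bool) => minn c ((if b then 1 else 0) + (acc + acc))) 0 l1 <= c by lia.
by elim/last_ind: l1 => // l1 b _; rewrite foldl_rcons geq_minl.
Qed.

Lemma ptime_reduce : ptime (fun z : bmat * seq bmat * nat => reduce z.1.1 z.1.2 z.2).
Proof.
have pk : ptime (fun z : bmat * seq bmat * nat => kept (size z.1.1) z.1.2 z.2).
  by apply: (ptime_comp (f := fun z : nat * seq bmat * nat => kept z.1.1 z.1.2 z.2)
    (g := fun z : bmat * seq bmat * nat => (size z.1.1, z.1.2, z.2)) ptime_kept); ptime_alg.
have pu : ptime (fun z : bmat * seq bmat * nat =>
    union_bmat z.1.2 (kept (size z.1.1) z.1.2 z.2)).
  by apply: (ptime_comp (f := fun z : seq bmat * seq (nat * nat) => union_bmat z.1 z.2)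
    (g := fun z : bmat * seq bmat * nat => (z.1.2, kept (size z.1.1) z.1.2 z.2)) ptime_union_bmat);
    ptime_alg.
have pb := ptime_bits_of; rewrite /reduce; apply: ptime_if.
- by apply: ptime_leq; [apply: ptime_size_seq | ptime_alg].
- by apply: ptime_pair => //; ptime_alg.
- by ptime_alg.
Qed.

Lemma ptime_after_sunflowers : ptime after_sunflowers.
Proof.
have pp := ptime_pieces; rewrite /after_sunflowers; apply: ptime_if; [by ptime_alg| |by ptime_alg].
by apply: (ptime_comp (f := fun z : bmat * seq bmat * nat => reduce z.1.1 z.1.2 z.2)
  (g := fun st : bmat * (nat * bool) => (st.1, pieces st.1, st.2.1)) ptime_reduce); ptime_alg.
Qed.

Lemma ptime_kernel_alg : ptime kernel_alg.
Proof.
have pk : ptime (fun z : bmat * nat => kernel_of z.1 z.2).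
  rewrite /kernel_of; apply: ptime_if; [by ptime_alg|by ptime_alg|].
  by apply: (ptime_comp (g := fun z : bmat * nat => sunflower_loop z.1 z.2)
    ptime_after_sunflowers ptime_sunflower_loop).
apply: (ptime_comp (f := fun z : bmat * nat => kernel_of z.1 z.2)
  (g := fun x : bmat * seq bool => (x.1, capped_value (size x.1 * size x.1) x.2)) pk).
apply: ptime_pair; first by ptime_alg.
by apply: (ptime_comp (f := fun z : nat * seq bool => capped_value z.1 z.2)
  (g := fun x : bmat * seq bool => (size x.1 * size x.1, x.2)) ptime_capped_value); ptime_alg.
Qed.

(** * Correctness of the algorithm *)

Section EdgeSets.

Variable T : finType.
Implicit Types (E F : {set {set T}}) (x y : T).

Lemma adj_sgraph E : edge_set E -> sgraph (adj E).
Proof.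
move=> /forall_inP Ee; split=> [x y|x]; rewrite /adj; first by rewrite setUC.
by apply/negP => /Ee; rewrite setUid cards1.
Qed.

Lemma dist_adj E F : edge_set F -> dist (adj E) (adj (symdiff E F)) = #|F|.*2.
Proof.
move=> Fe.
have -> : dist (adj E) (adj (symdiff E F)) = \sum_x \sum_y (adj F x y : nat).
  apply: eq_bigr => x _; apply: eq_bigr => y _; rewrite /adj /symdiff !inE.
  by case: (_ \in E); case: (_ \in F).
have -> : \sum_x \sum_y (adj F x y : nat) =
    \sum_(s in F) \sum_x \sum_y ([set x; y] == s : nat).
  rewrite [RHS]exchange_big; apply: eq_bigr => x _ /=; rewrite [RHS]exchange_big.
  apply: eq_bigr => y _ /=; rewrite /adj; case: (boolP ([set x; y] \in F)) => xyF.
    rewrite (bigD1 [set x; y]) //= eqxx big1 // => s /andP[_].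
    by rewrite eq_sym => /negPf->.
  by rewrite big1 // => s sF; case: eqP => // E'; move: xyF; rewrite E' sF.
rewrite -muln2 -sum_nat_const; apply: eq_bigr => s sF.
have /cards2P[a [b [ab Es]]] := forall_inP Fe s sF.
rewrite pair_bigA /= -big_mkcond /= sum1dep_card.
have -> : [set p : T * T | [set p.1; p.2] == s] = [set (a, b); (b, a)].
  apply/setP=> -[x y]; rewrite !inE /= !xpair_eqE Es.
  apply/eqP/orP => [E'|[]/andP[/eqP-> /eqP->]//]; last by rewrite setUC.
  have: x \in [set a; b] by rewrite -E' !inE eqxx.
  have: y \in [set a; b] by rewrite -E' !inE eqxx orbT.
  have: a \in [set x; y] by rewrite E' !inE eqxx.
  have: b \in [set x; y] by rewrite E' !inE eqxx orbT.
  rewrite !inE ![a == _]eq_sym ![b == _]eq_sym.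
  by case: (x == a); case: (y == b); case: (x == b); case: (y == a); auto.
by rewrite cards2 xpair_eqE negb_and ab.
Qed.

Lemma cographE E : edge_set E -> cograph E <-> p4free (adj E).
Proof.
move=> /adj_sgraph sg; split=> H a b c d; have := H a b c d; apply: contra => P.
  by rewrite /induced_P4 (p4_uniq sg P).
by case/andP: P.
Qed.

End EdgeSets.

Lemma symdiff_edge_set (T : finType) (E F : {set {set T}}) :
  edge_set E -> edge_set F -> edge_set (symdiff E F).
Proof.
move=> /forall_inP He /forall_inP Hf; apply/forall_inP => e.
by rewrite !inE => /orP[]/andP[_]; [apply: He | apply: Hf].
Qed.

Definition rel_edges (T : finType) (e : rel T) : {set {set T}} :=
  [set [set p.1; p.2] | p in [set p : T * T | (p.1 != p.2) && e p.1 p.2]].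

Lemma rel_edgesP (T : finType) (e : rel T) : edge_set (rel_edges e).
Proof.
apply/forall_inP => s /imsetP[p]; rewrite inE => /andP[np _] ->.
by rewrite cards2 np.
Qed.

Lemma adj_rel_edges (T : finType) (e : rel T) : sgraph e -> adj (rel_edges e) =2 e.
Proof.
move=> [es ei] x y; apply/imsetP/idP => [[[a b]]|exy]; last first.
  exists (x, y); rewrite // inE exy andbT /=.
  by apply: contraTneq exy => ->; rewrite ei.
rewrite inE /= => /andP[ab eab] E.
have bxy: b \in [set x; y] by rewrite E !inE eqxx orbT.
have axy: a \in [set x; y] by rewrite E !inE eqxx.
have: y \in [set a; b] by rewrite -E !inE eqxx orbT.
have: x \in [set a; b] by rewrite -E !inE eqxx.
move: axy bxy; rewrite !inE => A B /orP[]/eqP Ex /orP[]/eqP Ey.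
all: move: A B; rewrite Ex Ey ?orbb //.
- by rewrite (eq_sym b) (negPf ab).
- by rewrite es.
- by rewrite (negPf ab).
Qed.

Lemma edge_editionE (G : graph) k :
  cograph_edge_edition G k <-> editable (adj (edges G)) k.*2.
Proof.
have Ge := edgesP G; split=> [[F [Fe Fk co]]|[h [sgh p4h hk]]].
  exists (adj (symdiff (edges G) F)); rewrite dist_adj // leq_double; split=> //.
    by apply: adj_sgraph; apply: symdiff_edge_set.
  by apply/cographE => //; apply: symdiff_edge_set.
pose f : rel _ := fun x y => adj (edges G) x y (+) h x y.
have [ges gei] := adj_sgraph Ge; have [hs hi] := sgh.
have sgf : sgraph f by split=> [x y|x]; rewrite /f ?gei ?hi // ges hs.
have Eh : adj (symdiff (edges G) (rel_edges f)) =2 h.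
  move=> x y; have := adj_rel_edges sgf x y; rewrite /f /adj /symdiff !inE => ->.
  by case: (_ \in _); case: (h x y).
exists (rel_edges f); have fe := rel_edgesP f; split=> //.
  rewrite -leq_double -(dist_adj (edges G)) //; apply: leq_trans hk.
  by rewrite distC (eq_dist _ Eh) distC.
by apply/cographE; [apply: symdiff_edge_set | apply: eq_p4free p4h => x y; rewrite Eh].
Qed.

Definition brel n (m : bmat) : rel 'I_n := fun i j => bentry m i j.

Lemma brel_mk n (f : rel nat) : @brel n (mk_bmat n f) =2 fun i j => f i j.
Proof. by move=> i j; rewrite /brel bentry_mk. Qed.

(** * Greedy selections *)

Section Greedy.

Variables (A : eqType) (ok : seq A -> A -> bool).

Lemma greedy_rcons l a : greedy ok (rcons l a) =
  if ok (greedy ok l) a then a :: greedy ok l else greedy ok l.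
Proof. by rewrite /greedy foldl_rcons. Qed.

Lemma greedy_sub l : {subset greedy ok l <= l}.
Proof.
elim/last_ind: l => // l a IH x; rewrite greedy_rcons mem_rcons !inE.
case: ifP => _; last by move/IH->; rewrite orbT.
by rewrite inE => /orP[->//|/IH->]; rewrite orbT.
Qed.

Lemma greedy_uniq l : uniq l -> uniq (greedy ok l).
Proof.
elim/last_ind: l => // l a IH; rewrite rcons_uniq greedy_rcons => /andP[al /IH ul].
by case: ifP => //= _; rewrite ul andbT; apply: contra al; apply: greedy_sub.
Qed.

Lemma greedy_ind (P : seq A -> Prop) l : P [::] ->
  (forall acc a, P acc -> ok acc a -> P (a :: acc)) -> P (greedy ok l).
Proof.
move=> P0 PS; elim/last_ind: l => // l a IH; rewrite greedy_rcons.
by case: ifP => // oka; apply: PS.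
Qed.

Lemma greedy_max l a : a \in l -> a \notin greedy ok l ->
  exists s acc, greedy ok l = s ++ acc /\ ~~ ok acc a.
Proof.
elim/last_ind: l => // l b IH; rewrite greedy_rcons mem_rcons inE.
have [->|ab] /= := eqVneq a b.
  case: ifP => [_ _|okb _ _]; first by rewrite mem_head.
  by exists [::], (greedy ok l); rewrite okb.
move=> /IH{}IH; case: ifP => okb ag; last exact: IH.
have [|s [acc [E na]]] := IH; last by exists (b :: s), acc; rewrite E.
by apply: contra ag => ag; rewrite inE ag orbT.
Qed.

End Greedy.

Section Petals.

Variables (n : nat) (m : bmat).
Hypothesis szm : size m = n.

Lemma petals_sunflower (x y : 'I_n) : exists l : seq ('I_n * 'I_n),
  [/\ sunflower (brel m) x y l, size l = size (petals m x y)
    & map (fun p => (val p.1, val p.2)) l = petals m x y].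
Proof.
pose l := map (fun p => (insubd x p.1, insubd x p.2)) (petals m x y).
have El : map (fun p : 'I_n * 'I_n => (val p.1, val p.2)) l = petals m x y.
  rewrite /l -map_comp -[RHS]map_id; apply/eq_in_map => p /greedy_sub.
  by rewrite mem_grid szm => /andP[p1 p2]; rewrite /= !val_insubd p1 p2; case: (p).
exists l; split=> //; last by rewrite size_map.
have : pairwise (@apart nat) (petals m x y) /\ all (petal (bentry m) x y) (petals m x y).
  apply: (greedy_ind (P := fun s => pairwise (@apart nat) s /\
    all (petal (bentry m) x y) s)) => // acc p [pw al] /andP[pp ap] /=.
  by rewrite pw ap pp al.
rewrite -El pairwise_map all_map => -[pw al]; apply/andP; split; last exact: al.
exact: pw.
Qed.

Lemma sunflower_bound (x y : 'I_n) l : sunflower (brel m) x y l ->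
  size l <= (size (petals m x y)).*2.
Proof.
have [l0 [_ sz0 El0]] := petals_sunflower x y; rewrite -sz0.
apply: sunflower_maximal => p pp.
pose vp := (val p.1, val p.2).
have vpg : vp \in grid (size m) (size m) by rewrite mem_grid szm /= !ltn_ord.
have apart_irr q : ~~ @apart nat q q by rewrite /apart eqxx.
have [q ql qa] : exists2 q, q \in petals m x y & ~~ apart vp q.
  have [vin|vout] := boolP (vp \in petals m x y); first by exists vp.
  have [s [acc [E]]] := greedy_max vpg vout.
  have -> : petal (bentry m) x y vp by [].
  move=> /allPn[q qacc qa]; exists q => //.
  by rewrite /petals E mem_cat qacc orbT.
move: ql; rewrite -El0 => /mapP[q' q'l Eq]; exists q' => //.
by move: qa; rewrite Eq.
Qed.

End Petals.

Lemma brel_flip n m (x y : 'I_n) : size m = n ->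
  brel (flip_bmat m x y) =2 flip (brel m) x y.
Proof. by move=> szm i j; rewrite /brel /flip_bmat bentry_mk ?szm. Qed.

Definition loop_ok n (m : bmat) k (st : bmat * (nat * bool)) :=
  if st.2.2 then
    [/\ size st.1 = n, sgraph (@brel n st.1), st.2.1 <= k,
        heavy_pairs st.1 st.2.1 = [::] &
        editable (@brel n m) k.*2 <-> editable (@brel n st.1) st.2.1.*2]
  else ~ editable (@brel n m) k.*2.

Lemma heavy_pairP n m k p : size m = n -> p \in heavy_pairs m k ->
  exists (x y : 'I_n) l, [/\ p = (val x, val y), x != y,
    sunflower (brel m) x y l & k < size l].
Proof.
move=> szm; rewrite mem_filter mem_grid szm => /andP[/andP[p12 kp] /andP[p1 p2]].
have [l [sl szl _]] := petals_sunflower szm (Ordinal p1) (Ordinal p2).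
by exists (Ordinal p1), (Ordinal p2), l; split; rewrite ?szl //=; apply: surjective_pairing.
Qed.

Lemma heavy_head n m k : size m = n -> ~~ nilp (heavy_pairs m k) ->
  exists (x y : 'I_n) l, [/\ head (0, 0) (heavy_pairs m k) = (val x, val y), x != y,
    sunflower (brel m) x y l & k < size l].
Proof.
move=> szm nn; apply: heavy_pairP => //.
by case: (heavy_pairs m k) nn => //= a s _; rewrite mem_head.
Qed.

(** The first step is peeled off. Either no pair is heavy and all later steps are idle, or a forced
    pair is flipped and the induction hypothesis applies with one unit less; at budget 0 a forced
    edit refutes the instance. *)
Lemma sunflower_loopP n m k : size m = n -> sgraph (@brel n m) ->
  loop_ok n m k (sunflower_loop m k).
Proof.
rewrite /sunflower_loop; elim: k m => [|k IH] m szm sgm.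
  rewrite /= /sunflower_step /=; case: ifP => [/nilP h0|/negbT/(heavy_head szm) hn] /=.
    by rewrite /loop_ok.
  have [x [y [l [_ xy sf kl]]]] := hn.
  by rewrite /loop_ok /= => /(editable_flip sgm xy sf kl)[].
have fix_st st j : sunflower_step st = st -> iter j sunflower_step st = st.
  by move=> Est; elim: j => //= j ->.
rewrite iterSr; have [h0|hn] := boolP (nilp (heavy_pairs m k.+1)).
  have E0 : sunflower_step (m, (k.+1, true)) = (m, (k.+1, true)).
    by rewrite /sunflower_step /= h0.
  by rewrite E0 fix_st //; split=> //; apply/nilP.
have [x [y [l [Ep xy sf kl]]]] := heavy_head szm hn.
have -> : sunflower_step (m, (k.+1, true)) = (flip_bmat m x y, (k, true)).
  by rewrite /sunflower_step /= (negPf hn) Ep.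
have Ef := brel_flip x y szm.
have sgf : sgraph (@brel n (flip_bmat m x y)).
  by apply: eq_sgraph (sgraph_flip xy sgm) => i j; rewrite Ef.
have := IH (flip_bmat m x y) _ sgf; rewrite size_mk_bmat => /(_ szm).
have E : editable (@brel n m) k.+1.*2 <-> editable (@brel n (flip_bmat m x y)) k.*2.
  have [H1 H2] := editable_flip sgm xy sf kl; split=> [H|H].
    by have [_ H'] := H1 H; apply: eq_editable H' => i j; rewrite Ef.
  apply: H2; split=> //.
  by apply: eq_editable H => i j; rewrite Ef.
rewrite /loop_ok; case: ifP => _; last by move=> nE /E.
by case=> sz sg le h0 E'; split=> //; [apply: leqW | apply: iff_trans E E'].
Qed.

(** * Splitting creates no P4 *)

Section InduceP4.

Variables (T : finType) (e : rel T) (M : {set T}).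
Hypotheses (sge : sgraph e) (Mm : module e M).

Lemma p4_inside a b c d : p4 (inside e M) a b c d -> p4 e a b c d.
Proof.
rewrite /p4 /inside => /and5P[/and3P[aM bM ->] /and3P[_ cM ->] /and3P[_ dM ->]].
by rewrite aM bM cM dM => -> /andP[-> ->].
Qed.

(** Without its inner edges M is still a module, and independent. Two non-adjacent vertices of a P4
    are distinguished by a third one, which would lie in M next to a member; so the P4 meets M at
    most once and none of its pairs has changed. *)
Lemma p4_outside a b c d : p4 (outside e M) a b c d -> p4 e a b c d.
Proof.
have [os _] := sgraph_outside M sge; have om := module_outside Mm.
set o := outside e M in os om * => P; have /and5P[ab bc cd ac /andP[bd ad]] := P.
have ind x y : x \in M -> y \in M -> o x y = false.
  by move=> xM yM; rewrite /o /outside xM yM.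
have sep x y z : x \in M -> y \in M -> o x z -> ~~ o y z -> z \in M.
  by move=> xM yM xz; apply: contraNT => zM; rewrite -(om x y z).
have nab : ~~ ((a \in M) && (b \in M)).
  by apply/negP => /andP[aM bM]; rewrite ind in ab.
have nbc : ~~ ((b \in M) && (c \in M)).
  by apply/negP => /andP[bM cM]; rewrite ind in bc.
have ncd : ~~ ((c \in M) && (d \in M)).
  by apply/negP => /andP[cM dM]; rewrite ind in cd.
have nac : ~~ ((a \in M) && (c \in M)).
  apply: contra ncd => /andP[aM cM]; rewrite cM /=; exact: (sep c a).
have nbd : ~~ ((b \in M) && (d \in M)).
  apply: contra nab => /andP[bM dM]; rewrite bM andbT.
  by apply: (sep b d) => //; rewrite os.
have nad : ~~ ((a \in M) && (d \in M)).
  apply: contra nab => /andP[aM dM]; rewrite aM /=.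
  by apply: (sep a d) => //; rewrite os.
by move: P; rewrite /p4 /o /outside nab nbc ncd nac nbd nad.
Qed.

End InduceP4.

Lemma petal_sub (T : Type) (e f : rel T) x y p :
  (forall a b c d, p4 e a b c d -> p4 f a b c d) -> petal e x y p -> petal f x y p.
Proof. by move=> H; rewrite /petal => /orP[]/H->; rewrite ?orbT. Qed.

(** * Generated modules *)

Section Hull.

Variables (n : nat) (m : bmat) (p : nat * nat).
Hypotheses (szm : size m = n) (sgm : sgraph (@brel n m)).

Local Notation e := (@brel n m).

Definition splitters (X : {set 'I_n}) : {set 'I_n} :=
  [set z | [|| val z == p.1, val z == p.2
    | [exists a in X, exists b in X, e z a != e z b]]].

Lemma splitters_mono : {homo splitters : X Y / X \subset Y}.
Proof.
move=> X Y /subsetP XY; apply/subsetP => z; rewrite !inE.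
case/or3P=> [->//|->|/exists_inP[a aX /exists_inP[b bX ab]]]; rewrite ?orbT //.
apply/orP; right; apply/orP; right.
by apply/exists_inP; exists a; [apply: XY | apply/exists_inP; exists b; [apply: XY |]].
Qed.

Lemma hull_iterE t (z : 'I_n) :
  (val z \in iter t (hull_step m p) [::]) = (z \in iter t splitters set0).
Proof.
elim: t z => [|t IH] z; first by rewrite inE.
rewrite !iterS mem_filter mem_iota szm add0n ltn_ord leq0n !andbT inE.
congr (_ || (_ || _)); apply/hasP/exists_inP => [[a aS /hasP[b bS ab]]|[a aS /exists_inP[b bS ab]]].
  have lt s : s \in iter t (hull_step m p) [::] -> s < n.
    by case: (t) => // t'; rewrite iterS mem_filter mem_iota szm => /andP[_].
  exists (Ordinal (lt a aS)); first by rewrite -IH.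
  by apply/exists_inP; exists (Ordinal (lt b bS)); rewrite -?IH.
exists (val a); first by rewrite IH.
by apply/hasP; exists (val b); rewrite ?IH.
Qed.

Definition hull_set : {set 'I_n} := [set z | val z \in hull m p].

Lemma hull_setE : hull_set = fixset splitters.
Proof.
by apply/setP => z; rewrite inE /hull hull_iterE szm /fixset card_ord.
Qed.

Lemma module_hull : module e hull_set.
Proof.
move=> x y z; rewrite hull_setE => xM yM; rewrite -{1}(fixsetK splitters_mono) inE.
rewrite !negb_or => /and3P[_ _ /exists_inPn/(_ x xM)/exists_inPn/(_ y yM)].
by rewrite negbK (proj1 sgm x) (proj1 sgm y) => /eqP.
Qed.

Lemma hull_min (N : {set 'I_n}) : module e N ->
  (forall z : 'I_n, (val z == p.1) || (val z == p.2) -> z \in N) -> hull_set \subset N.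
Proof.
move=> Nm Np; rewrite hull_setE /fixset.
elim: #|_| => [|t IH]; first exact: sub0set.
rewrite iterS; apply/subsetP => z; rewrite inE orbA => /orP[/Np//|].
case/exists_inP=> a /(subsetP IH) aN /exists_inP[b /(subsetP IH) bN].
by apply: contraNT => zN; rewrite (proj1 sgm z a) (proj1 sgm z b) (Nm a b).
Qed.

Lemma brel_inside : @brel n (inside_bmat m (hull m p)) =2 inside e hull_set.
Proof. by move=> i j; rewrite /brel bentry_mk ?szm // /inside !inE /both_in andbA. Qed.

Lemma brel_outside : @brel n (outside_bmat m (hull m p)) =2 outside e hull_set.
Proof. by move=> i j; rewrite /brel bentry_mk ?szm // /outside !inE. Qed.

End Hull.

Lemma cuts_lt n m p : size m = n -> p \in cuts m -> p.1 < n /\ p.2 < n.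
Proof.
by move=> szm; rewrite !mem_filter mem_grid szm => /and3P[_ _ /andP[? ?]].
Qed.

Lemma hull_set_mem n m p (x : 'I_n) : size m = n -> p \in cuts m ->
  val x = p.1 -> x \in hull_set n m p.
Proof.
move=> szm /(cuts_lt szm)[p1 p2] xp; rewrite inE xp; clear x xp.
rewrite -szm in p1 p2; have n0 : 0 < size m by apply: leq_trans p1.
by have /andP[] := hull_mem n0 p1 p2.
Qed.

Lemma In_split_round ps m' : List.In m' (split_round ps) ->
  exists2 m, List.In m ps & nilp (cuts m) /\ m' = m \/
    exists2 p, p \in cuts m & m' = inside_bmat m (hull m p) \/ m' = outside_bmat m (hull m p).
Proof.
rewrite /split_round; elim: ps => //= m ps IH /List.in_app_iff[|/IH[m1 ? ?]]; last first.
  by exists m1; [right|].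
rewrite /split_bmat; case: ifP => [h0 [<-|//]|/negbT/cuts_head hc].
  by exists m; [left | left].
move=> Hm'; exists m; first by left.
by right; exists (head (0, 0) (cuts m)) => //; case: Hm' => [<-|[<-|//]]; [left|right].
Qed.

(** * Decomposition into irreducible pieces *)

Section Rounds.

Variables (n : nat) (m0 : bmat).
Hypotheses (sz0 : size m0 = n) (sg0 : sgraph (@brel n m0)).

(** By the last clause a sunflower of a piece is one of [m0], which is known to have small ones
    only. *)
Definition piece (m : bmat) := [/\ size m = n, sgraph (@brel n m) &
  forall a b c d, p4 (@brel n m) a b c d -> p4 (@brel n m0) a b c d].

Lemma rounds_piece t m : List.In m (rounds m0 t) -> piece m.
Proof.
apply: (rounds_ind (P := piece)) => // {}m p [sz sg sub] pc.
  have E := brel_inside p sz; split; first by rewrite size_mk_bmat.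
    by apply: eq_sgraph (sgraph_inside _ sg) => i j; rewrite E.
  move=> a b c d; rewrite /p4 !E => P; apply: sub; exact: p4_inside P.
have E := brel_outside p sz; split; first by rewrite size_mk_bmat.
  by apply: eq_sgraph (sgraph_outside _ sg) => i j; rewrite E.
move=> a b c d; rewrite /p4 !E => P; apply: sub.
exact: (p4_outside sg (module_hull (p := p) sz sg) P).
Qed.

Lemma editable_rounds t k :
  editable_seq [seq @brel n m | m <- rounds m0 t] k <-> editable (@brel n m0) k.
Proof.
elim: t k => [|t IH] k; first exact: editable_seq1.
rewrite -IH /rounds iterS -/(rounds m0 t) /split_round map_flatten -map_comp.
have -> : [seq @brel n m | m <- rounds m0 t] =
    flatten [seq [:: @brel n m] | m <- rounds m0 t].
  by elim: (rounds m0 t) => //= m s ->.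
apply: editable_seq_flatten => m {}k /rounds_piece[sz sg _] /=.
rewrite /split_bmat; case: ifP => [//|/negbT/cuts_head hc] /=.
have [p1 _] := cuts_lt sz hc; have Mm := module_hull (p := head (0, 0) (cuts m)) sz sg.
have mem := @hull_set_mem n m _ (Ordinal p1) sz hc erefl.
have Ei := brel_inside (head (0, 0) (cuts m)) sz.
have Eo := brel_outside (head (0, 0) (cuts m)) sz.
split=> [[a [b [le ea [c [d [le2 eb _]]]]]]|[a [b [le ea _]]]].
  exists k, 0; split; rewrite ?addn0 //; apply/(editable_split k sg Mm mem).
  exists a, c; split; first by lia.
    by apply: eq_editable ea => i j; rewrite Ei.
  by apply: eq_editable eb => i j; rewrite Eo.
have {}ea : editable (@brel n m) k by apply: leq_editable ea; lia.
have [H _] := editable_split k sg Mm mem.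
have [c [d [le2 ec ed]]] := H ea.
exists c, d; split=> //; first by apply: eq_editable ec => i j; rewrite Ei.
by exists d, 0; split; rewrite ?addn0 //; apply: eq_editable ed => i j; rewrite Eo.
Qed.

Lemma size_arcs m : size m = n -> size (arcs m) <= n * n.
Proof.
move=> sz; rewrite size_filter; apply: leq_trans (count_size _ _) _.
by rewrite size_grid sz.
Qed.

(** A piece is either stable, and then stays so, or has lost at least one arc in every round so far;
    after n^2 rounds no arc would be left to cut. *)
Lemma rounds_stable m : List.In m (rounds m0 (n * n)) -> cuts m = [::].
Proof.
have H t m' : List.In m' (rounds m0 t) -> cuts m' = [::] \/ size (arcs m') + t <= n * n.
  elim: t m' => [|t IH] m'; first by case=> // <-; right; rewrite addn0 size_arcs.
  rewrite /rounds iterS => /In_split_round[m1 /IH Hm1 [[/nilP c0 ->]|[p pc E]]].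
    by left.
  case: Hm1 => [c0|le]; first by rewrite c0 in pc.
  right; have [a1 a2] := cuts_arcs pc; have := arcs_split m1 (hull m1 p).
  by case: E => ->; lia.
case/H=> // le; suff : size (arcs m) = 0 by move/size0nil => E; rewrite /cuts E.
by lia.
Qed.

(** N contains the module generated by u and v, and that module contains all edges since uv is not a
    cut. *)
Lemma stable_module m (N : {set 'I_n}) (u v : 'I_n) : size m = n ->
  sgraph (@brel n m) -> cuts m = [::] -> module (@brel n m) N ->
  u \in N -> v \in N -> @brel n m u v -> forall x y, @brel n m x y -> x \in N.
Proof.
move=> sz sg c0 Nm uN vN uv x y xy.
have uva : (val u, val v) \in arcs m by rewrite mem_filter mem_grid sz /= !ltn_ord !andbT.
have xya : (val x, val y) \in arcs m by rewrite mem_filter mem_grid sz /= !ltn_ord !andbT.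
have : (val u, val v) \notin cuts m by rewrite c0.
rewrite mem_filter uva andbT => /hasPn/(_ _ xya); rewrite negbK => /andP[xh _].
have := hull_min (p := (val u, val v)) sz sg Nm.
move=> /(_ _)/subsetP sub; apply: sub; last by rewrite inE.
by move=> z /= /orP[]/eqP/val_inj->.
Qed.

Lemma has_p4P m : size m = n -> has_p4 m = false -> p4free (@brel n m).
Proof.
move=> sz h a b c d; apply/negP => P; move/negP: h; apply.
have mem (x : 'I_n) : val x \in iota 0 (size m) by rewrite mem_iota sz ltn_ord.
apply/hasP; exists (val a); first exact: mem.
apply/hasP; exists (val b); first exact: mem.
apply/hasP; exists (val c); first exact: mem.
by apply/hasP; exists (val d); first exact: mem.
Qed.

Lemma has_p4N m : size m = n -> has_p4 m -> ~ p4free (@brel n m).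
Proof.
move=> sz /hasP[a ain /hasP[b bin /hasP[c cin /hasP[d din P]]]] H.
move: ain bin cin din; rewrite !mem_iota !add0n sz => an bn cn dn.
by apply: (negP (H (Ordinal an) (Ordinal bn) (Ordinal cn) (Ordinal dn))); exact: P.
Qed.

Lemma editable_pieces k :
  editable_seq [seq @brel n m | m <- pieces m0] k <-> editable (@brel n m0) k.
Proof.
apply: iff_trans (editable_rounds (n * n) k).
rewrite /pieces sz0 -/(rounds m0 (n * n)).
have := @rounds_piece (n * n); elim: (rounds m0 (n * n)) k => //= m ps IH k Hp.
have {}IH j := IH j (fun m' H => Hp m' (or_intror H)).
case: ifP => [_ /=|h].
  by split=> -[a [b [le ea /IH eb]]]; exists a, b.
split=> [/IH H|[a [b [le _ /IH]]]]; last by apply: leq_editable_seq; lia.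
exists 0, k; split=> //; have [sz sg _] := Hp m (or_introl erefl).
exists (@brel n m); split=> //; first exact: has_p4P.
by rewrite /dist big1 // => x _; rewrite big1 // => y _; rewrite eqxx.
Qed.

End Rounds.

(** The size bound argues against a closest P4-free graph; excluded middle on the next smaller
    budget finds one. *)
Lemma editable_min (T : finType) (e : rel T) c : editable e c ->
  exists h, [/\ sgraph h, p4free h, dist e h <= c &
    forall g, sgraph g -> p4free g -> dist e h <= dist e g].
Proof.
elim: c => [|c IH] ed.
  by have [h [sg p4h d0]] := ed; exists h; split=> // g _ _; apply: leq_trans d0 _.
have [/IH[h [sg p4h dc hm]]|nc] := classic (editable e c).
  by exists h; split=> //; apply: leqW.
have [h [sg p4h dc]] := ed; exists h; split=> // g sgg p4g.
apply: leq_trans dc _; rewrite ltnNge; apply/negP => gc.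
by apply: nc; exists g.
Qed.

Lemma mem_In (A : eqType) (x : A) s : x \in s -> List.In x s.
Proof. by elim: s => //= a s IH; rewrite inE => /orP[/eqP->|/IH]; [left|right]. Qed.

Lemma card_bigcup_leq (I T : finType) (F : I -> {set T}) :
  #|\bigcup_i F i| <= \sum_i #|F i|.
Proof.
elim/big_rec2: _ => [|i n S _ le]; first by rewrite cards0.
by rewrite cardsU; apply: leq_trans (leq_subr _ _) _; rewrite leq_add2l.
Qed.

Lemma card_nbh_dunion (I T : finType) (es : I -> rel T) :
  #|nbh (dunion es) @: setT| <= \sum_i #|nbh (es i) @: setT|.
Proof.
apply: leq_trans (_ : _ <= \sum_i #|(fun S : {set T} => [set (i, y) | y in S])
   @: (nbh (es i) @: setT)|) _; last first.
  by apply: leq_sum => i _; apply: leq_imset_card.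
apply: leq_trans (card_bigcup_leq _); apply: subset_leq_card.
apply/subsetP => S /imsetP[[i x] _ ->]; apply/bigcupP; exists i => //.
apply/imsetP; exists (nbh (es i) x); first exact: imset_f.
apply/setP => -[j y]; rewrite inE /dunion /=; apply/andP/imsetP.
  by case=> /eqP<- xy; exists y; rewrite ?inE.
by case=> z; rewrite inE => xz [-> ->]; rewrite eqxx.
Qed.

(** * The union of the pieces and its kept vertices *)

Section Union.

Variables (n : nat) (m0 : bmat) (k : nat).
Hypotheses (sz0 : size m0 = n) (sg0 : sgraph (@brel n m0)).
Hypothesis light : heavy_pairs m0 k = [::].

Local Notation ps := (pieces m0).
Local Notation t := (size ps).

Definition pieces_rel (i : 'I_t) : rel 'I_n := @brel n (nth [::] ps i).
Definition pieces_union : rel ('I_t * 'I_n) := dunion pieces_rel.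

Local Notation D := pieces_union.

Lemma pieces_nth i : i < t -> [/\ piece n m0 (nth [::] ps i),
  cuts (nth [::] ps i) = [::] & ~ p4free (@brel n (nth [::] ps i))].
Proof.
move=> /(mem_nth [::]); move: (nth _ _ _) => m.
rewrite mem_filter sz0 => /andP[h /mem_In min].
have pm := rounds_piece sz0 sg0 min; have [sz _ _] := pm; split=> //.
  exact: (rounds_stable sz0 min).
exact: has_p4N h.
Qed.

Lemma sgraph_pieces_union : sgraph D.
Proof. by apply: sgraph_dunion => i; have [[]] := pieces_nth (ltn_ord i). Qed.

Lemma editable_pieces_union c : editable D c <-> editable (@brel n m0) c.
Proof.
apply: iff_trans (editable_pieces sz0 sg0 c).
apply: iff_trans (editable_dunion _ _) _.
apply: iff_trans; last exact: iff_sym (editable_seq_nth _ _).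
rewrite size_map; split=> -[f fc Hf].
  exists (fun i => if insub i is Some j then f j else 0).
    by apply: leq_trans fc; apply: leq_sum => i _; rewrite valK.
  move=> i it; rewrite (nth_map [::]) // (insubT (fun i => i < t) it).
  exact: Hf (Sub i it).
exists (fun i : 'I_t => f i) => // i; have := Hf i (ltn_ord i).
by rewrite (nth_map [::]).
Qed.

(** In [m0] the greedy sunflower of a pair has at most k petals, and an arbitrary one at most twice
    as many. *)
Lemma sunflower_pieces (i : 'I_t) (x y : 'I_n) l : x != y ->
  sunflower (pieces_rel i) x y l -> size l <= k.*2.
Proof.
move=> xy /andP[pw /allP al]; have [[sz _ sub] _ _] := pieces_nth (ltn_ord i).
have sf : sunflower (@brel n m0) x y l.
  by rewrite /sunflower pw; apply/allP => p /al; apply: petal_sub.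
apply: leq_trans (sunflower_bound sz0 sf) _; rewrite leq_double leqNgt.
apply/negP => big; have : (val x, val y) \in heavy_pairs m0 k.
  by rewrite mem_filter mem_grid sz0 /= !ltn_ord xy big.
by rewrite light.
Qed.

(** Each piece has an optimal solution of its own, to which [card_nbhs] applies with sunflowers of
    at most 2k petals. That bound is linear in the distance, so summing it over the pieces involves
    only the total budget. *)
Lemma card_classes c : editable D c -> #|nbh D @: setT| <= c * k.*2.*2.+4.*2.
Proof.
move=> /editable_dunion[f fc Hf]; apply: leq_trans (card_nbh_dunion _) _.
apply: leq_trans (_ : (\sum_i f i) * k.*2.*2.+4.*2 <= _); last by rewrite leq_mul2r fc orbT.
rewrite big_distrl /=; apply: leq_sum => i _.
have [[sz sg _] st np] := pieces_nth (ltn_ord i).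
have [h [sgh p4h hf hm]] := editable_min (Hf i).
apply: leq_trans (_ : dist (pieces_rel i) h * k.*2.*2.+4.*2 <= _); last first.
  by rewrite leq_mul2r hf orbT.
apply: card_nbhs => //.
  by move=> M u v Mm uM vM uv; apply: (stable_module sz sg st Mm uM vM uv).
by move=> x y l; apply: sunflower_pieces.
Qed.

Definition vals (q : 'I_t * 'I_n) : nat * nat := (val q.1, val q.2).

Lemma vals_inj : injective vals.
Proof. by move=> [i x] [j y] [/val_inj-> /val_inj->]. Qed.

Lemma union_entryE q r : union_entry ps (vals q) (vals r) = D q r.
Proof. by []. Qed.

Lemma mem_grid_vals q : vals q \in grid n t.
Proof. by rewrite mem_grid !ltn_ord. Qed.

Lemma grid_vals a : a \in grid n t -> exists q, vals q = a.
Proof.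
rewrite mem_grid => /andP[a1 a2]; exists (Ordinal a1, Ordinal a2).
by rewrite /vals /=; case: (a).
Qed.

Lemma union_twinE q r : union_twin ps (grid n t) (vals q) (vals r) = twin D q r.
Proof.
apply/allP/twinP => [H z|H a /grid_vals[z <-]].
  by apply/eqP; rewrite -!union_entryE; apply: H; apply: mem_grid_vals.
by rewrite !union_entryE H.
Qed.

Local Notation l := (kept n ps k).

Definition kept_set : {set 'I_t * 'I_n} := [set q | vals q \in l].

Lemma kept_grid a : a \in l -> a \in grid n t.
Proof. exact: greedy_sub. Qed.

Lemma uniq_grid : uniq (grid n t).
Proof.
rewrite -[grid n t]/([seq (i, j) | i <- iota 0 t, j <- iota 0 n]).
by apply: allpairs_uniq; rewrite ?iota_uniq // => -[i j] [i' j'] _ _ [-> ->].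
Qed.

Lemma kept_uniq : uniq l.
Proof. by apply: greedy_uniq; apply: uniq_grid. Qed.

Lemma vals_sub_card (s : seq (nat * nat)) (S : {set 'I_t * 'I_n}) : uniq s ->
  (forall a, a \in s -> exists2 q, q \in S & vals q = a) -> size s <= #|S|.
Proof.
move=> us sub; rewrite cardE -(size_map vals); apply: uniq_leq_size => // a /sub[q qS <-].
by apply: map_f; rewrite mem_enum.
Qed.

Lemma kept_twins v : v \notin kept_set -> k.*2 < #|[set u in kept_set | twin D u v]|.
Proof.
rewrite inE => vl; have [s [acc [E]]] := greedy_max (mem_grid_vals v) vl.
rewrite -ltnNge addnn => lt; apply: leq_trans lt _.
have ul := kept_uniq; rewrite /kept E cat_uniq in ul; case/and3P: ul => _ _ ua.
apply: vals_sub_card; first exact: filter_uniq.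
move=> a; rewrite mem_filter => /andP[tw aacc].
have al : a \in l by rewrite /kept E mem_cat aacc orbT.
have [q Eq] := grid_vals (kept_grid al); exists q => //.
by rewrite !inE Eq al /= -union_twinE Eq.
Qed.

Lemma card_twins v : #|[set u in kept_set | twin D u v]| <= k.*2.+1.
Proof.
apply: leq_trans (_ : size [seq b <- l | union_twin ps (grid n t) b (vals v)] <= _).
  rewrite cardE -(size_map vals); apply: uniq_leq_size.
    by rewrite (map_inj_uniq vals_inj) enum_uniq.
  move=> a /mapP[q]; rewrite mem_enum !inE => /andP[ql tw] ->.
  by rewrite mem_filter ql union_twinE tw.
rewrite /kept; pose tws acc := [seq b <- acc | union_twin ps (grid n t) b (vals v)].
rewrite -/(tws _).
have [//] : size (tws l) <= k.*2.+1 /\ {subset l <= grid n t}.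
suff : forall g, {subset g <= grid n t} -> size (tws (greedy (fun acc a =>
    size [seq b <- acc | union_twin ps (grid n t) b a] <= k + k) g)) <= k.*2.+1.
  by move=> H; split; [apply: H | apply: kept_grid].
elim/last_ind => // g a IH sub; rewrite greedy_rcons.
have subg : {subset g <= grid n t}.
  by move=> x xg; apply: sub; rewrite mem_rcons inE xg orbT.
have {}IH := IH subg; case: ifP => oka; last exact: IH.
rewrite /tws /=; case: ifP => twa /=; last exact: IH.
(* The new vertex is a twin of [v], so its twins are those of [v], and the test it has just passed
   is a test on the class of [v]. *)
rewrite ltnS -addnn; apply: leq_trans oka; rewrite leq_eqVlt; apply/orP; left; apply/eqP.
have [q Eq] : exists q, vals q = a by apply: grid_vals; apply: sub; rewrite mem_rcons mem_head.
congr size; apply: eq_in_filter => b /greedy_sub bg.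
have [r Er] : exists r, vals r = b.
  by apply: grid_vals; apply: sub; rewrite mem_rcons inE bg orbT.
move: twa; rewrite -Eq -Er !union_twinE => /twinP twa.
by apply/twinP/twinP => H z; rewrite H ?twa.
Qed.

Lemma size_kept c : editable D c -> size l <= k.*2.+1 * (c * k.*2.*2.+4.*2).
Proof.
move=> ed; apply: leq_trans (_ : #|kept_set| <= _).
  apply: vals_sub_card kept_uniq _ => a al.
  by have [q Eq] := grid_vals (kept_grid al); exists q; rewrite // inE Eq.
rewrite -sum1_card (partition_big_imset (nbh D)) /=.
apply: leq_trans (_ : \sum_(S in nbh D @: kept_set) k.*2.+1 <= _).
  apply: leq_sum => S /imsetP[v vl ->]; apply: leq_trans (card_twins v).
  rewrite sum1dep_card; apply: subset_leq_card; apply/subsetP => u.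
  rewrite !inE => /andP[-> /eqP E]; apply/twinP => z.
  by move/setP/(_ z): E; rewrite !inE.
rewrite sum_nat_const mulnC leq_mul2l; apply/orP; right.
apply: leq_trans (card_classes ed); apply: subset_leq_card; exact: imsetS (subsetT _).
Qed.

Lemma brel_union (i j : 'I_(size l)) :
  @brel (size l) (union_bmat ps l) i j = union_entry ps (nth (0, 0) l i) (nth (0, 0) l j).
Proof.
by rewrite /brel /bentry /union_bmat (nth_map (0, 0)) // (nth_map (0, 0)).
Qed.

Lemma kept_vals : exists f : 'I_(size l) -> 'I_t * 'I_n,
  [/\ injective f,
      @brel (size l) (union_bmat ps l) =2 relpre f (inside D kept_set) &
      forall p, p \in kept_set -> p \in codom f].
Proof.
have [i|f Ef] := @fin_all_exists _ (fun=> ('I_t * 'I_n)%type)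
    (fun (i : 'I_(size l)) q => vals q = nth (0, 0) l i).
  exact: grid_vals (kept_grid (mem_nth (0, 0) (ltn_ord i))).
exists f; split.
- move=> i j E; apply/val_inj/eqP => /=.
  by rewrite -(nth_uniq (0, 0) (ltn_ord i) (ltn_ord j) kept_uniq) -!Ef E.
- move=> i j; rewrite brel_union /= -!Ef union_entryE /inside !inE !Ef.
  by rewrite !mem_nth.
- move=> p; rewrite inE => pl; apply/codomP.
  have lt : index (vals p) l < size l by rewrite index_mem.
  by exists (Ordinal lt); apply: vals_inj; rewrite Ef /= nth_index.
Qed.

Lemma sgraph_union : sgraph (@brel (size l) (union_bmat ps l)).
Proof.
have [Ds Di] := sgraph_inside kept_set sgraph_pieces_union.
have [f [_ E _]] := kept_vals.
by split=> [i j|i]; rewrite !E /= ?Di // Ds.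
Qed.

Lemma editable_union :
  editable (@brel (size l) (union_bmat ps l)) k.*2 <-> editable (@brel n m0) k.*2.
Proof.
have [f [f_inj E cod]] := kept_vals.
apply: iff_trans (editable_pieces_union _).
apply: iff_trans; last exact: iff_sym (editable_keep sgraph_pieces_union kept_twins).
apply: (editable_embed f_inj _ E) => q r /and3P[qX rX _].
by rewrite !cod.
Qed.

End Union.

(** * Encodings and the theorem *)

Lemma binaryS k : 0 < k -> binary k = odd k :: binary k./2.
Proof.
move=> k0; rewrite /binary up_log2S // /mkseq /= divn1; congr (_ :: _).
rewrite (iotaDl 1 0) -map_comp; apply: eq_map => i /=.
by rewrite expnS divnMA divn2.
Qed.

Definition bits_value (l : seq bool) : nat := foldr (fun (b : bool) v => b + v.*2) 0 l.

Lemma binaryK k : bits_value (binary k) = k.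
Proof.
elim/ltn_ind: k => -[//|k] IH; rewrite binaryS // [bits_value _]/bits_value /=.
by rewrite -/(bits_value _) IH -?[uphalf k]/(k.+1./2) ?(odd_double_half k.+1) //; lia.
Qed.

Lemma incr_bits_cons b l :
  incr_bits (b :: l) = if b then false :: incr_bits l else true :: l.
Proof.
rewrite /incr_bits !foldl_rev /=.
suff -> : (foldr (fun b p => (b :: p.1, if b then false :: p.2 else true :: p.1))
  ([::], [:: true]) l).1 = l by [].
by elim: l => //= a l ->.
Qed.

Lemma incr_bits_binary k : incr_bits (binary k) = binary k.+1.
Proof.
elim/ltn_ind: k => -[//|k] IH; rewrite binaryS // incr_bits_cons.
rewrite (@binaryS k.+2) // IH; last by lia.
have [ok|ok] := boolP (odd k.+1).
  by congr (_ :: binary _); move: ok; rewrite /= ?negbK => ok; lia.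
by congr (_ :: binary _); move: ok; rewrite /= ?negbK => ok; lia.
Qed.

Lemma bits_of_binary k : bits_of k = binary k.
Proof. by elim: k => // k IH; rewrite /bits_of iterS -/(bits_of k) IH incr_bits_binary. Qed.

Lemma capped_valueE c l : capped_value c l = minn c (bits_value l).
Proof.
rewrite /capped_value foldl_rev; elim: l => [|b l IH] /=; first by rewrite minn0.
by rewrite IH; case: b; lia.
Qed.

Lemma binary_ones N : binary (2 ^ N).-1 = nseq N true.
Proof.
elim: N => // N IH; have p : 0 < 2 ^ N by rewrite expn_gt0.
rewrite expnS mul2n binaryS; last by lia.
have -> : (2 ^ N).*2.-1 = (2 ^ N).-1.*2.+1 by lia.
by rewrite /= odd_double uphalf_double IH.
Qed.

Definition square (m : bmat) := all (fun r => size r == size m) m.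

Lemma square_mk m : square m -> mk_bmat (size m) (bentry m) = m.
Proof.
move=> /allP sq; apply: (@eq_from_nth _ [::]); first by rewrite size_mk_bmat.
rewrite size_mk_bmat => i lt; rewrite (nth_map 0) ?size_iota // nth_iota // add0n.
have /eqP sz := sq _ (mem_nth [::] lt).
apply: (@eq_from_nth _ false); rewrite size_map size_iota // => j lj.
by rewrite (nth_map 0) ?size_iota // nth_iota.
Qed.

Definition graph_of_bmat (m : bmat) : graph := Graph (rel_edgesP (@brel (size m) m)).

Definition bmat_of_graph (G : graph) : bmat :=
  [seq [seq adj (edges G) i j | j <- enum 'I_(nvertices G)] | i <- enum 'I_(nvertices G)].

Lemma enc_graphE G : enc_graph G = encode (bmat_of_graph G).
Proof. by []. Qed.

Lemma mk_bmat_enum n f :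
  [seq [seq f (val i) (val j) | j <- enum 'I_n] | i <- enum 'I_n] = mk_bmat n f.
Proof.
rewrite /mk_bmat -val_enum_ord -map_comp; apply: eq_map => i /=.
by rewrite -map_comp.
Qed.

Lemma bmat_of_graphK m : square m -> sgraph (@brel (size m) m) ->
  bmat_of_graph (graph_of_bmat m) = m.
Proof.
move=> sq sg; rewrite -[RHS](square_mk sq) -mk_bmat_enum /bmat_of_graph /=.
by apply: eq_map => i; apply: eq_map => j; rewrite adj_rel_edges.
Qed.

Lemma size_bmat_of_graph G : size (bmat_of_graph G) = nvertices G.
Proof. by rewrite size_map size_enum_ord. Qed.

Lemma brel_bmat_of_graph G : @brel (nvertices G) (bmat_of_graph G) =2 adj (edges G).
Proof.
move=> i j; rewrite /brel /bentry /bmat_of_graph (nth_map i) ?size_enum_ord //.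
by rewrite (nth_map j) ?size_enum_ord // !nth_ord_enum.
Qed.

Lemma editable_graph G k :
  cograph_edge_edition G k <-> editable (@brel (nvertices G) (bmat_of_graph G)) k.*2.
Proof.
apply: iff_trans (edge_editionE G k) _.
by split; apply: eq_editable => i j; rewrite brel_bmat_of_graph.
Qed.

Lemma no_instanceP : ~ editable (@brel 4 p4_bmat) 0.
Proof.
case=> h [_ p4h]; rewrite leqn0 => /eqP d0.
have E i j : @brel 4 p4_bmat i j = h i j.
  move/eqP: d0; rewrite /dist sum_nat_eq0 => /forallP/(_ i)/implyP/(_ isT).
  by rewrite sum_nat_eq0 => /forallP/(_ j)/implyP/(_ isT); case: (brel _ _); case: (h i j).
have /negP := p4h (inord 0) (inord 1) (inord 2) (inord 3); apply.
by rewrite /p4 -!E /brel !inordK.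
Qed.

(** The 4 makes room for [no_instance], which is also returned at budget 0. *)
Definition kernel_spec n (m : bmat) k (r : bmat * seq bool) := exists k',
  [/\ r.2 = binary k' /\ k' <= k, square r.1, sgraph (@brel (size r.1) r.1),
      editable (@brel n m) k.*2 <-> editable (@brel (size r.1) r.1) k'.*2 &
      size r.1 <= maxn 4 (96 * k ^ 3)].

Lemma sgraph_p4_bmat : sgraph (@brel 4 p4_bmat).
Proof.
split=> [i j|i]; rewrite !brel_mk; first by rewrite orbC.
by rewrite -addn1 -[X in _ == X]addn0 eqn_add2l.
Qed.

Lemma no_instance_spec n m k : ~ editable (@brel n m) k.*2 ->
  kernel_spec n m k no_instance.
Proof.
move=> ne; exists 0; split=> //.
- exact: sgraph_p4_bmat.
- by split=> // /no_instanceP.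
- by rewrite leq_max.
Qed.

Lemma kernel_algP n m k : size m = n -> sgraph (@brel n m) ->
  kernel_spec n m k (kernel_alg (m, binary k)).
Proof.
move=> sz sg; rewrite /kernel_alg /kernel_of /= capped_valueE binaryK sz.
case: leqP => nk.
  (* The budget reaches n^2: removing all edges is affordable, so the empty graph with budget 0 is
     an equivalent instance. *)
  exists 0; split=> //; first by split=> -[].
    split=> _.
      exists (fun _ _ => false); split=> //.
      by rewrite /dist big1 // => -[].
    exists (fun _ _ => false); split=> //.
    apply: leq_trans (_ : n * n <= _); last by move: nk; rewrite leq_min leqnn /=; lia.
    by rewrite dist_card; apply: leq_trans (max_card _) _; rewrite card_prod !card_ord.
(* Below the cap the capped value is k itself. *)
rewrite (minn_idPr _); last by move: nk; rewrite gtn_min ltnn /=; apply: ltnW.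
have := sunflower_loopP k sz sg; case: (sunflower_loop m k) => m1 [k1 b].
rewrite /loop_ok /after_sunflowers /=; case: b; last exact: no_instance_spec.
case=> sz1 sg1 le1 light E; rewrite /reduce sz1.
case: ifP => le; last first.
  apply: no_instance_spec => /E ed; move/negP: le; apply.
  have := size_kept sz1 sg1 light (proj2 (editable_pieces_union sz1 sg1 _) ed).
  (* At distance 2k the bound of [size_kept] is the product of 2k+1, 2k and 8k+8. For k > 0 these
     are at most 3k, 2k and 16k, whence 96; for k = 0 the product vanishes. *)
  move/leq_trans; apply; clear; rewrite -!muln2.
  by case: k1 => // k; nia.
exists k1; split.
- by rewrite bits_of_binary.
- by rewrite /square; apply/allP => _ /mapP[a _ ->]; rewrite !size_map.
- by rewrite size_map; apply: sgraph_union sz1 sg1.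
- by rewrite size_map; apply: iff_trans E _; apply: iff_sym; apply: editable_union sz1 sg1.
- rewrite size_map leq_max; apply/orP; right; apply: leq_trans le _.
  by rewrite leq_mul2l /= !expnS expn0 muln1 !leq_mul.
Qed.

(** The digits returned always form a canonical [binary] expansion and the matrix a square one of a
    simple graph, so encoding the decoded pair again yields the output of the program. *)
Definition kernel (x : graph * nat) : graph * nat :=
  let r := kernel_alg (bmat_of_graph x.1, binary x.2) in (graph_of_bmat r.1, bits_value r.2).

Lemma kernel_graphP G k :
  kernel_spec (nvertices G) (bmat_of_graph G) k (kernel_alg (bmat_of_graph G, binary k)).
Proof.
apply: kernel_algP; first exact: size_bmat_of_graph.
by apply: eq_sgraph (adj_sgraph (edgesP G)) => i j; rewrite brel_bmat_of_graph.
Qed.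

Lemma polytime_kernel :
  polytime (enc_pair enc_graph enc_nat) (enc_pair enc_graph enc_nat) kernel.
Proof.
have [p [t [[d Ht] H]]] := ptime_kernel_alg.
exists (p 0), (2 ^ d), d => -[G k].
have [|s' [n [ex le E _]]] := H (bmat_of_graph G, binary k) 0
  (init (enc_pair enc_graph enc_nat (G, k))); first by [].
exists n; last first.
  apply: leq_trans le (leq_trans (Ht _) _).
  have -> : dsize (enc_pair enc_graph enc_nat (G, k)) = esz (bmat_of_graph G, binary k) by [].
  (* Passes from the base of [pbound] to that of [polytime]: z+1 is at most 2z. *)
  have aux z : 0 < z -> z.+1 ^ d <= 2 ^ d * z ^ d + 2 ^ d.
    move=> z0; apply: leq_trans (_ : (2 * z) ^ d <= _); last by rewrite expnMn leq_addr.
    by case: (d) => // d'; rewrite leq_exp2r // mul2n -addnn -addn1 leq_add2l.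
  by apply: aux; apply: esz_gt0.
exists s' => //; rewrite E; have [k' [[E2 _] sq sg _ _]] := kernel_graphP G k.
rewrite /enc_pair /= enc_graphE bmat_of_graphK //.
by rewrite /encode /= /encodable_prod /enc_pair /= E2 binaryK.
Qed.

(** Chosen to be trivial to compute: its binary digits are all ones, six for each digit of k and 17
    more. If P is the least power of 2 above k, at most Z = 128 P^3 vertices remain and the matrix
    has size at most 4 Z^2 + 2 Z + 1 < 8 Z^2 = 2^17 P^6. *)
Definition size_bound k := (2 ^ (up_log 2 k.+1 * 6 + 17)).-1.

Lemma computable_size_bound : computable enc_nat enc_nat size_bound.
Proof.
pose g (l : seq bool) := flatten [seq nseq 6 true | _ <- l] ++ nseq 17 true.
have pm : ptime (fun l : seq bool => [seq nseq 6 true | _ <- l]).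
  by apply: (ptime_map (l := fun l => l) (f := fun (_ : seq bool) _ => nseq 6 true)); ptime_auto.
have pg : ptime g by apply: ptime_cat (ptime_flatten pm) (ptime_const _).
have [p [t [_ H]]] := pg; exists (p 0) => k.
have [|s' [n [ex _ E _]]] := H (binary k) 0 (init (enc_nat k)); first by [].
exists n, s' => //; rewrite E /enc_nat /size_bound binary_ones /encode /=; congr (enc_seq _ _).
rewrite /g nseqD; congr (_ ++ _).
rewrite -[X in nseq (X * _)](size_mkseq (fun i => odd (k %/ 2 ^ i))) -/(binary k).
by elim: (binary k) => //= b l ->.
Qed.

Lemma size_boundP n k : n <= maxn 4 (96 * k ^ 3) -> (n * (n * 4).+2).+1 <= size_bound k /\ k <= size_bound k.
Proof.
rewrite /size_bound expnD expnM; set P := 2 ^ _.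
have kP : k < P by apply: up_logP.
move=> le; have P0 : 0 < P by apply: leq_trans kP.
have P3 : k ^ 3 <= P ^ 3 by rewrite leq_exp2r // ltnW.
have P1 : 0 < P ^ 3 by rewrite expn_gt0 P0.
have n128 : n <= 128 * P ^ 3 by move: le; rewrite leq_max => /orP[]; lia.
have PP : P ^ 6 = P ^ 3 * P ^ 3 by rewrite -expnD.
have kP3 : k <= P ^ 3 by apply: leq_trans (ltnW kP) _; rewrite -{1}[P]expn1 leq_pexp2l.
rewrite PP; move: (P ^ 3) P1 n128 kP3 => Q Q1 nQ kQ.
have -> : Q * Q * 2 ^ 17 = 8 * ((128 * Q) * (128 * Q)).
  rewrite -[17]/(3 + 7 + 7) !expnD -[2 ^ 3]/8 -[2 ^ 7]/128; move: 128 => w.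
  by rewrite mulnC -!mulnA; congr (_ * _); rewrite mulnCA mulnA mulnA -mulnA.
have QZ : Q <= 128 * Q by rewrite leq_pmull.
move: (128 * Q) nQ QZ => Z nZ QZ.
have nn : n * n <= Z * Z by apply: leq_mul.
have ZZ : Z <= Z * Z by rewrite leq_pmull // (leq_trans Q1).
have -> : n * (n * 4).+2 = 4 * (n * n) + 2 * n by nia.
by move: (n * n) (Z * Z) nn ZZ => u v nn ZZ; split; lia.
Qed.

Lemma esz_square m : square m -> esz m <= (size m * (size m * 4).+2).+1.
Proof. by move=> sq; rewrite -{1}(square_mk sq); apply: esz_mk_bmat. Qed.

Theorem theorem3p12 :
  exists K : graph * nat -> graph * nat,
    kernelization enc_graph cograph_edge_edition K /\
    exists C k0 : nat, forall (G : graph) (k : nat),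
      k0 <= k -> nvertices (K (G, k)).1 <= C * k ^ 3.
Proof.
exists kernel; split; last first.
  (* The four vertices of the fixed negative instance exceed 96 k^3 only for k = 0. *)
  exists 96, 1 => G k k1; have [k' [_ _ _ _]] := kernel_graphP G k.
  rewrite leq_max => /orP[le|//]; apply: leq_trans le _.
  have k3 : 0 < k ^ 3 by rewrite expn_gt0 k1.
  by lia.
split; first exact: polytime_kernel.
  move=> G k; have [k' [[E2 _] sq sg E _]] := kernel_graphP G k.
  apply: iff_trans (editable_graph G k) _; apply: iff_trans E _.
  apply: iff_sym; rewrite /kernel /= E2 binaryK.
  by apply: iff_trans (editable_graph _ _) _; rewrite bmat_of_graphK.
exists size_bound; first exact: computable_size_bound.
move=> G k; have [k' [[E2 k'k] sq sg _ sz]] := kernel_graphP G k.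
have [b1 b2] := size_boundP sz; rewrite /kernel /= E2 binaryK enc_graphE bmat_of_graphK //.
by split; [apply: leq_trans (esz_square sq) b1 | apply: leq_trans k'k b2].
Qed.
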